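(* Let $d\in\mathbb N$, $a\in\mathbb R$, $b\in[a,\infty)$, let $\mu\colon\mathcal B([a,b]^d)\to[0,\infty]$ be a measure, let $f\colon[a,b]^d\to\mathbb R$ be continuous, let $\sigma\colon\mathbb R\to\mathbb R$ satisfy $\sigma(x)=\max\{x,0\}$ for all $x\in\mathbb R$, and let $D_h$, $\mathcal L_h\colon\mathbb R^{D_h}\to\mathbb R$ (assumed real-valued) ($h\in\mathbb N_0$) and $\mathscr K\in\mathbb N_0\cup\{\infty\}$ be as defined in the context. Let $p\colon\mathbb R^d\to[0,\infty)$ be continuous, assume $p^{-1}((0,\infty))=(a,b)^d$, assume $\mu(B)=\int_Bp(x)\,dx$ for all $B\in\mathcal B([a,b]^d)$, and let $H,n\in\mathbb N_0$ satisfy $n=\min\{H,\mathscr K\}$. Then there exist $\vartheta_0,\vartheta_1,\dots,\vartheta_n\in\mathbb R^{D_H}$ such that (i) for all $h\in\{0,1,\dots,n\}$, $\vartheta_h$ is a local minimum of $\mathcal L_H$, and (ii) $$\inf_{\xi\in\mathbb R}\int_{[a,b]^d}|f(x)-\xi|^2\,\mu(dx)\ge\mathcal L_H(\vartheta_0)>\mathcal L_H(\vartheta_1)>\dots>\mathcal L_H(\vartheta_n).$$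
   Context: For $h\in\mathbb N_0$ let $D_h=dh+2h+1$; for $\theta\in\mathbb R^{D_h}$, $x\in\mathbb R^d$ let $$\mathcal N_h^\theta(x)=\theta_{dh+2h+1}+\sum_{i=1}^h\theta_{dh+h+i}\,\sigma\Bigl(\theta_{dh+i}+\sum_{j=1}^d\theta_{(i-1)d+j}x_j\Bigr);$$ $\mathcal L_h(\theta)=\int_{[a,b]^d}(\mathcal N_h^\theta(x)-f(x))^2\,\mu(dx)$, where $\mathcal L_h\colon\mathbb R^{D_h}\to\mathbb R$ is assumed real-valued for every $h\in\mathbb N_0$ (so $\mu$ is finite); $\mathbb I_h=\inf_{\theta\in\mathbb R^{D_h}}\mathcal L_h(\theta)$; $\mathscr K=\inf(\{h\in\mathbb N_0\colon\mathbb I_h=0\}\cup\{\infty\})$. *)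

(* Defs.v *)
From HB Require Import structures.
From mathcomp Require Import all_boot all_order all_algebra.
From mathcomp Require Import all_classical all_reals all_analysis.
From mathcomp Require Import measurable_realfun.

Set Implicit Arguments.
Unset Strict Implicit.
Unset Printing Implicit Defensive.

Import Order.TTheory GRing.Theory Num.Theory.
Import numFieldNormedType.Exports.

Local Open Scope classical_set_scope.
Local Open Scope ring_scope.

Section borel_rV.
Variables (R : realType) (n : nat).

HB.instance Definition _ :=
  @isMeasurable.Build (sigma_display (@open 'rV[R]_n)) 'rV[R]_n
    <<s @open 'rV[R]_n >>
    (@sigma_algebra0 _ setT _) (@sigma_algebraC _ _)
    (@sigma_algebra_bigcup _ setT _).

Lemma measurable_rVE : @measurable _ 'rV[R]_n = <<s open >>.
Proof. by []. Qed.

Lemma measurable_rV_open (A : set 'rV[R]_n) : open A -> measurable A.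
Proof. exact: sub_sigma_algebra. Qed.

Lemma measurable_fun_rV_coord (i : 'I_n) :
  measurable_fun setT (fun x : 'rV[R]_n => x ord0 i).
Proof.
apply: (measurability _ (RGenOpens.measurableE R)) => _ [_ [a [b ->]] <-].
rewrite setTI; apply: measurable_rV_open.
by apply: open_comp => [x _|]; [exact: coord_continuous|exact: interval_open].
Qed.

Lemma measurable_fun_rVP d (T : measurableType d) (f : T -> 'rV[R]_n) :
  (forall i, measurable_fun setT (fun t => f t ord0 i)) -> measurable_fun setT f.
Proof.
move=> mf; apply: (measurability _ measurable_rVE) => _ [U oU <-]; rewrite setTI.
pose Q := ('rV[rat]_n * nat)%type.
pose r (q : Q) : 'rV[R]_n := map_mx (@ratr R) q.1.
pose B (q : Q) := ball (r q) q.2.+1%:R^-1.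
have -> : f @^-1` U = \bigcup_(q in [set: Q])
    (if `[< B q `<=` U >] then f @^-1` B q else set0).
  apply/seteqP; split => [t Ut|t [q _]]; last by case: asboolP => // + Bt; exact.
  have /nbhs_ballP[e e0 eU] := open_nbhs_nbhs (conj oU Ut).
  have [k ke] : exists k : nat, k.+1%:R^-1 < e / 2.
    have e20 : 0 < (e / 2)^-1 by rewrite invr_gt0 divr_gt0.
    exists (Num.truncn (e / 2)^-1); rewrite invf_plt ?posrE ?divr_gt0//.
    exact: truncnS_gt.
  have k0 : 0 < k.+1%:R^-1 :> R by rewrite invr_gt0.
  have /choice[q qP] : forall i, exists q : rat,
      `|ratr q - f t ord0 i| < k.+1%:R^-1.
    move=> i.
    have : f t ord0 i - k.+1%:R^-1 < f t ord0 i + k.+1%:R^-1.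
      by rewrite ltrBlDr -addrA ltrDl addr_gt0.
    by move=> /rat_in_itvoo[q]; rewrite in_itv/= -ltr_distl; exists q.
  have Bt : B (\row_i q i, k) (f t).
    by split => [|i j]; [exact: k0|rewrite ord1 !mxE; exact: qP].
  exists (\row_i q i, k) => //; case: asboolP => // -[].
  move=> y By; apply: eU; rewrite (splitr e).
  apply: (@ball_triangle _ _ (r (\row_i q i, k))).
    by apply/ball_sym/(le_ball (ltW ke)).
  exact: (le_ball (ltW ke)).
apply: countable_bigcupT_measurable => [|q]; first exact: countableP.
case: ifPn => // _.
have -> : f @^-1` B q =
    \bigcap_(i in [set: 'I_n]) ((fun t => f t ord0 i) @^-1` ball (r q ord0 i) q.2.+1%:R^-1).
  apply/seteqP; split => [t [_ /= Bt] i _|t Bt]; first exact: Bt.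
  by split => [|i j]; [rewrite invr_gt0|rewrite ord1; exact: Bt].
apply: fin_bigcap_measurable => // i _.
by rewrite -[X in measurable X]setTI; apply: mf => //; exact: measurable_ball.
Qed.

End borel_rV.

Definition rv_cons (R : realType) (n : nat) (p : measurableTypeR R * 'rV[R]_n) :
    'rV[R]_n.+1 :=
  \row_i oapp (p.2 ord0) p.1 (unlift ord0 i).

Fixpoint lebesgue_rV (R : realType) (n : nat) : set 'rV[R]_n -> \bar R :=
  match n return set 'rV[R]_n -> \bar R with
  | 0 => \d_(0 : 'rV[R]_0)
  | n'.+1 => pushforward (lebesgue_measure \x @lebesgue_rV R n')%E
               (@rv_cons R n')
  end.

Arguments lebesgue_rV {R} n A.

Section lebesgue_rV.
Variable R : realType.

Lemma measurable_rv_cons n : measurable_fun setT (@rv_cons R n).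
Proof.
apply: measurable_fun_rVP => i; under eq_fun do rewrite mxE.
case: unliftP => [j|] _ /=; last first.
  by move=> mT A mA; exact: (@measurable_fst _ _ (measurableTypeR R) 'rV[R]_n mT A mA).
apply: (@measurableT_comp _ _ _ _ _ _ (fun v : 'rV[R]_n => v ord0 j)) => //.
exact: measurable_fun_rV_coord.
Qed.

Let rv_uncons n (v : 'rV[R]_n.+1) : measurableTypeR R * 'rV[R]_n :=
  (v ord0 ord0, \row_i v ord0 (lift ord0 i)).

Let rv_consK n : cancel (@rv_cons R n) (@rv_uncons n).
Proof.
move=> [x v]; rewrite /rv_uncons /rv_cons mxE unlift_none; congr pair.
by apply/rowP => i; rewrite !mxE liftK.
Qed.

Let measurable_rv_uncons n : measurable_fun setT (@rv_uncons n).
Proof.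
apply: measurable_fun_pair; first exact: measurable_fun_rV_coord.
apply: measurable_fun_rVP => i; under eq_fun do rewrite mxE.
exact: measurable_fun_rV_coord.
Qed.

Let lebesgue_rV_subproof n : [/\ @lebesgue_rV R n set0 = 0%E,
  forall A, (0 <= @lebesgue_rV R n A)%E,
  semi_sigma_additive (@lebesgue_rV R n) &
  sigma_finite setT (@lebesgue_rV R n)].
Proof.
elim: n => [|n [leb0 leb_ge0 leb_sigma leb_sfin]] /=.
  split; first exact: measure0.
  - exact: measure_ge0.
  - exact: measure_semi_sigma_additive.
  - by apply: fin_num_fun_sigma_finite => //; rewrite measure0.
pose M := isMeasure.Build _ _ _ (lebesgue_rV n) leb0 leb_ge0 leb_sigma.
pose m0 : {measure set 'rV[R]_n -> \bar R} := HB.pack (lebesgue_rV n) M.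
pose S := Measure_isSigmaFinite.Build _ _ _ m0 leb_sfin.
pose m : {sigma_finite_measure set 'rV[R]_n -> \bar R} :=
  HB.pack (lebesgue_rV n) M S.
have mcons A : measurable A -> measurable (@rv_cons R n @^-1` A).
  by move=> mA; rewrite -[X in measurable X]setTI; exact: measurable_rv_cons.
pose P : {measure set (measurableTypeR R * 'rV[R]_n)%type -> \bar R} :=
  (lebesgue_measure \x m)%E.
rewrite -[(_ \x _)%E]/(P : set _ -> _).
split.
- by rewrite /pushforward preimage_set0 measure0.
- by move=> A; rewrite /pushforward measure_ge0.
- move=> F mF tF mUF; rewrite /pushforward preimage_bigcup.
  apply: measure_semi_sigma_additive.
  + by move=> k; exact: mcons.
  + apply/trivIsetP => i j _ _ ij; rewrite -preimage_setI.
    by move/trivIsetP : tF => /(_ _ _ _ _ ij) ->//; rewrite preimage_set0.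
  + by rewrite -preimage_bigcup; exact: mcons.
- have /sigma_finiteP[F [FT ndF Ffin]] := sigma_finiteT (@lebesgue_measure R).
  have /sigma_finiteP[G [GT ndG Gfin]] := sigma_finiteT m.
  exists (fun k => @rv_uncons n @^-1` (F k `*` G k)).
    rewrite -preimage_bigcup (_ : \bigcup_k (F k `*` G k) = setT)//.
    rewrite -subTset => -[x y] _.
    have [k _ Fx] : (\bigcup_k F k) x by rewrite -FT.
    have [l _ Gy] : (\bigcup_k G k) y by rewrite -GT.
    exists (maxn k l) => //; split => /=.
      by move: x Fx; exact/subsetPset/ndF/leq_maxl.
    by move: y Gy; exact/subsetPset/ndG/leq_maxr.
  move=> k; have [mF Foo] := Ffin k; have [mG Goo] := Gfin k; split.
    by rewrite -[X in measurable X]setTI; apply: measurable_rv_uncons => //;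
      exact: measurableX.
  rewrite /pushforward -comp_preimage (_ : _ \o _ = id); last first.
    by apply/funext => p; exact: rv_consK.
  rewrite preimage_id /P [ltLHS]product_measure1E// lte_mul_pinfty//.
  by rewrite ge0_fin_numE.
Qed.

Let lebesgue_rV0 n : lebesgue_rV n set0 = 0%E :> \bar R.
Proof. by have [] := lebesgue_rV_subproof n. Qed.

Let lebesgue_rV_ge0 n (A : set 'rV[R]_n) : (0 <= lebesgue_rV n A)%E.
Proof. by have [] := lebesgue_rV_subproof n. Qed.

Let lebesgue_rV_sigma_additive n : semi_sigma_additive (@lebesgue_rV R n).
Proof. by have [] := lebesgue_rV_subproof n. Qed.

Let lebesgue_rV_sigma_finite n : sigma_finite setT (@lebesgue_rV R n).
Proof. by have [] := lebesgue_rV_subproof n. Qed.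

HB.instance Definition _ n := isMeasure.Build _ _ _ (@lebesgue_rV R n)
  (@lebesgue_rV0 n) (@lebesgue_rV_ge0 n) (@lebesgue_rV_sigma_additive n).

HB.instance Definition _ n := Measure_isSigmaFinite.Build _ _ _
  (@lebesgue_rV R n) (@lebesgue_rV_sigma_finite n).

Lemma measurable_rV_box n (u v : 'I_n -> R) :
  measurable [set x : 'rV[R]_n | forall i, x ord0 i \in `[u i, v i]].
Proof.
rewrite [X in measurable X](_ : _ = \bigcap_(i in [set: 'I_n])
    ((fun x : 'rV[R]_n => x ord0 i) @^-1` `[u i, v i]%classic)); last first.
  by apply/seteqP; split => x /= xuv i; [move=> _|]; exact: xuv.
apply: fin_bigcap_measurable => // i _.
by rewrite -[X in measurable X]setTI; exact: measurable_fun_rV_coord.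
Qed.

Lemma lebesgue_rV_box n (u v : 'I_n -> R) : (forall i, u i <= v i) ->
  lebesgue_rV n [set x | forall i, x ord0 i \in `[u i, v i]] =
  (\prod_(i < n) (v i - u i))%:E.
Proof.
elim: n u v => [|n ih] u v uv /=.
  by rewrite big_ord0 diracE mem_set// => -[].
pose u' i := u (lift ord0 i); pose v' i := v (lift ord0 i).
rewrite /pushforward (_ : _ @^-1` _ = `[u ord0, v ord0]%classic `*`
    [set x : 'rV[R]_n | forall i, x ord0 i \in `[u' i, v' i]]); last first.
  apply/seteqP; split => -[x y] /=.
    move=> xyuv; split => [|i].
      by have := xyuv ord0; rewrite mxE unlift_none.
    by have := xyuv (lift ord0 i); rewrite mxE liftK.
  move=> [xuv yuv] i; rewrite mxE.
  by case: unliftP => [j|] ->; [exact: yuv|exact: xuv].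
rewrite [LHS]product_measure1E//; last exact: measurable_rV_box.
rewrite [X in (X * _)%E]lebesgue_measure_itv/= [X in (_ * X)%E]ih; last first.
  by move=> i; exact: uv.
rewrite big_ord_recl EFinM; congr (_ * _)%E.
have := uv ord0; rewrite le_eqVlt lte_fin => /predU1P[->|->//].
by rewrite ltxx subrr.
Qed.

End lebesgue_rV.

Section shallow_network.
Variable R : realType.

(* The number of parameters, d * h + 2 * h + 1. *)
Definition nn_dim (d h : nat) : nat := (d * h + 2 * h).+1.

(* Parameters and neurons are numbered from 0: the entries of th are, in order,
   the inner weights (row by row), the inner biases, the outer weights and the
   outer bias. *)
Definition nn (sigma : R -> R) (d h : nat) (th : 'rV[R]_(nn_dim d h))
    (x : 'rV[R]_d) : R :=
  let t (k : nat) : R := th ord0 (inord k) in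
  t (d * h + 2 * h)%N +
  \sum_(i < h) t (d * h + h + i)%N *
    sigma (t (d * h + i)%N + \sum_(j < d) t (i * d + j)%N * x ord0 j).

End shallow_network.

Definition cube (R : realType) (d : nat) (a b : R) : set 'rV[R]_d :=
  [set x | forall i, x ord0 i \in `[a, b]].

Definition open_cube (R : realType) (d : nat) (a b : R) : set 'rV[R]_d :=
  [set x | forall i, x ord0 i \in `]a, b[].

Arguments cube {R} d a b.
Arguments open_cube {R} d a b.

Definition local_minimum (R : realType) (T : topologicalType) (L : T -> R)
    (x : T) : Prop :=
  \forall y \near x, L x <= L y.

(* Elements of N u {oo} are represented as extended reals. *)
Definition least_width (R : realType) (d : nat)
    (L : forall h, 'rV[R]_(nn_dim d h) -> R) : \bar R :=
  ereal_inf ([set h%:R%:E | h in [set h | inf (range (L h)) = 0]] `|`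
             [set +oo%E]).

(* Main.v *)
Require Import Defs.
From HB Require Import structures.
From mathcomp Require Import all_boot all_order all_algebra.
From mathcomp Require Import all_classical all_reals all_analysis.
From mathcomp Require Import measurable_realfun zify lra ring.

(* Every infimum I_h is attained, and I_(h+1) < I_h as soon as I_h > 0; so one may take for
   the h-th point a minimizer of L_h padded with H - h dead neurons, which stay inactive on
   the cube under small perturbations.

   Strict descent: if no (h+1)-st neuron improved a minimizer N, then N - f would be orthogonal
   to all relu (l x + t), hence to the hat functions of affine forms, to their uniform limits
   exp (l x + t), and to the powers of C - sum_i 2 cosh (x_i - y_i), which concentrate at y.

   Attainment: normalise the inner parameters of a minimizing sequence to norm 1 and pass to
   the limit along an ultrafilter. Neurons whose limiting hyperplanes coincide may combine
   into a jump 1_(al > 0) A, so the limit is in general discontinuous. Replace each jump by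
   the steep ramp relu (l + A / 2) - relu (l - A / 2) with l = eta al / e + s v, of cost 2.
   For s = 1 and s = -1 the first-order effects of the two ramps cancel by the reflection of
   the transition layer, what remains is negative of order e, and so the losses of the two
   ramped functions add up to less than twice the loss of the limit. Either no jump occurs,
   or a network of width h beats the infimum. *)

Set Implicit Arguments.
Unset Strict Implicit.
Unset Printing Implicit Defensive.

Import Order.TTheory GRing.Theory Num.Theory.
Import numFieldNormedType.Exports.

Local Open Scope classical_set_scope.
Local Open Scope ring_scope.

(** * Lebesgue measure under affine maps *)

(** The functions of width h do not form a closed set: two neurons with nearly equal hyperplanes and
    huge opposite weights tend to a jump. A jump uses up at least two neurons, because a single
    unbounded weight would make the coefficient of its class unbounded; so ramps of two neurons each
    fit into the width. What may not fit is the affine part left over when the neurons of a class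
    are reflected to a common orientation. If no neuron is spare, this part has to be made constant
    by reflecting some of the ramp neurons and by displacing the ramps, which dictates the
    displacement v. For v = 0 the first-order change of the loss cancels for a single ramp, by
    symmetry; a forced v contributes a term of unknown sign, and this is why the ramps for v and - v
    are used together.

    An ultrafilter gives limits to all bounded quantities at once and makes every other real
    quantity either bounded or tend to infinity, so that no successive subsequences have to be
    extracted. *)

Section lebesgue_rV_translation.
Variable R : realType.

Lemma lebesgue_measure_shift (c : R) (A : set (measurableTypeR R)) :
  measurable A ->
  lebesgue_measure ((fun x : measurableTypeR R => x + c) @^-1` A) =
  lebesgue_measure A.
Proof.
move=> mA; apply/esym.
have mc : measurable_fun setT (fun x : measurableTypeR R => (x + c : measurableTypeR R)).
  exact: measurable_funD.
pose phi : {mfun measurableTypeR R >-> measurableTypeR R} :=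
  HB.pack (fun x : measurableTypeR R => (x + c : measurableTypeR R))
    (isMeasurableFun.Build _ _ _ _ _ mc).
apply: (lebesgue_measure_unique (mu := pushforward lebesgue_measure phi)) => //.
move=> _ [[u v] _ <-]; rewrite /pushforward.
rewrite [X in _ = lebesgue_measure X](_ : _ = `]u - c, v - c]%classic); last first.
  by apply/seteqP; split => x /=; rewrite !in_itv/= lerBrDr ltrBlDr.
rewrite [LHS]lebesgue_measure_itv [RHS]lebesgue_measure_itv/= !lte_fin ltrD2r.
by rewrite -!EFinB opprB addrA subrK.
Qed.

Lemma continuous_measurable_rV n m (f : 'rV[R]_n -> 'rV[R]_m) :
  continuous f -> measurable_fun setT f.
Proof.
move=> cf; apply: (measurability _ (@measurable_rVE R m)) => _ [U oU <-].
by rewrite setTI; apply: measurable_rV_open; exact: open_comp.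
Qed.

Lemma continuous_measurable_rVR n (f : 'rV[R]_n -> R) :
  continuous f -> measurable_fun setT f.
Proof.
move=> cf; apply: (measurability _ (RGenOpens.measurableE R)) => _ [_ [a [b ->]] <-].
rewrite setTI; apply: measurable_rV_open.
by apply: open_comp => // *; exact: interval_open.
Qed.

Lemma continuous_shiftr n (c : 'rV[R]_n) : continuous (fun x : 'rV[R]_n => x + c).
Proof. by move=> x; apply: (@continuousD _ _ _ id (cst c)) => //; exact: cst_continuous. Qed.

Lemma lebesgue_rV_shift n (c : 'rV[R]_n) (A : set 'rV[R]_n) :
  measurable A -> lebesgue_rV n ((fun x => x + c) @^-1` A) = lebesgue_rV n A.
Proof.
elim: n c A => [|n ih] c A mA.
  congr (lebesgue_rV 0 _); apply/seteqP; split=> x /=;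
  by have -> : x + c = x by apply/rowP => -[].
pose c' : 'rV[R]_n := \row_i c ord0 (lift ord0 i).
pose T (q : measurableTypeR R * 'rV[R]_n) : measurableTypeR R * 'rV[R]_n :=
  (q.1 + c ord0 ord0, q.2 + c').
have mT : measurable_fun setT T.
  apply: measurable_fun_pair.
    by apply: measurable_funD => //; exact: measurable_fst.
  apply: (@measurableT_comp _ _ _ _ _ _ (fun x : 'rV[R]_n => x + c')); last exact: measurable_snd.
  by apply: continuous_measurable_rV; exact: continuous_shiftr.
pose phi : {mfun (measurableTypeR R * 'rV[R]_n)%type >->
    (measurableTypeR R * 'rV[R]_n)%type} :=
  HB.pack T (isMeasurableFun.Build _ _ _ _ _ mT).
rewrite /= /pushforward.
have mB : measurable (@rv_cons R n @^-1` A).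
  by rewrite -[X in measurable X]setTI; exact: measurable_rv_cons.
rewrite [X in (_ \x _)%E X](_ : _ = T @^-1` (@rv_cons R n @^-1` A)); last first.
  rewrite -comp_preimage; congr (_ @^-1` A); apply/funext => q /=.
  apply/rowP => i; rewrite !mxE/=.
  by case: unliftP => [j|] -> /=; rewrite ?mxE.
pose m' := pushforward (lebesgue_measure \x (@lebesgue_rV R n))%E phi.
apply/esym/(@product_measure_unique _ _ (measurableTypeR R) 'rV[R]_n R
  lebesgue_measure (@lebesgue_rV R n) m') => // C D mC mD.
have mC' : measurable ((fun x : measurableTypeR R => (x + c ord0 ord0 : measurableTypeR R)) @^-1` C).
  by rewrite -[X in measurable X]setTI; apply: measurable_funD.
have mD' : measurable ((fun x => x + c') @^-1` D).
  rewrite -[X in measurable X]setTI; apply: continuous_measurable_rV => //.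
  exact: continuous_shiftr.
rewrite [LHS](product_measure1E _ _ mC' mD').
by congr (_ * _)%E; [exact: lebesgue_measure_shift|exact: ih].
Qed.

End lebesgue_rV_translation.

(** * Linear maps scale Lebesgue measure *)

Section lebesgue_rV_linear.
Variables (R : realType) (n : nat).
Local Notation lam := (@lebesgue_rV R n).

Lemma measurable_mulmxr m (M : 'M[R]_(n, m)) :
  measurable_fun setT (fun x : 'rV[R]_n => x *m M).
Proof.
apply: measurable_fun_rVP => i; under eq_fun do rewrite mxE.
apply: measurable_sum => j; apply: measurable_funM => //.
exact: measurable_fun_rV_coord.
Qed.

Lemma measurable_preimage d1 d2 (T1 : measurableType d1) (T2 : measurableType d2)
    (f : T1 -> T2) (A : set T2) :
  measurable_fun setT f -> measurable A -> measurable (f @^-1` A).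
Proof. by move=> mf mA; rewrite -[X in measurable X]setTI; exact: mf. Qed.

Lemma measurable_shiftr (c : 'rV[R]_n) : measurable_fun setT (fun x : 'rV[R]_n => x + c).
Proof. by apply: continuous_measurable_rV; exact: continuous_shiftr. Qed.

(* Tonelli on {(x, y) | x in E, x + y M in B}. *)
Let lam_mulE (M : 'M[R]_n) (E B : set 'rV[R]_n) : M \in unitmx ->
  measurable E -> measurable B ->
  (lam E * lam ((fun x => x *m M) @^-1` B) =
   \int[lam]_y lam (E `&` ((fun x => (x + y *m M)%R) @^-1` B)))%E.
Proof.
move=> uM mE mB.
pose S : set ('rV[R]_n * 'rV[R]_n) := fst @^-1` E `&` (fun q => q.1 + q.2 *m M) @^-1` B.
have mS : measurable S.
  apply: measurableI; apply: measurable_preimage => //;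
  apply: measurable_fun_rVP => i; under eq_fun do rewrite mxE.
  apply: measurable_funD.
    apply: (@measurableT_comp _ _ _ _ _ _ (fun v : 'rV[R]_n => v ord0 i)).
      exact: measurable_fun_rV_coord.
    exact: measurable_fst.
  apply: (@measurableT_comp _ _ _ _ _ _ (fun v : 'rV[R]_n => (v *m M) ord0 i)); last exact: measurable_snd.
  apply: (@measurableT_comp _ _ _ _ _ _ (fun v : 'rV[R]_n => v ord0 i)).
    exact: measurable_fun_rV_coord.
  exact: measurable_mulmxr.
have := @indic_fubini_tonelli _ _ _ _ R lam lam S mS.
rewrite indic_fubini_tonelli_FE// indic_fubini_tonelli_GE// => H.
transitivity (\int[lam]_x (lam \o xsection S) x)%E; last first.
  rewrite H; apply: eq_integral => y _ /=; congr (lebesgue_rV n _).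
  by rewrite ysectionE.
have mMB : measurable ((fun x => x *m M) @^-1` B).
  exact: measurable_preimage (measurable_mulmxr M) mB.
transitivity (\int[lam]_x (lam ((fun x => x *m M) @^-1` B) * (\1_E x)%:E))%E.
  by rewrite ge0_integralZl// ?integral_indic ?setIT 1?muleC//; exact: measurableT_comp.
apply: eq_integral => x _ /=; rewrite indicE xsectionE.
have [xE|xE] := boolP (x \in E); last first.
  have -> : (fun y => (x, y)) @^-1` S = set0.
    by apply/seteqP; split => // y [/= Ex]; rewrite notin_setE in xE.
  by rewrite measure0 mule0.
(* As x + y M = (x M^-1 + y) M, the section at x is a translate of the preimage of [B]. *)
rewrite mule1 -(lebesgue_rV_shift (x *m invmx M) mMB); congr (lebesgue_rV n _).
apply/seteqP; split => y /=; rewrite mulmxDl mulmxKV// addrC.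
  by move=> By; split=> //; rewrite inE in xE.
by case.
Qed.

(** Translating the y-section in [lam_mulE] by - y M exchanges [E] and [B] and turns M into - M. *)
Let lam_mulC (M : 'M[R]_n) (E B : set 'rV[R]_n) : M \in unitmx ->
  measurable E -> measurable B ->
  (lam E * lam ((fun x => x *m M) @^-1` B) =
   lam B * lam ((fun x => x *m (- M)) @^-1` E))%E.
Proof.
move=> uM mE mB; rewrite !lam_mulE//; last first.
  by rewrite -scaleN1r unitmxZ// unitrN1.
apply: eq_integral => y _.
rewrite -(lebesgue_rV_shift (y *m - M)); last first.
  apply: measurableI => //.
  exact: measurable_preimage (measurable_shiftr _) _.
congr (lebesgue_rV n _); apply/seteqP; split => x /=;
by rewrite mulmxN subrK => -[].
Qed.

Let unit_box : set 'rV[R]_n := [set x | forall i, x ord0 i \in `[0, 1]].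

Let lam_unit_box : lam unit_box = 1%E.
Proof.
by rewrite lebesgue_rV_box// subr0 prodr_const expr1n.
Qed.

(** No determinant is involved: with the unit box for [B], [lam_mulC] gives the scaling law with k
    the measure of a preimage of the box. Applied to the preimage of the box under the inverse of M,
    the law reads k * l = 1, which makes k finite and positive. *)
Lemma lebesgue_rV_linear (M : 'M[R]_n) : M \in unitmx ->
  exists2 k : R, 0 < k & forall E, measurable E ->
    lam ((fun x => x *m M) @^-1` E) = (k%:E * lam E)%E.
Proof.
move=> uM.
have uNM : - M \in unitmx by rewrite -scaleN1r unitmxZ// unitrN1.
have mb : measurable unit_box by exact: measurable_rV_box.
pose k := lam ((fun x => x *m (- M)) @^-1` unit_box).
have kE E : measurable E -> lam ((fun x => x *m M) @^-1` E) = (k * lam E)%E.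
  move=> mE; have := lam_mulC uNM mE mb.
  by rewrite opprK lam_unit_box mul1e => <-; rewrite muleC.
have := kE ((fun x => x *m invmx M) @^-1` unit_box) (measurable_preimage (measurable_mulmxr _) mb).
rewrite (_ : _ @^-1` _ = unit_box); last first.
  by rewrite -comp_preimage; apply/seteqP; split => x /=; rewrite mulmxK.
rewrite lam_unit_box.
have : (0 <= k)%E by exact: measure_ge0.
have : (0 <= lam ((fun x => x *m invmx M) @^-1` unit_box))%E by exact: measure_ge0.
move: k kE (lam _) => [k||]// kE [l||]//.
- move=> l0 k0; rewrite -EFinM => -[kl]; exists k => //.
  rewrite lt_neqAle -lee_fin k0 andbT eq_sym; apply/eqP => k00.
  by move: kl; rewrite k00 mul0r => /eqP; rewrite oner_eq0.
- rewrite lee_fin => l0 k0.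
  have [->|kn0] := eqVneq k 0; first by rewrite mul0e => -[/eqP]; rewrite oner_eq0.
  by rewrite gt0_muley// lte_fin lt_neqAle k0 andbT eq_sym.
- move=> l0 _; move: l0; rewrite lee_fin le_eqVlt => /orP[/eqP<-|l0].
    by rewrite mule0 => -[/eqP]; rewrite oner_eq0.
  by rewrite gt0_mulye.
Qed.

Lemma lebesgue_rV_involution (M : 'M[R]_n) (E : set 'rV[R]_n) :
  M *m M = 1%:M -> measurable E -> lam ((fun x => x *m M) @^-1` E) = lam E.
Proof.
move=> MM mE; have uM : M \in unitmx by case/mulmx1_unit: MM.
have [k k0 kE] := lebesgue_rV_linear uM.
suff k1 : k = 1 by rewrite kE// k1 mul1e.
have mb : measurable unit_box by exact: measurable_rV_box.
have := kE _ (measurable_preimage (measurable_mulmxr M) mb).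
rewrite -comp_preimage (_ : _ \o _ = id); last first.
  by apply/funext => x /=; rewrite -mulmxA MM mulmx1.
rewrite kE// preimage_id lam_unit_box mule1 -EFinM => -[kk].
apply/eqP; rewrite -(@eqrXn2 _ 2)// ?ltW// expr1n expr2; exact/eqP/esym.
Qed.

End lebesgue_rV_linear.

(** * Change of variables for maps that scale a measure *)

Section scaling_map.
Context {R : realType} {d} {T : measurableType d}.
Variables (mu : {measure set T -> \bar R}) (psi : T -> T) (k : R).
Hypotheses (mpsi : measurable_fun setT psi) (k0 : 0 < k).
Hypothesis psiE : forall E, measurable E -> mu (psi @^-1` E) = (k%:E * mu E)%E.

Lemma ge0_integral_scaling_map (F : T -> \bar R) :
  measurable_fun setT F -> (forall x, (0 <= F x)%E) ->
  (\int[mu]_x F (psi x) = k%:E * \int[mu]_x F x)%E.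
Proof.
move=> mF F0.
pose phi : {mfun T >-> T} := HB.pack psi (isMeasurableFun.Build _ _ _ _ _ mpsi).
pose k' : {nonneg R} := NngNum (ltW k0).
have -> : (\int[mu]_x F (psi x) = \int[pushforward mu phi]_x F x)%E.
  by rewrite ge0_integral_pushforward// preimage_setT.
have -> : (\int[pushforward mu phi]_x F x = \int[mscale k' mu]_x F x)%E.
  by apply: eq_measure_integral => A mA _; exact: psiE.
by rewrite ge0_integral_mscale.
Qed.

Lemma integrable_scaling_map (F : T -> R) :
  mu.-integrable setT (EFin \o F) -> mu.-integrable setT (EFin \o (F \o psi)).
Proof.
move=> /integrableP[mF Foo]; apply/integrableP; split.
  exact: (measurableT_comp (f := EFin \o F)).
rewrite (ge0_integral_scaling_map (F := fun x => `|(F x)%:E|%E))//.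
- by rewrite lte_mul_pinfty// ?lee_fin ?ltW.
- exact: measurableT_comp.
Qed.

Lemma Rintegral_scaling_map (F : T -> R) : mu.-integrable setT (EFin \o F) ->
  \int[mu]_x F (psi x) = k * \int[mu]_x F x.
Proof.
move=> iF; have iFp := integrable_scaling_map iF.
have mF := measurable_int _ iF.
rewrite /Rintegral [in LHS]integralE [in RHS]integralE.
have -> : (\int[mu]_x (fun x => (F (psi x))%:E)^\+ x = k%:E * \int[mu]_x (EFin \o F)^\+ x)%E.
  rewrite -ge0_integral_scaling_map//; last exact: measurable_funepos.
  by apply: eq_integral => x _; rewrite !funeposE.
have -> : (\int[mu]_x (fun x => (F (psi x))%:E)^\- x = k%:E * \int[mu]_x (EFin \o F)^\- x)%E.
  rewrite -ge0_integral_scaling_map//; last exact: measurable_funeneg.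
  by apply: eq_integral => x _; rewrite !funenegE.
have := integrable_pos_fin_num measurableT iF.
have := integrable_neg_fin_num measurableT iF.
rewrite -[(fun x => (F x)%:E)]/(EFin \o F).
case: (integral _ _ _) => // r _; case: (integral _ _ _) => // s _.
by rewrite -!EFinM -!EFinB /= mulrBr.
Qed.

End scaling_map.

Section lebesgue_rV_affine.
Variables (R : realType) (n : nat).
Local Notation lam := (@lebesgue_rV R n).

Lemma lebesgue_rV_affine (M : 'M[R]_n) (c : 'rV[R]_n) : M \in unitmx ->
  measurable_fun setT (fun x : 'rV[R]_n => x *m M + c) /\
  exists2 k : R, 0 < k & forall E, measurable E ->
    lam ((fun x => x *m M + c) @^-1` E) = (k%:E * lam E)%E.
Proof.
move=> uM; split.
  apply: (@measurableT_comp _ _ _ _ _ _ (fun x : 'rV[R]_n => x + c)).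
    exact: measurable_shiftr.
  exact: measurable_mulmxr.
have [k k0 kE] := lebesgue_rV_linear uM; exists k => // E mE.
have mE' := measurable_preimage (measurable_shiftr c) mE.
by rewrite -(lebesgue_rV_shift c mE) -kE.
Qed.

Lemma lebesgue_rV_bounded (E : set 'rV[R]_n) (M : R) : measurable E ->
  (forall x, E x -> forall i, `|x ord0 i| <= M) -> (lam E < +oo)%E.
Proof.
move=> mE EM; pose M' := Num.max M 0.
have M'0 : 0 <= M' by rewrite le_max lexx orbT.
apply: (@le_lt_trans _ _ (lam [set x | forall i, x ord0 i \in `[- M', M']])).
  apply: le_measure; rewrite ?inE//; first exact: measurable_rV_box.
  by move=> x Ex i; rewrite in_itv/= -ler_norml le_max EM.
by rewrite lebesgue_rV_box ?ltry// => i; rewrite ge0_cp.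
Qed.

Lemma lebesgue_rV_open (U : set 'rV[R]_n) : open U -> U !=set0 -> (0 < lam U)%E.
Proof.
move=> oU [x Ux].
have /nbhs_ballP[e /= e0 eU] := open_nbhs_nbhs (conj oU Ux).
pose B := [set y : 'rV[R]_n | forall i, y ord0 i \in `[x ord0 i - e / 2, x ord0 i + e / 2]].
apply: (@lt_le_trans _ _ (lam B)).
  rewrite lebesgue_rV_box => [|i]; last by rewrite lerD2l ge0_cp// divr_ge0 ?ltW.
  rewrite lte_fin; apply: prodr_gt0 => i _.
  by rewrite opprB addrC addrA subrK addr_gt0 ?divr_gt0.
apply: le_measure; rewrite ?inE; [exact: measurable_rV_box|exact: measurable_rV_open|].
move=> y By; apply: eU; split => // i j; rewrite ord1.
have := By j; rewrite in_itv/= -ler_distl distrC => /le_lt_trans; apply.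
by rewrite ltr_pdivrMr// ltr_pMr// ltr1n.
Qed.

End lebesgue_rV_affine.

(** * Affine functions *)

(** Entry 0 is the constant term, the others form the slope. Locked, so that the sum is not unfolded
    during unification and simplification. *)
HB.lock Definition aff (R : realType) n (a : 'rV[R]_n.+1) (x : 'rV[R]_n) : R :=
  a ord0 ord0 + \sum_j a ord0 (lift ord0 j) * x ord0 j.

Section affine_functions.
Variable R : realType.

Lemma affE n (a : 'rV[R]_n.+1) (x : 'rV[R]_n) :
  aff a x = a ord0 ord0 + \sum_j a ord0 (lift ord0 j) * x ord0 j.
Proof. by rewrite unlock. Qed.


Definition lin n (a : 'rV[R]_n.+1) : 'rV[R]_n := \row_j a ord0 (lift ord0 j).

Lemma affD n (a b : 'rV[R]_n.+1) x : aff (a + b) x = aff a x + aff b x.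
Proof.
rewrite !affE !mxE addrACA -big_split; congr (_ + _); apply: eq_bigr => j _.
by rewrite !mxE mulrDl.
Qed.

Lemma affZ n c (a : 'rV[R]_n.+1) x : aff (c *: a) x = c * aff a x.
Proof.
rewrite !affE !mxE mulrDr mulr_sumr; congr (_ + _); apply: eq_bigr => j _.
by rewrite !mxE mulrA.
Qed.

Lemma affN n (a : 'rV[R]_n.+1) x : aff (- a) x = - aff a x.
Proof. by rewrite -scaleN1r affZ mulN1r. Qed.

Lemma affB n (a b : 'rV[R]_n.+1) x : aff (a - b) x = aff a x - aff b x.
Proof. by rewrite affD affN. Qed.

Lemma aff0 n (x : 'rV[R]_n) : aff 0 x = 0.
Proof. by rewrite -(scale0r 0) affZ mul0r. Qed.

Lemma aff_sum n I (r : seq I) (P : pred I) (a : I -> 'rV[R]_n.+1) x :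
  aff (\sum_(i <- r | P i) a i) x = \sum_(i <- r | P i) aff (a i) x.
Proof. by elim/big_rec2: _ => [|i y z _ <-]; rewrite ?aff0 ?affD. Qed.

Lemma affDx n (a : 'rV[R]_n.+1) x (z : 'rV[R]_n) :
  aff a (x + z) = aff a x + \sum_j lin a ord0 j * z ord0 j.
Proof.
rewrite !affE -addrA -big_split; congr (_ + _); apply: eq_bigr => j _.
by rewrite !mxE mulrDr.
Qed.

Lemma aff_lin0 n (a : 'rV[R]_n.+1) x : lin a = 0 -> aff a x = a ord0 ord0.
Proof.
move=> a0; rewrite !affE big1 ?addr0// => j _.
by have /rowP/(_ j) := a0; rewrite !mxE => ->; rewrite mul0r.
Qed.

Lemma aff_eq0 n (a : 'rV[R]_n.+1) : lin a = 0 -> a ord0 ord0 = 0 -> a = 0.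
Proof.
move=> a0 a00; apply/rowP => i; rewrite mxE; case: (unliftP ord0 i) => [j ->|->//].
by have /rowP/(_ j) := a0; rewrite !mxE.
Qed.

Lemma linD n (a b : 'rV[R]_n.+1) : lin (a + b) = lin a + lin b.
Proof. by apply/rowP => j; rewrite !mxE. Qed.

Lemma linZ n c (a : 'rV[R]_n.+1) : lin (c *: a) = c *: lin a.
Proof. by apply/rowP => j; rewrite !mxE. Qed.

Lemma linN n (a : 'rV[R]_n.+1) : lin (- a) = - lin a.
Proof. by apply/rowP => j; rewrite !mxE. Qed.

Lemma lin_sum n I (r : seq I) (P : pred I) (a : I -> 'rV[R]_n.+1) :
  lin (\sum_(i <- r | P i) a i) = \sum_(i <- r | P i) lin (a i).
Proof.
elim/big_rec2: _ => [|i y z _ <-]; last by rewrite linD.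
by rewrite -(scale0r 0) linZ scale0r.
Qed.

Lemma cvg_aff T (F : set_system T) n (a_ : T -> 'rV[R]_n.+1) (x_ : T -> 'rV[R]_n) a x :
  Filter F -> a_ @ F --> a -> x_ @ F --> x -> aff (a_ t) (x_ t) @[t --> F] --> aff a x.
Proof.
move=> FF ca cx.
have coord m (v_ : T -> 'rV[R]_m) (v : 'rV[R]_m) j : v_ @ F --> v -> v_ t ord0 j @[t --> F] --> v ord0 j.
  by move=> cv; exact: (cvg_comp _ _ cv (@coord_continuous R 1 m ord0 j v)).
under eq_fun do rewrite affE.
rewrite affE; apply: cvgD; first exact: coord.
apply: cvg_big => [|j _]; first by move=> q; exact: add_continuous.
by apply: cvgM; exact: coord.
Qed.

Lemma continuous_aff n (a : 'rV[R]_n.+1) : continuous (aff a).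
Proof. by move=> x; apply: (@cvg_aff _ (nbhs x) n (fun=> a) id) => //; exact: cvg_cst. Qed.

Lemma measurable_aff n (a : 'rV[R]_n.+1) : measurable_fun setT (aff a).
Proof. by apply: continuous_measurable_rVR; exact: continuous_aff. Qed.

Lemma cvg_rV T (F : set_system T) n (x_ : T -> 'rV[R]_n) (x : 'rV[R]_n) :
  Filter F -> (forall j, x_ t ord0 j @[t --> F] --> x ord0 j) -> x_ @ F --> x.
Proof.
move=> FF cx; apply/cvg_ballP => e e0.
have : \forall t \near F, forall j, `|x ord0 j - x_ t ord0 j| < e.
  by apply: filter_forall => j; have /cvgrPdist_lt := cx j; apply.
apply: filterS => t xt; split => // i j; rewrite ord1; exact: xt.
Qed.

(** Completes a normal vector to a coordinate system. In the rank-one decomposition of [w], the left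
    factor is a nonzero scalar, so [w] is that scalar times the first row of an invertible
    matrix. *)
Lemma unit_row0 n (w : 'rV[R]_n.+1) : w != 0 ->
  exists2 M : 'M[R]_n.+1, M \in unitmx & row ord0 M = w.
Proof.
move=> w0; have := mulmx_ebase w.
have rw : \rank w = 1%N.
  by apply/eqP; rewrite eqn_leq rank_leq_row lt0n mxrank_eq0.
set u := col_ebase w; rewrite (mx11_scalar u) rw mul_scalar_mx => wE.
have u0 : u ord0 ord0 != 0.
  by apply: contraNneq w0 => u0; rewrite -wE u0 scale0r mul0mx.
exists (u ord0 ord0 *: row_ebase w).
  by rewrite unitmxZ ?unitfE// row_ebase_unit.
rewrite -[RHS]wE -scalemxAl; apply/rowP => j; rewrite !mxE.
congr (_ * _); rewrite (bigD1 ord0)//= big1 ?addr0 => [|i i0].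
  by rewrite !mxE eqxx mul1r.
by rewrite !mxE; case: eqP => [/= i00|_]; rewrite ?mul0r//; rewrite -val_eqE/= -i00 in i0.
Qed.

Lemma rV_coord_le_norm n (x : 'rV[R]_n) i : `|x ord0 i| <= `|x|.
Proof.
rewrite [leRHS]/Num.norm/= mx_normrE; apply/bigmax_geP; right => /=.
by exists (ord0, i).
Qed.

(** In coordinates that start with the normal, the hyperplane becomes z_0 = const, a countable union
    of boxes with one side of length 0. *)
Lemma lebesgue_rV_hyperplane n (a : 'rV[R]_n.+1) : a != 0 ->
  lebesgue_rV n [set x | aff a x = 0] = 0%E.
Proof.
have [l0 a0|] := eqVneq (lin a) 0.
  rewrite (_ : [set x | _] = set0) ?measure0//.
  apply/seteqP; split => // x /=; rewrite aff_lin0// => a00.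
  by move/eqP: a0; apply; exact: aff_eq0.
case: n a => [a /eqP[]|n a l0 _]; first by apply/rowP => -[].
have [M uM Ma] := unit_row0 l0.
have uMT : M^T \in unitmx by rewrite unitmx_tr.
have affE x : aff a x = a ord0 ord0 + (x *m M^T) ord0 ord0.
  rewrite !affE mxE; congr (_ + _); apply: eq_bigr => j _.
  by rewrite mulrC; congr (_ * _); have /rowP/(_ j) := Ma; rewrite !mxE => ->.
have [k k0 kE] := lebesgue_rV_linear uMT.
pose H : set 'rV[R]_n.+1 := [set z | z ord0 ord0 = - a ord0 ord0].
pose lo (N : nat) (i : 'I_n.+1) : R := if i == ord0 then - a ord0 ord0 else - N%:R.
pose hi (N : nat) (i : 'I_n.+1) : R := if i == ord0 then - a ord0 ord0 else N%:R.
have HE : H = \bigcup_N [set z : 'rV[R]_n.+1 | forall i, z ord0 i \in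
    `[lo N i, hi N i]].
  apply/seteqP; split => [z zH|z [N _]]; last first.
    by move=> /(_ ord0); rewrite /lo /hi eqxx in_itv/= -eq_le => /eqP.
  have [N hN] : exists N : nat, forall i, `|z ord0 i| <= N%:R.
    have [N zN] : exists N : nat, `|z| <= N%:R.
      by exists (Num.truncn `|z|).+1; apply/ltW/truncnS_gt.
    by exists N => i; exact: le_trans (rV_coord_le_norm _ _) zN.
  exists N => // i; rewrite /lo /hi; case: ifPn => [/eqP->|i0]; rewrite in_itv/=.
    by rewrite zH lexx.
  by rewrite -ler_norml.
have mB N : measurable [set z : 'rV[R]_n.+1 | forall i, z ord0 i \in
    `[lo N i, hi N i]].
  exact: measurable_rV_box.
have mH : measurable H by rewrite HE; exact: bigcupT_measurable.
rewrite (_ : [set x | _] = (fun x => x *m M^T) @^-1` H); last first.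
  apply/seteqP; split=> x /=; rewrite /H/= affE.
    by move/eqP; rewrite addrC addr_eq0 => /eqP.
  by move=> ->; rewrite subrr.
rewrite [LHS]kE// (_ : lebesgue_rV n.+1 H = 0%E) ?mule0//.
apply: measure_negligible; rewrite // HE.
apply: negligible_bigcup => N; apply/negligibleP; first exact: mB.
rewrite [LHS](@lebesgue_rV_box R n.+1 (lo N) (hi N)) => [|i]; last first.
  by rewrite /lo /hi; case: ifPn => // _; rewrite ge0_cp.
by rewrite (bigD1 ord0)//= /lo /hi eqxx subrr mul0r.
Qed.

End affine_functions.

(** * The weighted integral *)

Section finite_support.
Context {R : realType} {d} {T : measurableType d}.
Variables (mu : {measure set T -> \bar R}) (E : set T).
Hypotheses (mE : measurable E) (Eoo : (mu E < +oo)%E).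

Lemma integrable_cst_indic (C : R) :
  mu.-integrable setT (EFin \o (fun x => C * \1_E x)).
Proof.
apply/integrableP; split.
  by apply: measurableT_comp => //; apply: measurable_funM => //; exact: measurable_indic.
under eq_integral => x _ do rewrite /= normrM [X in _ * X]ger0_norm//.
rewrite (_ : (fun _ => _) = (fun x => `|C|%:E * (\1_E x)%:E)%E); last first.
  by apply/funext => x; rewrite EFinM.
rewrite ge0_integralZl//.
- by rewrite integral_indic// setIT lte_mul_pinfty// ?lee_fin ?ge0_fin_numE.
- by apply: measurableT_comp => //; exact: measurable_indic.
Qed.

Lemma dominated_integrable_indic (h : T -> R) (C : R) : measurable_fun setT h ->
  (forall x, `|h x| <= C * \1_E x) -> mu.-integrable setT (EFin \o h).
Proof.
move=> mh hC; apply: le_integrable (integrable_cst_indic C) => //.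
  exact: measurableT_comp.
by move=> x _ /=; rewrite lee_fin; exact: le_trans (hC x) (ler_norm _).
Qed.

Lemma Rintegral_dominated_cvg (h_ : nat -> T -> R) (h : T -> R) (C : R) (N : set T) :
  (forall n, measurable_fun setT (h_ n)) -> measurable_fun setT h ->
  (forall n x, `|h_ n x| <= C * \1_E x) ->
  measurable N -> mu N = 0%E ->
  (forall x, ~ N x -> h_ n x @[n --> \oo] --> h x) ->
  mu.-integrable setT (EFin \o h) /\
  \int[mu]_x h_ n x @[n --> \oo] --> \int[mu]_x h x.
Proof.
move=> mh_ mh hC mN N0 h_h.
have [||||ih _ cv] := @dominated_convergence _ _ _ mu setT measurableT
  (fun n x => (h_ n x)%:E) (EFin \o h) (fun x => (C * \1_E x)%:E) _ _ _
  (integrable_cst_indic C).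
- by move=> n; exact: measurableT_comp.
- exact: measurableT_comp.
- exists N; split => // x /= /not_implyP[_ xh]; apply: contrapT => Nx; apply: xh.
  by apply/fine_cvgP; split; [exact: nearW|exact: h_h].
- by apply: aeW => x n _; rewrite /= lee_fin; exact: hC.
split=> //; apply: fine_cvg; rewrite /Rintegral fineK//; exact: integrable_fin_num.
Qed.

Lemma Rintegral_ge (h : T -> R) (U : set T) (delta : R) :
  mu.-integrable setT (EFin \o h) ->
  (forall x, 0 <= h x) -> measurable U -> (forall x, U x -> delta <= h x) ->
  (delta%:E * mu U <= (\int[mu]_x h x)%:E)%E.
Proof.
move=> ih h0 mU Uh; rewrite /Rintegral fineK; last exact: integrable_fin_num.
apply: (@le_trans _ _ (\int[mu]_(x in U) (h x)%:E)%E); last first.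
  apply: ge0_subset_integral => //; first exact: measurable_int ih.
  by move=> x _; rewrite lee_fin.
have [d0|d0] := leP 0 delta; last first.
  apply: (@le_trans _ _ 0%E); last by apply: integral_ge0 => x _; rewrite lee_fin.
  by apply: mule_le0_ge0 => //; rewrite lee_fin ltW.
rewrite -integral_cst//; apply: ge0_le_integral => //.
- apply: measurable_funTS; exact: measurable_int ih.
Qed.

End finite_support.

Section weighted_integral.
Variables (R : realType) (n : nat).
Local Notation lam := (@lebesgue_rV R n).
Variables (Q : set 'rV[R]_n) (p : 'rV[R]_n -> R).
Hypothesis oQ : open Q.
Hypothesis bQ : exists B, forall x, Q x -> forall i, `|x ord0 i| <= B.
Hypothesis cp : continuous p.
Hypothesis p0 : forall x, 0 <= p x.
Hypothesis pQ : forall x, 0 < p x <-> Q x.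

(* Boundedness is required on [Q] only, as the weight vanishes elsewhere. *)
Definition bm (phi : 'rV[R]_n -> R) := measurable_fun setT phi /\
  exists M, forall x, Q x -> `|phi x| <= M.

Definition wint (phi : 'rV[R]_n -> R) := \int[lam]_x (phi x * p x).

Lemma weight_eq0 x : ~ Q x -> p x = 0.
Proof. by move=> nQ; apply/eqP; rewrite eq_le p0 andbT leNgt; apply/negP => /pQ. Qed.

Lemma continuous_bounded_on_bounded (phi : 'rV[R]_n -> R) : continuous phi ->
  exists M, forall x, Q x -> `|phi x| <= M.
Proof.
move=> cphi; have [B QB] := bQ.
pose K := [set x : 'rV[R]_n | forall i, x ord0 i \in `[- B, B]].
have cK : compact K.
  by apply: (@rV_compact _ _ (fun=> `[- B, B]%classic)) => _; exact: segment_compact.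
have : bounded_set (phi @` K).
  apply: compact_bounded; apply: continuous_compact => //.
  by apply: continuous_subspaceT.
move=> [M [_ hM]]; exists (M + 1) => x Qx; apply: (hM (M + 1)); first by rewrite ltrDl.
by exists x => // i; rewrite in_itv/= -ler_norml QB.
Qed.

Lemma weight_bounded : exists2 P, 0 <= P & forall x, p x <= P * \1_Q x.
Proof.
have [P QP] := continuous_bounded_on_bounded cp.
exists (Num.max P 0) => [|x]; first by rewrite le_max lexx orbT.
rewrite indicE; have [/set_mem xQ|/negP xQ] := boolP (x \in Q).
  by rewrite mulr1 le_max (le_trans (ler_norm _) (QP x xQ)).
by rewrite mulr0 weight_eq0// => Qx; apply: xQ; rewrite inE.
Qed.

Lemma measurable_Q : measurable Q. Proof. exact: measurable_rV_open. Qed.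

Lemma lam_Q : (lam Q < +oo)%E.
Proof. by have [B QB] := bQ; exact: lebesgue_rV_bounded measurable_Q QB. Qed.

Lemma measurable_weight : measurable_fun setT p.
Proof. exact: continuous_measurable_rVR. Qed.

Lemma bm_cst c : bm (fun=> c).
Proof. by split => //; exists `|c|. Qed.

Lemma bmD phi psi : bm phi -> bm psi -> bm (fun x => phi x + psi x).
Proof.
move=> [m1 [M1 b1]] [m2 [M2 b2]]; split; first exact: measurable_funD.
by exists (M1 + M2) => x Qx; rewrite (le_trans (ler_normD _ _))// lerD// ?b1 ?b2.
Qed.

Lemma bmM phi psi : bm phi -> bm psi -> bm (fun x => phi x * psi x).
Proof.
move=> [m1 [M1 b1]] [m2 [M2 b2]]; split; first exact: measurable_funM.
by exists (M1 * M2) => x Qx; rewrite normrM ler_pM// ?b1 ?b2.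
Qed.

Lemma bmZ c phi : bm phi -> bm (fun x => c * phi x).
Proof. by move=> h; apply: bmM => //; exact: bm_cst. Qed.

Lemma bmN phi : bm phi -> bm (fun x => - phi x).
Proof.
move=> h; have -> : (fun x => - phi x) = (fun x => -1 * phi x) by apply/funext => x; rewrite mulN1r.
exact: bmZ.
Qed.

Lemma bmB phi psi : bm phi -> bm psi -> bm (fun x => phi x - psi x).
Proof. by move=> h1 h2; apply: bmD => //; exact: bmN. Qed.

Lemma bmX phi k : bm phi -> bm (fun x => phi x ^+ k).
Proof.
move=> h; elim: k => [|k ih]; first exact: bm_cst.
rewrite (_ : (fun x => _) = (fun x => phi x * phi x ^+ k)); first exact: bmM.
by apply/funext => x; rewrite exprS.
Qed.

Lemma bm_sum I (r : seq I) (P : pred I) (phi : I -> 'rV[R]_n -> R) :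
  (forall i, P i -> bm (phi i)) -> bm (fun x => \sum_(i <- r | P i) phi i x).
Proof.
move=> h; elim: r => [|i r ih].
  rewrite (_ : (fun x => _) = (fun=> 0)); first exact: bm_cst.
  by apply/funext => x; rewrite big_nil.
have [Pi|Pi] := boolP (P i); last first.
  by rewrite (_ : (fun x => _) = (fun x => \sum_(j <- r | P j) phi j x))//; apply/funext => x; rewrite big_cons (negbTE Pi).
rewrite (_ : (fun x => _) = (fun x => phi i x + \sum_(j <- r | P j) phi j x)).
  by apply: bmD => //; exact: h.
by apply/funext => x; rewrite big_cons Pi.
Qed.

Lemma bm_continuous phi : continuous phi -> bm phi.
Proof.
move=> c; split; [exact: continuous_measurable_rVR|exact: continuous_bounded_on_bounded].
Qed.

Lemma bm_weighted phi : bm phi -> measurable_fun setT (fun x => phi x * p x) /\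
  exists C, forall x, `|phi x * p x| <= C * \1_Q x.
Proof.
move=> [m [M b]]; split; first by apply: measurable_funM => //; exact: measurable_weight.
have [P P0 pP] := weight_bounded; exists (M * P) => x.
rewrite normrM (ger0_norm (p0 x)) indicE.
have [/set_mem xQ|/negP xQ] := boolP (x \in Q).
  rewrite mulr1 ler_pM// ?b//; have := pP x.
  by rewrite indicE mem_set// mulr1.
by rewrite mulr0 weight_eq0 ?mulr0// => Qx; apply: xQ; rewrite inE.
Qed.

Lemma bm_integrable phi : bm phi -> lam.-integrable setT (EFin \o (fun x => phi x * p x)).
Proof.
move=> /bm_weighted[m [C hC]].
exact: dominated_integrable_indic measurable_Q lam_Q _ _ m hC.
Qed.

Lemma wintD phi psi : bm phi -> bm psi ->
  wint (fun x => phi x + psi x) = wint phi + wint psi.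
Proof.
move=> h1 h2; rewrite /wint -RintegralD//; try exact: bm_integrable.
by apply: eq_Rintegral => x _; rewrite mulrDl.
Qed.

Lemma wintZ c phi : bm phi -> wint (fun x => c * phi x) = c * wint phi.
Proof.
move=> h; rewrite /wint -RintegralZl//; last exact: bm_integrable.
by apply: eq_Rintegral => x _; rewrite mulrA.
Qed.

Lemma wintB phi psi : bm phi -> bm psi ->
  wint (fun x => phi x - psi x) = wint phi - wint psi.
Proof.
move=> h1 h2; rewrite /wint -RintegralB//; try exact: bm_integrable.
by apply: eq_Rintegral => x _; rewrite mulrBl.
Qed.

Lemma wint0 : wint (fun=> 0) = 0.
Proof. by rewrite -{1}(mul0r 0) wintZ ?mul0r//; exact: bm_cst. Qed.

Lemma wint_sum I (r : seq I) (P : pred I) (phi : I -> 'rV[R]_n -> R) :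
  (forall i, P i -> bm (phi i)) ->
  wint (fun x => \sum_(i <- r | P i) phi i x) = \sum_(i <- r | P i) wint (phi i).
Proof.
move=> h; elim: r => [|i r ih].
  by rewrite big_nil -[RHS]wint0; congr wint; apply/funext => x; rewrite big_nil.
rewrite big_cons; case: ifPn => Pi; last first.
  by rewrite -ih; congr wint; apply/funext => x; rewrite big_cons (negbTE Pi).
rewrite -ih -wintD; [|exact: h|exact: bm_sum].
by congr wint; apply/funext => x; rewrite big_cons Pi.
Qed.

Lemma eq_wint phi psi : (forall x, Q x -> phi x = psi x) -> wint phi = wint psi.
Proof.
move=> h; apply: eq_Rintegral => x _.
have [Qx|nQ] := pselect (Q x); first by rewrite h.
by rewrite weight_eq0// !mulr0.
Qed.

Lemma wint_le phi psi : bm phi -> bm psi -> (forall x, Q x -> phi x <= psi x) ->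
  wint phi <= wint psi.
Proof.
move=> h1 h2 h; apply: le_Rintegral => //; try exact: bm_integrable.
move=> x _; have [Qx|nQ] := pselect (Q x); first by rewrite ler_wpM2r// h.
by rewrite weight_eq0// !mulr0.
Qed.

Lemma wint_ge0 phi : (forall x, Q x -> 0 <= phi x) -> 0 <= wint phi.
Proof.
move=> h; apply: Rintegral_ge0 => x _.
have [Qx|nQ] := pselect (Q x); first by rewrite mulr_ge0// h.
by rewrite weight_eq0// !mulr0.
Qed.

Lemma wint_gt0_open phi U : bm phi -> (forall x, Q x -> 0 <= phi x) ->
  open U -> U !=set0 -> U `<=` Q -> (exists2 delta, 0 < delta & forall x, U x -> delta <= phi x) ->
  0 < wint phi.
Proof.
move=> h h0 oU [u Uu] UQ [delta d0 Uphi].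
have [V [oV Vu VU]] : exists V, [/\ open V, V u & V `<=` U `&` [set x | p u / 2 < p x]].
  exists (U `&` [set x | p u / 2 < p x]); split => //.
    apply: openI => //; rewrite -[X in open X]/(p @^-1` [set y | p u / 2 < y]).
    by apply: open_comp => [x _|]; [exact: cp|exact: open_gt].
  by split => //=; rewrite ltr_pdivrMr// ltr_pMr ?ltr1n//; exact/pQ/UQ.
have pu : 0 < p u by exact/pQ/UQ.
have mV : measurable V by exact: measurable_rV_open.
have : ((delta * (p u / 2))%:E * lam V <= (wint phi)%:E)%E.
  apply: Rintegral_ge => //; first exact: bm_integrable.
    move=> x; have [Qx|nQ] := pselect (Q x); first by rewrite mulr_ge0// h0.
    by rewrite weight_eq0// mulr0.
  move=> x /VU[Ux /= px]; apply: ler_pM; [exact: ltW| |exact: Uphi|exact: ltW].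
  by rewrite divr_ge0// ltW.
rewrite -lte_fin; apply: lt_le_trans.
by rewrite mule_gt0 ?lte_fin ?mulr_gt0 ?divr_gt0//; apply: lebesgue_rV_open => //; exists u.
Qed.

(** Fatou rather than dominated convergence: a minimizing sequence of networks has bounded losses,
    but no common bound near the limiting hyperplanes. *)
Lemma wint_fatou (phi_ : nat -> 'rV[R]_n -> R) phi (N : set 'rV[R]_n) c :
  (forall k, bm (phi_ k)) -> bm phi ->
  (forall k x, Q x -> 0 <= phi_ k x) -> (forall x, Q x -> 0 <= phi x) ->
  measurable N -> lam N = 0%E ->
  (forall x, Q x -> ~ N x -> phi_ k x @[k --> \oo] --> phi x) ->
  (forall e, 0 < e -> \forall k \near \oo, wint (phi_ k) <= c + e) -> wint phi <= c.
Proof.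
move=> hk h hk0 h0 mN N0 cv hc.
have fin psi : bm psi -> (wint psi)%:E = (\int[lam]_x (psi x * p x)%:E)%E.
  by move=> hpsi; rewrite /wint /Rintegral fineK//; exact: integrable_fin_num (bm_integrable hpsi).
have ge0 psi x : (forall y, Q y -> 0 <= psi y) -> 0 <= psi x * p x.
  move=> psi0; have [Qx|nQ] := pselect (Q x); first by rewrite mulr_ge0// psi0.
  by rewrite weight_eq0// mulr0.
apply/ler_addgt0Pr => e e0; rewrite -lee_fin fin//.
have mNC : measurable (~` N) by exact: measurableC.
have neg psi : bm psi -> (\int[lam]_x (psi x * p x)%:E = \int[lam]_(x in ~` N) (psi x * p x)%:E)%E.
  by move=> hpsi; rewrite (negligible_integral mN _ (bm_integrable hpsi))// setTD.
rewrite neg//.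
have := @fatou _ _ R lam _ mNC (fun k x => (phi_ k x * p x)%:E).
have -> : (\int[lam]_(x in ~` N) limn_einf (fun k => (phi_ k x * p x)%:E) =
    \int[lam]_(x in ~` N) (phi x * p x)%:E)%E.
  apply: eq_integral => x; rewrite inE => Nx.
  apply: (cvg_limn_einf_sup _).1; apply/fine_cvgP; split; first exact: nearW.
  have [Qx|nQ] := pselect (Q x); first by apply: cvgM; [exact: cv|exact: cvg_cst].
  by rewrite weight_eq0// mulr0; under eq_fun do rewrite mulr0; exact: cvg_cst.
move=> /(_ _ _)/le_trans; apply.
- by move=> k; apply: measurable_funTS; apply: measurableT_comp => //; exact: (bm_weighted (hk k)).1.
- by move=> k x _; rewrite lee_fin ge0// => y; exact: hk0.
rewrite limn_einf_lim; apply: lime_le; first exact: is_cvg_einfs.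
have [K _ hK] := hc e e0; exists K => // k /= Kk.
apply: le_trans (_ : (\int[lam]_(x in ~` N) (phi_ k x * p x)%:E <= _)%E).
  by apply: ereal_inf_lbound; exists k => /=.
by rewrite -neg// -fin// lee_fin hK.
Qed.

End weighted_integral.

(** * Hyperplanes and points in general position *)

Section affine_geometry.
Variables (R : realType) (n : nat).
Implicit Types (a b : 'rV[R]_n.+1) (x y z : 'rV[R]_n).

Lemma aff_comp b (M : 'M[R]_n) (c : 'rV[R]_n) :
  exists b', forall z, aff b (z *m M + c) = aff b' z.
Proof.
exists (\row_i oapp (fun j => \sum_l M j l * lin b ord0 l) (aff b c) (unlift ord0 i)) => z.
rewrite addrC affDx [RHS]affE mxE unlift_none /=; congr (_ + _).
transitivity (\sum_l \sum_j lin b ord0 l * (z ord0 j * M j l)).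
  by apply: eq_bigr => l _; rewrite [X in _ * X]mxE mulr_sumr.
rewrite exchange_big; apply: eq_bigr => j _ /=.
rewrite mxE liftK/= mulr_suml; apply: eq_bigr => l _.
by ring.
Qed.

Lemma rV_neq0P m (w : 'rV[R]_m) : w != 0 -> exists j, w ord0 j != 0.
Proof.
move=> w0; apply/existsP; apply: contraNT w0; rewrite negb_exists => /forallP wj.
by apply/eqP/rowP => j; rewrite mxE; apply/eqP/negPn/wj.
Qed.

Lemma aff_conv a x y t : aff a (x + t *: (y - x)) = (1 - t) * aff a x + t * aff a y.
Proof.
have -> : aff a y = aff a x + \sum_j lin a ord0 j * (y - x) ord0 j.
  by rewrite -affDx addrC subrK.
rewrite affDx mulrDr addrA -mulrDl subrK mul1r; congr (_ + _).
by rewrite mulr_sumr; apply: eq_bigr => j _; rewrite [X in _ * X]mxE mulrCA.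
Qed.

Lemma hyperplane_point a : lin a != 0 -> exists x, aff a x = 0.
Proof.
move=> /rV_neq0P[j aj].
exists (\row_l (if l == j then - a ord0 ord0 / lin a ord0 j else 0)).
rewrite affE (bigD1 j)//= big1 => [|l lj]; last by rewrite [X in _ * X]mxE (negbTE lj) mulr0.
move: aj; rewrite !mxE eqxx addr0 => aj.
by rewrite mulrC divfK// subrr.
Qed.

Lemma vanish_proportional a b : lin a != 0 ->
  (forall x, aff a x = 0 -> aff b x = 0) -> exists mu, b = mu *: a.
Proof.
move=> a0 ab; have [x0 ax0] := hyperplane_point a0.
have [j aj] := rV_neq0P a0.
exists (lin b ord0 j / lin a ord0 j).
apply/eqP; rewrite -subr_eq0; apply/eqP.
set c := b - _.
have cx x : aff a x = 0 -> aff c x = 0.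
  by move=> ax; rewrite affB affZ ax mulr0 subr0 ab.
have cj : lin c ord0 j = 0.
  by rewrite /c linD linN linZ mxE [X in _ + X]mxE [X in - X]mxE divfK// subrr.
have lc : lin c = 0.
  apply/rowP => l; have [->|lj] := eqVneq l j; first by rewrite cj mxE.
  (* A direction tangent to the hyperplane of [a]: a unit step in coordinate l, compensated in
     coordinate j. *)
  pose z : 'rV[R]_n := \row_k (if k == l then 1 else if k == j then - lin a ord0 l / lin a ord0 j else 0).
  have sumz e : \sum_k lin e ord0 k * z ord0 k = lin e ord0 l - lin e ord0 j * (lin a ord0 l / lin a ord0 j).
    rewrite (bigD1 l)//= (bigD1 j)/=; last by rewrite eq_sym.
    rewrite big1 => [|k /andP[kl kj]]; last by rewrite [X in _ * X]mxE (negbTE kl) (negbTE kj) mulr0.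
    rewrite addr0 [X in _ * X + _]mxE [X in _ + _ * X]mxE eqxx mulr1.
    by rewrite eq_sym (negbTE lj) eqxx mulNr mulrN.
  have : aff c (x0 + z) = 0.
    by apply: cx; rewrite affDx ax0 add0r sumz mulrC divfK// subrr.
  by rewrite affDx (cx _ ax0) add0r sumz cj mul0r subr0 => ->; rewrite mxE.
apply: aff_eq0 => //.
by have := cx _ ax0; rewrite aff_lin0.
Qed.

Lemma continuous_segment x y : continuous (fun t : R => x + t *: (y - x)).
Proof.
move=> t; apply: cvgD; first exact: cvg_cst.
by apply: cvgZr_tmp; exact: cvg_id.
Qed.

(** [C] is the whole space or a hyperplane. If b vanishes at the point found so far, a short step
    towards some y of [C] with b(y) nonzero repairs this; [Q] and the finitely many earlier
    conditions are open and survive. *)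
Lemma generic_point (Q : set 'rV[R]_n) (C : set 'rV[R]_n) (s : seq 'rV[R]_n.+1) :
  open Q -> (forall x y t, C x -> C y -> C (x + t *: (y - x))) ->
  (exists x, Q x /\ C x) ->
  (forall b, b \in s -> exists2 y, C y & aff b y != 0) ->
  exists x, [/\ Q x, C x & forall b, b \in s -> aff b x != 0].
Proof.
move=> oQ Cline [x0 [Qx0 Cx0]]; elim: s => [|b s ih] hs; first by exists x0; split.
have [|x [Qx Cx sx]] := ih; first by move=> b' b's; apply: hs; rewrite inE b's orbT.
have [bx0|bx] := eqVneq (aff b x) 0; last first.
  by exists x; split => // b'; rewrite inE => /predU1P[->//|]; exact: sx.
have [|y Cy by0] := hs b; first exact: mem_head.
have : \forall t \near (0 : R), Q (x + t *: (y - x)) /\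
    forall b', b' \in s -> aff b' (x + t *: (y - x)) != 0.
  have c0 : x + (0 : R) *: (y - x) = x by rewrite scale0r addr0.
  apply: filterI.
    apply: (@continuous_segment x y (0 : R)); rewrite c0; exact: open_nbhs_nbhs.
  elim: {ih hs} s sx => [|b' s ih sx]; first by move=> _; apply: (@filterS _ (nbhs (0 : R)) _ setT); [move=> t _ b'; rewrite in_nil|exact: filterT].
  have := ih (fun b'' (h : b'' \in s) => sx b'' (ltac:(by rewrite inE h orbT))).
  have : \forall t \near (0 : R), aff b' (x + t *: (y - x)) != 0.
    have cv : aff b' (x + t *: (y - x)) @[t --> (0 : R)] --> aff b' x.
      have := cvg_comp _ _ (@continuous_segment x y (0 : R)) (@continuous_aff R n b' _).
      by rewrite c0.
    by move/cvgr_neq0 : cv; apply; rewrite sx// mem_head.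
  apply: filterS2 => t b't st b''; rewrite inE => /predU1P[->//|]; exact: st.
move=> /nbhs_ballP[e /= e0 he].
have [|Qt st] := he (e / 2).
  rewrite /ball/= sub0r normrN gtr0_norm ?divr_gt0//.
  by rewrite ltr_pdivrMr// ltr_pMr// ltr1n.
exists (x + (e / 2) *: (y - x)); split => //; first exact: Cline.
move=> b'; rewrite inE => /predU1P[->|]; last exact: st.
by rewrite aff_conv bx0 mulr0 add0r mulf_neq0// gt_eqF// divr_gt0.
Qed.

End affine_geometry.

(** * Replacing jumps by ramps *)

Section ramp.
Variable R : realType.
Implicit Types l m : R.

Definition relu (z : R) : R := Num.max z 0.

(* [ramp l m] climbs from 0 to [m] as [l] goes from [- `|m| / 2] to [`|m| / 2]; it rests on
   two neurons if [l] and [m] are affine. *)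
Definition ramp l m : R := relu (l + m / 2) - relu (l - m / 2).

Lemma reluE z : relu z = (z + `|z|) / 2.
Proof.
rewrite /relu; have [z0|z0] := leP z 0.
  by rewrite ler0_norm// subrr mul0r.
by rewrite gtr0_norm//; field.
Qed.

Lemma reluN z : relu (- z) = relu z - z.
Proof. by rewrite !reluE normrN; field. Qed.

Lemma relu_gt0 z : 0 <= z -> relu z = z.
Proof. by move=> z0; rewrite /relu max_l. Qed.

Lemma relu_le0 z : z <= 0 -> relu z = 0.
Proof. by move=> z0; rewrite /relu max_r. Qed.

Lemma cvg_relu T (F : set_system T) (FF : Filter F) (z_ : T -> R) z :
  z_ @ F --> z -> relu (z_ t) @[t --> F] --> relu z.
Proof.
move=> cz; under eq_fun do rewrite reluE.
rewrite reluE; apply: cvgMr_tmp; apply: cvgD => //; exact: cvg_norm.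
Qed.

Lemma cvg_ramp T (F : set_system T) (FF : Filter F) (l_ m_ : T -> R) l m :
  l_ @ F --> l -> m_ @ F --> m -> ramp (l_ t) (m_ t) @[t --> F] --> ramp l m.
Proof.
move=> cl cm; apply: cvgB; apply: cvg_relu; [apply: cvgD|apply: cvgB] => //;
exact: cvgMr_tmp.
Qed.

(** The reflection symmetry of the transition layer. *)
Lemma rampN l m : ramp (- l) m = m - ramp l m.
Proof.
rewrite /ramp; have -> : - l + m / 2 = - (l - m / 2) by ring.
have -> : - l - m / 2 = - (l + m / 2) by ring.
by rewrite !reluN; field.
Qed.

Lemma ramp_sat l m : `|m| <= 2 * l -> ramp l m = m.
Proof.
rewrite ler_norml => /andP[h1 h2].
by rewrite /ramp !relu_gt0; lra.
Qed.

Lemma ramp_eq0 l m : `|m| <= - (2 * l) -> ramp l m = 0.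
Proof.
rewrite ler_norml => /andP[h1 h2].
by rewrite /ramp !relu_le0; lra.
Qed.

(** The ramp stays between 0 and m, whatever the sign of m. This product is what survives of the
    change of the loss, so its sign decides the improvement. *)
Lemma ramp_between l m : 0 <= ramp l m * (m - ramp l m).
Proof.
rewrite -rampN /ramp.
have [m0|m0] := leP 0 m.
  apply: mulr_ge0; rewrite subr_ge0 /relu; apply: le_max2; lra.
rewrite -mulrNN; apply: mulr_ge0; rewrite oppr_ge0 subr_le0 /relu; apply: le_max2; lra.
Qed.

Lemma ramp_norm l m : `|ramp l m| <= `|m|.
Proof.
have := ramp_between l m; set r := ramp l m => h.
have [m0|m0] := leP 0 m; [rewrite (ger0_norm m0)|rewrite (ltr0_norm m0)]; rewrite ler_norml; nra.
Qed.

Lemma ramp0 m : ramp 0 m = m / 2.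
Proof. by rewrite /ramp add0r sub0r reluN; lra. Qed.

End ramp.

(** * Coordinates adapted to a hyperplane *)

Section affine_maps.
Variables (R : realType) (n : nat).

Lemma aff_coord (j : 'I_n) : exists b : 'rV[R]_n.+1, forall x : 'rV[R]_n, x ord0 j = aff b x.
Proof.
exists (delta_mx ord0 (lift ord0 j)) => x.
rewrite affE mxE/= (bigD1 j)//= big1 => [|l lj].
  by rewrite [X in _ + (X * _ + _)]mxE !eqxx/= mul1r addr0 add0r.
by rewrite mxE/= (inj_eq (@lift_inj _ ord0)) (negbTE lj) mul0r.
Qed.

Lemma continuous_affine_map (M : 'M[R]_n) (c : 'rV[R]_n) :
  continuous (fun z : 'rV[R]_n => z *m M + c).
Proof.
move=> z; apply: (@cvg_rV _ _ (nbhs z)) => j.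
have [b bE] := aff_coord j; have [b' b'E] := aff_comp b M c.
under eq_fun do rewrite bE b'E.
by rewrite bE b'E; exact: continuous_aff.
Qed.

(** Small e zooms into the layer around the hyperplane z_0 = 0, [dil 0] projects onto it and
    [dil (-1)] reflects in it. *)
Definition dil (e : R) : 'M[R]_n.+1 := diag_mx (\row_j if j == ord0 then e else 1).

Lemma mul_dil e e' : dil e *m dil e' = dil (e * e').
Proof.
rewrite /dil mulmx_diag; congr diag_mx; apply/rowP => j; rewrite !mxE.
by case: ifP; rewrite ?mulr1.
Qed.

Lemma dil1 : dil 1 = 1%:M.
Proof.
rewrite /dil -diag_const_mx; congr diag_mx; apply/rowP => j; rewrite !mxE.
by case: ifP.
Qed.

Lemma dil_unit e : e != 0 -> dil e \in unitmx.
Proof.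
move=> e0; have /mulmx1_unit[]// : dil e *m dil e^-1 = 1%:M.
by rewrite mul_dil divff// dil1.
Qed.

Lemma dilE e : dil e = dil 0 + e *: delta_mx ord0 ord0.
Proof.
apply/matrixP => i j; rewrite !mxE.
have [->|ij] := eqVneq i j; last first.
  rewrite !mulr0n add0r; have [i0|] := eqVneq i ord0; last by rewrite mulr0.
  have [j0|] := eqVneq j ord0; last by rewrite mulr0.
  by rewrite i0 j0 eqxx in ij.
by rewrite andbb !mulr1n; have [_|_] := eqVneq j ord0; rewrite ?mulr1 ?mulr0 ?add0r ?addr0.
Qed.

Lemma mulmx_dil (z : 'rV[R]_n.+1) e j :
  (z *m dil e) ord0 j = (if j == ord0 then e else 1) * z ord0 j.
Proof. by rewrite /dil mul_mx_diag !mxE mulrC. Qed.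

End affine_maps.

Section indicator.
Variable R : realType.

Definition ind (t : R) : R := (0 < t)%R%:R.

Lemma cvg_ind T (F : set_system T) (FF : Filter F) (t_ : T -> R) t : t != 0 ->
  t_ @ F --> t -> ind (t_ x) @[x --> F] --> ind t.
Proof.
move=> t0 ct; apply: cvg_near_cst; rewrite /ind.
have [tp|tn|/eqP] := ltgtP 0 t; last by rewrite eq_sym (negbTE t0).
  by move/cvgr_gt : ct => /(_ _ tp); apply: filterS => x ->.
by move/cvgr_lt : ct => /(_ _ tn); apply: filterS => x xt; rewrite ltNge ltW.
Qed.

Lemma ind_norm t : `|ind t| <= 1.
Proof. by rewrite /ind; case: (0 < t); rewrite ?normr1 ?normr0. Qed.

Lemma indN t : t != 0 -> ind (- t) = 1 - ind t.
Proof.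
move=> t0; rewrite /ind oppr_gt0; case: ltgtP t0 => //; by rewrite ?subr0 ?subrr.
Qed.

Lemma indM e t : 0 < e -> ind (e * t) = ind t.
Proof. by move=> e0; rewrite /ind pmulr_rgt0. Qed.

End indicator.

Lemma negligible_fin_bigcup d (T : measurableType d) (R : realType)
    (mu : {measure set T -> \bar R}) (I : finType) (P : pred I) (H : I -> set T) :
  (forall i, P i -> mu.-negligible (H i)) ->
  mu.-negligible (\bigcup_(i in [set i | P i]) H i).
Proof.
move=> nH.
pose H' k := if onth (enum I) k is Some i then (if P i then H i else set0) else set0.
apply: (@negligibleS _ _ _ _ (\bigcup_k H' k)).
  move=> x [i /= Pi Hx]; exists (index i (enum I)) => //.
  by rewrite /H' onthE (nth_map i) ?index_mem ?mem_enum// nth_index ?mem_enum// Pi.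
apply: negligible_bigcup => k; rewrite /H'; case: onth => [i|]; last exact: negligible_set0.
by case: ifPn => [/nH//|_]; exact: negligible_set0.
Qed.

(** * The change of the loss when jumps become ramps *)

Section improvement.
Variables (R : realType) (d' : nat).
Local Notation n := d'.+1.
Local Notation lam := (@lebesgue_rV R n).
Variables (Q : set 'rV[R]_n) (p : 'rV[R]_n -> R).
Hypothesis oQ : open Q.
Hypothesis bQ : exists B, forall x, Q x -> forall i, `|x ord0 i| <= B.
Hypothesis cp : continuous p.
Hypothesis p0 : forall x, 0 <= p x.
Hypothesis pQ : forall x, 0 < p x <-> Q x.
Variable f : 'rV[R]_n -> R.
Hypothesis bf : bm Q f.
Hypothesis cf : forall x, Q x -> {for x, continuous f}.
Variables (I : finType) (P : pred I) (a A v : I -> 'rV[R]_n.+1) (eta : I -> R).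
Variable u0 : 'rV[R]_n -> R.
Hypothesis bu : bm Q u0.
Hypothesis cu : forall x, Q x -> {for x, continuous u0}.
Hypothesis eta0 : forall i, P i -> 0 < eta i.
Hypothesis aQ : forall i, P i -> exists2 x, Q x & aff (a i) x = 0.
Hypothesis al : forall i, P i -> lin (a i) != 0.
Hypothesis aa : forall i j, P i -> P j -> i != j ->
  exists2 y, aff (a i) y = 0 & aff (a j) y != 0.
Hypothesis aA : forall i, P i -> exists2 y, aff (a i) y = 0 & aff (A i) y != 0.

(** The i-th jump takes place across the hyperplane of [a i] and has height [A i]; its ramp has
    steepness [eta i / e] and is displaced by [s * aff (v i) x]. *)
Definition step i x := ind (aff (a i) x) * aff (A i) x.
Definition rmp e s i x :=
  ramp (eta i / e * aff (a i) x + s * aff (v i) x) (aff (A i) x).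
Definition jumpy x := u0 x + \sum_(i | P i) step i x.
Definition ramped e s x := u0 x + \sum_(i | P i) rmp e s i x.

(** Outside a layer of width O(e) around the hyperplane, the ramp is saturated. *)
Lemma rmp_eq_step e s i x : P i -> 0 < e ->
  e * `|aff (A i) x| + 2 * e * `|s * aff (v i) x| <= 2 * eta i * `|aff (a i) x| ->
  rmp e s i x = step i x.
Proof.
move=> Pi e0; rewrite /rmp /step /ind.
set t := aff (a i) x; set m := aff (A i) x; set w := s * _ => h.
have ee : e != 0 by rewrite gt_eqF.
have h' : `|m| <= 2 * (eta i / e * `|t|) - 2 * `|w|.
  rewrite -(ler_pM2l e0) mulrBr.
  have -> : e * (2 * (eta i / e * `|t|)) = 2 * eta i * `|t| by field.
  lra.
have := ler_norm w; have := ler_norm (- w); rewrite normrN => w1 w2.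
have [tp|tn|t0] := ltgtP 0 t.
- by rewrite mul1r ramp_sat//; rewrite (gtr0_norm tp) in h'; lra.
- by rewrite mul0r ramp_eq0//; rewrite (ltr0_norm tn) in h'; lra.
- rewrite mul0r; rewrite -t0 normr0 !mulr0 in h' *.
  have m0 : `|m| <= 0 by have := normr_ge0 w; lra.
  by rewrite normr_le0 in m0; rewrite (eqP m0) /ramp !mul0r addr0 subr0 subrr.
Qed.

Lemma bm_aff b : bm Q (aff b).
Proof. by apply: bm_continuous => //; exact: continuous_aff. Qed.

Lemma bm_step i : bm Q (step i).
Proof.
apply: bmM; last exact: bm_aff.
split; last by exists 1 => x _; exact: ind_norm.
rewrite (_ : (fun x => _) = \1_[set x | 0 < aff (a i) x]); last first.
  apply/funext => x; rewrite /ind indicE; congr ((nat_of_bool _)%:R).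
  by apply/idP/idP; rewrite inE.
apply: measurable_indic; apply: measurable_rV_open.
rewrite -[X in open X]/(aff (a i) @^-1` [set y | 0 < y]).
by apply: open_comp => [x _|]; [exact: continuous_aff|exact: open_gt].
Qed.

Lemma continuous_rmp e s i : continuous (rmp e s i).
Proof.
move=> x; apply: (@cvg_ramp _ _ (nbhs x)); last exact: continuous_aff.
apply: cvgD; apply: cvgMl_tmp; exact: continuous_aff.
Qed.

Lemma bm_rmp e s i : bm Q (rmp e s i).
Proof. by apply: bm_continuous => //; exact: continuous_rmp. Qed.

Lemma bm_jumpy : bm Q jumpy.
Proof. by apply: bmD => //; apply: bm_sum => i _; exact: bm_step. Qed.

Lemma bm_ramped e s : bm Q (ramped e s).
Proof. by apply: bmD => //; apply: bm_sum => i _; exact: bm_rmp. Qed.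

(** The share of the i-th jump in the difference of squares (ramped - f)^2 - (jumpy - f)^2 = (jumpy
    + ramped - 2 f) (ramped - jumpy). *)
Let T e s i x := (jumpy x + ramped e s x - 2 * f x) * (rmp e s i x - step i x).

Let bm_T e s i : bm Q (T e s i).
Proof.
apply: bmM; last by apply: bmB; [exact: bm_rmp|exact: bm_step].
by apply: bmB; [apply: bmD; [exact: bm_jumpy|exact: bm_ramped]|exact: bmZ].
Qed.

Lemma loss_ramped e s :
  wint p (fun x => (ramped e s x - f x) ^+ 2) - wint p (fun x => (jumpy x - f x) ^+ 2) =
  \sum_(i | P i) wint p (T e s i).
Proof.
rewrite -(wintB oQ bQ cp p0 pQ); last 2 first.
- by apply: bmX; apply: bmB => //; exact: bm_ramped.
- by apply: bmX; apply: bmB => //; exact: bm_jumpy.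
rewrite -(wint_sum oQ bQ cp p0 pQ) => [|i _]; last exact: bm_T.
congr wint; apply/funext => x.
rewrite /T -mulr_sumr (_ : \sum_(i | P i) _ = ramped e s x - jumpy x); first ring.
by rewrite /ramped /jumpy sumrB; ring.
Qed.

Let T_bounded : exists2 C, 0 <= C & forall e s i x, P i -> Q x -> `|T e s i x| <= C.
Proof.
have [_ [Mu hu]] := bu; have [_ [Mf hf]] := bf.
have /choice[MA hA] : forall i, exists M, forall x, Q x -> `|aff (A i) x| <= M.
  by move=> i; have [_ ?] := bm_aff (A i).
have MA0 i x : Q x -> 0 <= MA i by move=> Qx; exact: le_trans (hA i x Qx).
have hs i x : Q x -> `|step i x| <= MA i.
  move=> Qx; rewrite normrM (le_trans _ (hA i x Qx))// ler_piMl//; exact: ind_norm.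
have hr e s i x : Q x -> `|rmp e s i x| <= MA i.
  by move=> Qx; rewrite (le_trans (ramp_norm _ _))// hA.
pose S := \sum_(i | P i) MA i.
exists (`|(Mu + S + (Mu + S) + 2 * Mf) * (S + S)|) => // e s i x Pi Qx.
apply: le_trans (ler_norm _).
have Sg phi : (forall i, `|phi i| <= MA i) -> `|\sum_(i | P i) phi i| <= S.
  by move=> h; rewrite (le_trans (ler_norm_sum _ _ _))// ler_sum.
have MS : MA i <= S.
  by rewrite /S (bigD1 i)//= lerDl; apply: sumr_ge0 => j _; exact: MA0 Qx.
rewrite /T normrM ler_pM//.
  rewrite (le_trans (ler_normB _ _))// lerD//.
    rewrite (le_trans (ler_normD _ _))// lerD//.
      by rewrite (le_trans (ler_normD _ _))// lerD ?hu// Sg// => j; exact: hs.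
    by rewrite (le_trans (ler_normD _ _))// lerD ?hu// Sg// => j; exact: hr.
  by rewrite normrM ger0_norm// ler_pM2l// hf.
by rewrite (le_trans (ler_normB _ _))// lerD// (le_trans _ MS) ?hs ?hr.
Qed.

Section limits.
Variables (e_ : nat -> R) (x_ : nat -> 'rV[R]_n) (y : 'rV[R]_n) (s : R).
Hypothesis e_gt0 : forall k, 0 < e_ k.
Hypothesis e_cvg : e_ @ \oo --> (0 : R).
Hypothesis x_cvg : x_ @ \oo --> y.

Let aff_cvg b : aff b (x_ k) @[k --> \oo] --> aff b y.
Proof. by exact: (cvg_comp _ _ x_cvg (@continuous_aff R n b y)). Qed.

Let step_cvg j : aff (a j) y != 0 -> step j (x_ k) @[k --> \oo] --> step j y.
Proof. by move=> ay; apply: cvgM; [exact: cvg_ind|exact: aff_cvg]. Qed.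

Let rmp_cvg j : P j -> aff (a j) y != 0 ->
  rmp (e_ k) s j (x_ k) @[k --> \oo] --> step j y.
Proof.
move=> Pj ay; apply: cvg_trans (step_cvg ay); apply: near_eq_cvg.
have c : 2 * eta j * `|aff (a j) (x_ k)| - (e_ k * `|aff (A j) (x_ k)| +
    2 * e_ k * `|s * aff (v j) (x_ k)|) @[k --> \oo] -->
    2 * eta j * `|aff (a j) y| - (0 * `|aff (A j) y| + 2 * 0 * `|s * aff (v j) y|).
  apply: cvgB; first by apply: cvgMl_tmp; exact: cvg_norm.
  apply: cvgD; apply: cvgM => //; try exact: cvg_norm.
    exact: cvgMl_tmp.
  by apply: cvg_norm; exact: cvgMl_tmp.
have : 0 < 2 * eta j * `|aff (a j) y| - (0 * `|aff (A j) y| + 2 * 0 * `|s * aff (v j) y|).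
  by rewrite mulr0 !mul0r addr0 subr0 !mulr_gt0 ?normr_gt0// eta0.
move=> /(cvgr_gt _ c); apply: filterS => k; rewrite subr_gt0 => /ltW h.
by rewrite rmp_eq_step.
Qed.

(** The points approach [y] at a fixed position t inside the layer of jump i. As [y] lies off the
    other hyperplanes, all other ramps have already turned into steps, and both sums share the same
    limit c. *)
Lemma T_cvg i t : P i -> Q y -> t != 0 ->
  (forall j, P j -> j != i -> aff (a j) y != 0) ->
  (forall k, aff (a i) (x_ k) = e_ k * t) ->
  let c := u0 y + \sum_(j | P j && (j != i)) step j y in
  let m := aff (A i) y in
  let r := ramp (eta i * t + s * aff (v i) y) m in
  T (e_ k) s i (x_ k) * p (x_ k) @[k --> \oo] -->
    (c + ind t * m + (c + r) - 2 * f y) * (r - ind t * m) * p y.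
Proof.
move=> Pi Qy t0 ay ax c m r.
have cstep : step i (x_ k) @[k --> \oo] --> ind t * m.
  rewrite (_ : (fun k => _) = (fun k => ind t * aff (A i) (x_ k))); last first.
    by apply/funext => k; rewrite /step ax indM.
  by apply: cvgMl_tmp; exact: aff_cvg.
have crmp : rmp (e_ k) s i (x_ k) @[k --> \oo] --> r.
  apply: cvg_ramp; last exact: aff_cvg.
  rewrite (_ : (fun k => _) = (fun k => eta i * t + s * aff (v i) (x_ k))); last first.
    apply/funext => k; rewrite ax; congr (_ + _).
    by rewrite mulrA divfK// gt_eqF.
  by apply: cvgD; [exact: cvg_cst|apply: cvgMl_tmp; exact: aff_cvg].
have cu0 : u0 (x_ k) @[k --> \oo] --> u0 y.
  exact: (cvg_comp _ _ x_cvg (cu Qy)).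
have cpx : p (x_ k) @[k --> \oo] --> p y by exact: (cvg_comp _ _ x_cvg (@cp y)).
have cfx : f (x_ k) @[k --> \oo] --> f y by exact: (cvg_comp _ _ x_cvg (cf Qy)).
apply: cvgM => //; apply: cvgM; last exact: cvgB.
apply: cvgB; last by apply: cvgMl_tmp; exact: cfx.
apply: cvgD.
  rewrite (_ : (fun k => _) = (fun k => u0 (x_ k) + \sum_(j | P j && (j != i)) step j (x_ k) + step i (x_ k))); last first.
    by apply/funext => k; rewrite /jumpy (bigD1 i)//= [step i _ + _]addrC addrA.
  apply: cvgD => //; apply: cvgD => //.
  apply: cvg_big => [|j /andP[Pj ji]]; first by move=> q; exact: add_continuous.
  by apply: step_cvg; exact: ay.
rewrite (_ : (fun k => _) = (fun k => u0 (x_ k) + \sum_(j | P j && (j != i)) rmp (e_ k) s j (x_ k) + rmp (e_ k) s i (x_ k))); last first.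
  by apply/funext => k; rewrite /ramped (bigD1 i)//= [rmp _ _ i _ + _]addrC addrA.
apply: cvgD => //; apply: cvgD => //.
apply: cvg_big => [|j /andP[Pj ji]]; first by move=> q; exact: add_continuous.
by apply: rmp_cvg => //; exact: ay.
Qed.

(** No continuity of [f] is available off [Q]; there the weight, which is continuous and vanishes
    outside [Q], forces the limit 0. *)
Lemma T_cvg0 i : P i -> ~ Q y -> T (e_ k) s i (x_ k) * p (x_ k) @[k --> \oo] --> (0 : R).
Proof.
move=> Pi nQy; have [C C0 hC] := T_bounded.
apply/norm_cvg0P.
apply: (@squeeze_cvgr _ _ _ _ (fun=> 0) (fun k => C * p (x_ k))).
- apply: nearW => k; rewrite normr_ge0/= normrM (ger0_norm (p0 _)).
  have [Qx|nQx] := pselect (Q (x_ k)); first by rewrite ler_wpM2r// hC.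
  by rewrite (weight_eq0 p0 pQ nQx) !mulr0.
- exact: cvg_cst.
- rewrite -(mulr0 C); apply: cvgMl_tmp.
  by have := cvg_comp _ _ x_cvg (@cp y); rewrite (weight_eq0 p0 pQ nQy).
Qed.

End limits.

Let e_ (k : nat) : R := k.+1%:R^-1.

Let e_gt0 k : 0 < e_ k. Proof. by rewrite invr_gt0. Qed.

Let e_cvg : e_ @ \oo --> (0 : R). Proof. exact: cvg_harmonic. Qed.

(* In the coordinates z with [aff (a i) x = e * z_0], the integrand converges; pairing z_0
   with - z_0 and s with - s leaves [- 2 R (m - R) p], where [R] is the ramp and [m] the jump. *)
Lemma T_sum_lt0 i : P i ->
  \forall k \near \oo, wint p (T (e_ k) 1 i) + wint p (T (e_ k) (-1) i) < 0.
Proof.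
move=> Pi; have [xk Qxk axk] := aQ Pi.
have [M0 uM0 M0a] := unit_row0 (al Pi).
have uMT : M0^T \in unitmx by rewrite unitmx_tr.
pose N0 := invmx M0^T.
have uN0 : N0 \in unitmx by rewrite unitmx_inv.
(* [Psi 0] lands on the hyperplane, so limits are evaluated there; [Psi (- e)] is [Psi e] after the
   reflection of z_0. *)
pose Psi e (z : 'rV[R]_n) := z *m (dil d' e *m N0) + xk.
have PsiK e z : (Psi e z - xk) *m M0^T = z *m dil d' e.
  by rewrite /Psi addrK mulmxA mulmxKV.
have M0E (y : 'rV[R]_n) : \sum_j lin (a i) ord0 j * y ord0 j = (y *m M0^T) ord0 ord0.
  rewrite [RHS]mxE; apply: eq_bigr => j _; rewrite mulrC; congr (_ * _).
  by rewrite -M0a !mxE.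
have aPsi e z : aff (a i) (Psi e z) = e * z ord0 ord0.
  have -> : Psi e z = xk + (Psi e z - xk) by rewrite addrC subrK.
  by rewrite affDx axk add0r M0E PsiK mulmx_dil eqxx.
have PsiN e z : Psi e (z *m dil d' (-1)) = Psi (- e) z.
  by rewrite /Psi mulmxA -[z *m _ *m _]mulmxA mul_dil mulN1r mulmxA.
have Psi_cvg (c_ : nat -> R) z : c_ @ \oo --> (0 : R) -> Psi (c_ k) z @[k --> \oo] --> Psi 0 z.
  move=> cc; rewrite (_ : (fun k => _) = (fun k => Psi 0 z + c_ k *: (z *m (delta_mx ord0 ord0 *m N0)))); last first.
    apply/funext => k; rewrite /Psi dilE mulmxDl mulmxDr addrAC; congr (_ + _).
    by rewrite -scalemxAl -scalemxAr.
  rewrite -[X in _ --> X]addr0 -(scale0r (z *m (delta_mx ord0 ord0 *m N0))).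
  by apply: cvgD; [exact: cvg_cst|exact: cvgZr_tmp].
pose W s e x := T e s i x * p x.
have mW s e : measurable_fun setT (W s e).
  by have [] := bm_weighted bQ cp p0 pQ (bm_T e s i).
(* The reflection preserves Lebesgue measure, so using [Psi (- e_ k)] in the second term does not
   alter its integral; the Jacobian is a positive factor common to both terms. *)
pose h_ k (z : 'rV[R]_n) := W 1 (e_ k) (Psi (e_ k) z) + W (-1) (e_ k) (Psi (- e_ k) z).
pose rr (z : 'rV[R]_n) := ramp (eta i * z ord0 ord0 + aff (v i) (Psi 0 z)) (aff (A i) (Psi 0 z)).
pose h (z : 'rV[R]_n) := - 2 * (rr z * (aff (A i) (Psi 0 z) - rr z)) * p (Psi 0 z).
have mPsi e : measurable_fun setT (Psi e).
  by apply: continuous_measurable_rV; exact: continuous_affine_map.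
have int_h k : exists2 c, 0 < c & \int[lam]_z h_ k z = c * (wint p (T (e_ k) 1 i) + wint p (T (e_ k) (-1) i)).
  have ue : dil d' (e_ k) *m N0 \in unitmx.
    by rewrite unitmx_mul uN0 andbT dil_unit// gt_eqF.
  have [_ [c c0 cE]] := lebesgue_rV_affine xk ue.
  exists c => //.
  have iW s : lam.-integrable setT (EFin \o W s (e_ k)).
    exact (bm_integrable oQ bQ cp p0 pQ (bm_T (e_ k) s i)).
  have i1 s := integrable_scaling_map (mPsi (e_ k)) c0 cE (iW s).
  have invol E : measurable E -> lam ((fun z => z *m dil d' (-1)) @^-1` E) = (1%:E * lam E)%E.
    by move=> mE; rewrite mul1e lebesgue_rV_involution// mul_dil mulrNN mulr1 dil1.
  have mrho : measurable_fun setT (fun z : 'rV[R]_n => z *m dil d' (-1)).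
    exact: measurable_mulmxr.
  have i2 s : lam.-integrable setT (EFin \o (W s (e_ k) \o Psi (- e_ k))).
    have -> : W s (e_ k) \o Psi (- e_ k) = (W s (e_ k) \o Psi (e_ k)) \o (fun z => z *m dil d' (-1)).
      by apply/funext => z; rewrite /comp PsiN.
    exact: (integrable_scaling_map mrho ltr01 invol (i1 s)).
  rewrite RintegralD//; [|exact: i1|exact: i2].
  have -> : \int[lam]_z W (-1) (e_ k) (Psi (- e_ k) z) = \int[lam]_z W (-1) (e_ k) (Psi (e_ k) z).
    rewrite -[RHS]mul1r -(Rintegral_scaling_map mrho ltr01 invol (i1 (-1))).
    by apply: eq_Rintegral => z _; rewrite /comp PsiN.
  by rewrite !(Rintegral_scaling_map (mPsi (e_ k)) c0 cE)// -mulrDr.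
suff : \forall k \near \oo, \int[lam]_z h_ k z < 0.
  apply: filterS => k; have [c c0 ->] := int_h k.
  by rewrite pmulr_rlt0.
have [_ [VB hV]] := bm_aff (v i); have [_ [AB hA]] := bm_aff (A i).
have VB0 : 0 <= VB by exact: le_trans (hV _ Qxk).
have AB0 : 0 <= AB by exact: le_trans (hA _ Qxk).
have [B1 hB1] : exists B, forall x, Q x -> `|(x - xk) *m M0^T| <= B.
  have [|B hB] := @continuous_bounded_on_bounded _ _ Q bQ (fun x => `|x *m M0^T + (- xk *m M0^T)|).
    by move=> x; apply: (cvg_norm (@continuous_affine_map R n M0^T (- xk *m M0^T) x)).
  by exists B => x Qx; rewrite mulmxBl -mulNmx; have := hB x Qx; rewrite normr_id.
(* The threshold of [rmp_eq_step] divided by e: beyond it in |z_0| the integrand vanishes. The other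
   coordinates do not depend on e and are bounded by [B1]. Hence the dominating function lives on
   the fixed box [E]. *)
pose B0 := (AB + 2 * VB) / (2 * eta i).
pose E := [set z : 'rV[R]_n | forall j, z ord0 j \in `[- (Num.max B0 B1), Num.max B0 B1]].
have mE : measurable E by exact: measurable_rV_box.
have Eoo : (lam E < +oo)%E.
  apply: (@lebesgue_rV_bounded _ _ _ (Num.max B0 B1)) => // z Ez j.
  by have := Ez j; rewrite in_itv/= -ler_norml.
have e_le1 k : e_ k <= 1 by rewrite invf_le1// ler1n.
have ei := eta0 Pi.
have outE k s e' z : `|e'| = e_ k -> `|s| = 1 -> ~ E z -> W s (e_ k) (Psi e' z) = 0.
  move=> ee' s1 nE; rewrite /W.
  have [Qx|nQx] := pselect (Q (Psi e' z)); last by rewrite (weight_eq0 p0 pQ nQx) mulr0.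
  have [zB|zB] := leP `|z ord0 ord0| B0.
    exfalso; apply: nE => j; rewrite in_itv/= -ler_norml le_max.
    have [->|j0] := eqVneq j ord0; first by rewrite zB.
    apply/orP; right; rewrite (le_trans _ (hB1 _ Qx))//.
    by rewrite PsiK (le_trans _ (rV_coord_le_norm _ j))// mulmx_dil (negbTE j0) mul1r.
  rewrite /T rmp_eq_step ?subrr ?mulr0 ?mul0r//.
  rewrite aPsi [`|s * _|]normrM s1 mul1r [`|e' * _|]normrM ee'.
  have := hV _ Qx; have := hA _ Qx; have ek := e_gt0 k => hA' hV'.
  have -> : e_ k * `|aff (A i) (Psi e' z)| + 2 * e_ k * `|aff (v i) (Psi e' z)| =
    e_ k * (`|aff (A i) (Psi e' z)| + 2 * `|aff (v i) (Psi e' z)|) by ring.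
  have -> : 2 * eta i * (e_ k * `|z ord0 ord0|) = e_ k * (2 * eta i * `|z ord0 ord0|) by ring.
  rewrite ler_pM2l//; move: zB; rewrite /B0 ltr_pdivrMr ?mulr_gt0// => zB; lra.
have [C C0 hC] := T_bounded.
have [PP PP0 hPP] := weight_bounded bQ cp p0 pQ.
have Wb s e x : `|W s e x| <= C * PP.
  rewrite /W normrM (ger0_norm (p0 x)).
  have [Qx|nQx] := pselect (Q x); last by rewrite (weight_eq0 p0 pQ nQx) mulr0 mulr_ge0.
  by rewrite ler_pM// ?hC//; have := hPP x; rewrite indicE mem_set// mulr1.
have dom k z : `|h_ k z| <= (C * PP + C * PP) * \1_E z.
  rewrite indicE; have [zE|zE] := boolP (z \in E).
    by rewrite mulr1 (le_trans (ler_normD _ _))// lerD.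
  rewrite mulr0 /h_ !outE ?addr0 ?normr0 ?normr1 ?normrN1 ?normrN ?gtr0_norm//; by rewrite notin_setE in zE.
(* The exceptional set: at z_0 = 0 the identity [indN] fails, and where [Psi 0 z] lies on another
   hyperplane, that jump is not resolved. *)
pose Z := [set z : 'rV[R]_n | z ord0 ord0 = 0] `|`
  \bigcup_(j in [set j | P j && (j != i)]) [set z : 'rV[R]_n | aff (a j) (Psi 0 z) = 0].
have [b0 b0E] := @aff_coord R n ord0.
have b00 : b0 != 0.
  apply/eqP => b00; have := b0E (const_mx 1).
  by rewrite b00 aff0 mxE => /eqP; rewrite oner_eq0.
have /choice[bb bbE] : forall j, exists b', forall z, aff (a j) (Psi 0 z) = aff b' z.
  by move=> j; exact: aff_comp.
have PsiS y : aff (a i) y = 0 -> Psi 0 ((y - xk) *m M0^T) = y.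
  move=> ay; rewrite /Psi.
  have -> : (y - xk) *m M0^T *m (dil d' 0 *m N0) = (y - xk) *m M0^T *m N0.
    rewrite mulmxA; congr (_ *m _); apply/rowP => j; rewrite mulmx_dil.
    have [->|] := eqVneq j ord0; last by rewrite mul1r.
    rewrite mul0r -M0E; have := ay.
    by rewrite -{1}(subrK xk y) [y - xk + xk]addrC affDx axk add0r => ->.
  by rewrite mulmxK// subrK.
have ZE : Z = [set z | aff b0 z = 0] `|` \bigcup_(j in [set j | P j && (j != i)]) [set z | aff (bb j) z = 0].
  congr (_ `|` _); first by apply/seteqP; split => z /=; rewrite b0E.
  by apply: eq_bigcupr => j _; apply/seteqP; split => z /=; rewrite bbE.
have mH b : measurable [set z : 'rV[R]_n | aff b z = 0].
  rewrite -[X in measurable X]/(aff b @^-1` [set 0]).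
  exact: measurable_preimage (measurable_aff b) (measurable_set1 _).
have mZ : measurable Z.
  rewrite ZE; apply: measurableU => //.
  by apply: fin_bigcup_measurable; [exact: finite_finset|].
have Z0 : lam Z = 0%E.
  apply: measure_negligible => //; rewrite ZE; apply: negligibleU.
    by apply/negligibleP => //; exact: lebesgue_rV_hyperplane.
  apply: negligible_fin_bigcup => j /andP[Pj ji]; apply/negligibleP => //.
  apply: lebesgue_rV_hyperplane; apply/eqP => bj.
  have [|y ay] := aa Pi Pj; first by rewrite eq_sym.
  by rewrite -(PsiS y ay) bbE bj aff0 eqxx.
have h_cvg z : ~ Z z -> h_ k z @[k --> \oo] --> h z.
  move=> nZ.
  have z0 : z ord0 ord0 != 0 by apply/eqP => z0; apply: nZ; left.
  have aj j : P j -> j != i -> aff (a j) (Psi 0 z) != 0.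
    by move=> Pj ji; apply/eqP => aj; apply: nZ; right; exists j => //=; rewrite Pj ji.
  have c1 := Psi_cvg e_ z e_cvg.
  have c2 : Psi (- e_ k) z @[k --> \oo] --> Psi 0 z.
    by apply: Psi_cvg; rewrite -oppr0; exact: cvgN.
  have [Qy|nQy] := pselect (Q (Psi 0 z)); last first.
    rewrite /h (weight_eq0 p0 pQ nQy) mulr0 -[X in _ --> X]addr0.
    by apply: cvgD; [exact: (T_cvg0 e_ 1 c1 Pi nQy)|exact: (T_cvg0 e_ (-1) c2 Pi nQy)].
  have := T_cvg (s := 1) e_gt0 e_cvg c1 Pi Qy z0 aj (fun k => aPsi (e_ k) z).
  have zN0 : - z ord0 ord0 != 0 by rewrite oppr_eq0.
  have aN k : aff (a i) (Psi (- e_ k) z) = e_ k * - z ord0 ord0 by rewrite aPsi mulNr mulrN.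
  have := T_cvg (s := -1) e_gt0 e_cvg c2 Pi Qy zN0 aj aN.
  move=> /= t2 t1; have t12 := cvgD t1 t2.
  set lim12 := (X in _ --> X) in t12; suff <- : lim12 = h z by exact: t12.
  (* With I the indicator, r the ramp and m the jump, all terms in c and f cancel and 2 (r - I m) (r
     + I m - m) remains; I^2 = I then removes I. *)
  rewrite /lim12 mul1r mulN1r mulrN -opprD rampN indN// /h /rr.
  by rewrite /ind; case: (0 < z ord0 ord0); rewrite /=; ring.
have cPsi : continuous (Psi 0) by exact: continuous_affine_map.
have cA b z : aff b (Psi 0 z') @[z' --> z] --> aff b (Psi 0 z).
  exact: (cvg_comp _ _ (cPsi z) (@continuous_aff R n b (Psi 0 z))).
have crr z : rr z' @[z' --> z] --> rr z.
  have cz : (fun z' : 'rV[R]_n => eta i * z' ord0 ord0) @ z --> eta i * z ord0 ord0.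
    exact: (cvgMl_tmp (@coord_continuous R 1 n ord0 ord0 z)).
  have cl := @cvgD _ _ _ _ (nbhs_filter z) _ _ _ _ cz (cA (v i) z).
  exact: (cvg_ramp (nbhs_filter z) cl (cA (A i) z)).
have ch : continuous h.
  move=> z.
  have c0 := cvg_comp _ _ (cPsi z) (@cp (Psi 0 z)).
  have FF := nbhs_filter z.
  have c1 := @cvgB _ _ _ _ FF _ _ _ _ (cA (A i) z) (crr z).
  have c2 := @cvgM _ _ _ FF _ _ _ _ (crr z) c1.
  have c3 := @cvgMl_tmp _ _ _ FF _ (-2) _ c2.
  exact: (@cvgM _ _ _ FF _ _ _ _ c3 c0).
have mh : measurable_fun setT h by exact: continuous_measurable_rVR.
have mh_ k : measurable_fun setT (h_ k).
  by apply: measurable_funD; apply: measurableT_comp.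
have [ih cvh] := Rintegral_dominated_cvg mE Eoo mh_ mh dom mZ Z0 h_cvg.
suff : \int[lam]_z h z < 0 by move=> hlt; move/cvgr_lt : cvh => /(_ _ hlt).
have [y [Qy ay Ay]] : exists y, [/\ Q y, aff (a i) y = 0 & aff (A i) y != 0].
  have [|||y [Qy ay Ay]] := @generic_point _ _ Q [set y | aff (a i) y = 0] [:: A i] oQ.
  - by move=> x y t /= ax ay; rewrite aff_conv ax ay !mulr0 addr0.
  - by exists xk.
  - by move=> b; rewrite inE => /eqP ->; exact: aA.
  - by exists y; split => //; apply: Ay; rewrite inE.
(* Chosen such that [eta i * z_0 + aff (v i) y = 0]: the ramp is at its midpoint m / 2, where the
   limit integrand is strictly negative. *)
pose z0 : 'rV[R]_n := (y - xk) *m M0^T - (aff (v i) y / eta i) *: delta_mx ord0 ord0.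
have z00 : z0 ord0 ord0 = - (aff (v i) y / eta i).
  rewrite /z0 [LHS]mxE -M0E; have := ay.
  rewrite -{1}(subrK xk y) [y - xk + xk]addrC affDx axk add0r => ->.
  by rewrite !mxE eqxx mulr1 add0r.
have Psiz0 : Psi 0 z0 = y.
  rewrite -[RHS](PsiS y ay) /Psi; congr (_ + _); rewrite !mulmxA; congr (_ *m _).
  apply/rowP => j; rewrite !mulmx_dil; case: eqP => [->|/eqP j0]; first by rewrite !mul0r.
  have dj : ((aff (v i) y / eta i) *: delta_mx ord0 ord0 : 'rV[R]_n) ord0 j = 0.
    by rewrite !mxE eqxx (negbTE j0) mulr0.
  by rewrite !mul1r /z0 [LHS]mxE [X in _ + X]mxE dj subr0.
have hz0 : h z0 < 0.
  rewrite /h /rr Psiz0 z00 mulrN [eta i * _]mulrC divfK ?gt_eqF// addNr ramp0.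
  have -> : aff (A i) y / 2 * (aff (A i) y - aff (A i) y / 2) = (aff (A i) y / 2) ^+ 2 by field.
  have : 0 < (aff (A i) y / 2) ^+ 2.
    by rewrite exprn_even_gt0//= mulf_neq0// invr_eq0.
  have /pQ : Q y by [].
  move: (p y) (_ ^+ 2) => q r q0 r0; nra.
have h_le0 z : h z <= 0.
  rewrite /h !mulNr oppr_le0; apply: mulr_ge0 => //; apply: mulr_ge0 => //.
  exact: ramp_between.
pose U := h @^-1` [set t | t < h z0 / 2].
have oU : open U.
  by apply: open_comp => [z _|]; [exact: ch|exact: open_lt].
have Uz0 : U z0 by rewrite /U /=; lra.
have iNh : lam.-integrable setT (EFin \o (fun z => - h z)).
  by have := integrableN ih.
have mU : measurable U by exact: measurable_rV_open.
have := @Rintegral_ge _ _ _ lam (fun z => - h z) U (- (h z0 / 2)) iNh.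
move=> /(_ _ mU _)/(lt_le_trans _) h0.
have : (0 < (\int[lam]_z - h z)%:E :> \bar R)%E.
  apply: h0.
  - apply: mule_gt0; first by rewrite lte_fin; lra.
    by apply: lebesgue_rV_open => //; exists z0.
  - by move=> z; rewrite oppr_ge0.
  - by move=> z; rewrite /U/= => /ltW; rewrite lerN2.
rewrite lte_fin (_ : \int[lam]_z - h z = - \int[lam]_z h z) ?oppr_gt0//.
rewrite -[RHS]mulN1r -RintegralZl//; apply: eq_Rintegral => z _; by rewrite mulN1r.
Qed.

Theorem ramp_improvement : (exists i, P i) ->
  exists2 e, 0 < e & wint p (fun x => (ramped e 1 x - f x) ^+ 2) +
    wint p (fun x => (ramped e (-1) x - f x) ^+ 2) <
    2 * wint p (fun x => (jumpy x - f x) ^+ 2).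
Proof.
move=> [i0 Pi0].
have : \forall k \near \oo, forall i, P i -> wint p (T (e_ k) 1 i) + wint p (T (e_ k) (-1) i) < 0.
  apply: filter_forall => i; have [Pi|nPi] := boolP (P i); last by apply: nearW.
  by apply: filterS (T_sum_lt0 Pi) => k.
move=> [k _ /(_ k (leqnn k)) hk]; exists (e_ k) => //.
rewrite -subr_lt0.
have -> : forall x y z : R, x + y - 2 * z = (x - z) + (y - z) by move=> *; ring.
rewrite !loss_ramped -big_split/= (bigD1 i0)//=.
rewrite -[ltRHS]addr0 ltr_leD ?hk//.
by apply: sumr_le0 => i /andP[Pi _]; rewrite ltW// hk.
Qed.

End improvement.

(** * Compactness of normalised networks *)

Section ultrafilters.
Context {T : Type} (U : set_system T) {UU : UltraFilter U}.

Lemma ultra_fmap {S : Type} (u : T -> S) : UltraFilter (u @ U).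
Proof.
split=> [|G GG sUG]; first exact: fmap_proper_filter.
apply/seteqP; split => // A GA.
have [//|UA] := in_ultra_setVsetC (u @^-1` A) UU.
have GAC : G (~` A) by apply: sUG.
by have [x []] := @filter_ex _ G GG _ (@filterI _ G _ _ _ GA GAC).
Qed.

Lemma ultra_compact_cvg {S : topologicalType} (K : set S) (u : T -> S) : compact K ->
  (\forall k \near U, K (u k)) -> exists2 l, K l & u @ U --> l.
Proof.
rewrite compact_ultra => cK uK.
by have [l [Kl ul]] := cK _ (ultra_fmap u) uK; exists l.
Qed.

Lemma ultra_bounded_cvg {R : realType} m (u : T -> 'rV[R]_m) M :
  (\forall k \near U, `|u k| <= M) -> exists l : 'rV[R]_m, u @ U --> l.
Proof.
move=> uM.
have cK : compact [set x : 'rV[R]_m | forall i, x ord0 i \in `[- M, M]].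
  by apply: (@rV_compact _ _ (fun=> `[- M, M]%classic)) => _; exact: segment_compact.
have [|l _ ul] := ultra_compact_cvg (u := u) cK; last by exists l.
apply: filterS uM => k uk i; rewrite in_itv/= -ler_norml.
exact: le_trans (rV_coord_le_norm _ _) uk.
Qed.

Lemma ultra_boundedR_cvg {R : realType} (u : T -> R) M :
  (\forall k \near U, `|u k| <= M) -> exists l : R, u @ U --> l.
Proof.
move=> uM; have [|l _ ul] := ultra_compact_cvg (u := u) (@segment_compact R (- M) M).
  by apply: filterS uM => k uk; rewrite /= in_itv/= -ler_norml.
by exists l.
Qed.

(** The dichotomy that replaces passing to subsequences. *)
Lemma ultra_boundedP {R : realType} (u : T -> R) :
  (exists M, \forall k \near U, u k <= M) \/ (forall M, \forall k \near U, M < u k).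
Proof.
have [|nM] := pselect (exists M, \forall k \near U, u k <= M); first by left.
right=> M; have [UM|] := in_ultra_setVsetC [set k | u k <= M] UU.
  by exfalso; apply: nM; exists M.
by apply: filterS => k /= /negP; rewrite -ltNge.
Qed.

End ultrafilters.

Definition netf (R : realType) n h (c0 : R) (c : 'I_h -> R) (a : 'I_h -> 'rV[R]_n.+1)
  (x : 'rV[R]_n) : R := c0 + \sum_i c i * relu (aff (a i) x).

(** * Networks near a point off all limiting hyperplanes *)

Section local_formula.
Variables (R : realType) (n h : nat) (Q : set 'rV[R]_n) (xc : 'rV[R]_n).
Hypothesis Qconv : forall x y t, Q x -> Q y -> 0 <= t <= 1 -> Q (x + t *: (y - x)).
Hypothesis Qxc : Q xc.

Lemma aff_sign (a : 'rV[R]_n.+1) : (forall x, Q x -> aff a x != 0) ->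
  forall x, Q x -> ind (aff a x) = ind (aff a xc).
Proof.
move=> a0 x Qx; rewrite /ind; congr ((nat_of_bool _)%:R).
have key y z : Q y -> Q z -> 0 < aff a y -> 0 < aff a z.
  move=> Qy Qz ay; rewrite ltNge; apply/negP => az.
  have d0 : 0 < aff a y - aff a z by lra.
  pose t := aff a y / (aff a y - aff a z).
  have t01 : 0 <= t <= 1.
    by rewrite /t divr_ge0 ?(ltW ay) ?(ltW d0)//= ler_pdivrMr// mul1r; lra.
  have := a0 _ (Qconv Qy Qz t01); rewrite aff_conv => /eqP; apply.
  rewrite /t; field; exact: lt0r_neq0.
by apply/idP/idP; exact: key.
Qed.

Variable (al : 'I_h -> 'rV[R]_n.+1).
Hypothesis al_neq0 : forall i, al i != 0.

Definition meets i := `[< exists x, Q x /\ aff (al i) x = 0 >].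

(** For forms of norm 1 with nonzero slope, this says that the two hyperplanes coincide. *)
Definition sim i j := (al i == al j) || (al i == - al j).

Lemma sim_refl i : sim i i. Proof. by rewrite /sim eqxx. Qed.

Lemma sim_sym i j : sim i j = sim j i.
Proof. by rewrite /sim eq_sym [X in _ || X]eq_sym eqr_oppLR. Qed.

Lemma sim_trans i j k : sim i j -> sim j k -> sim i k.
Proof.
rewrite /sim => /orP[] /eqP-> /orP[] /eqP->; rewrite ?opprK eqxx ?orbT//.
Qed.

Definition rep i := odflt i [pick j | sim i j].

Lemma sim_rep i : sim i (rep i).
Proof. by rewrite /rep; case: pickP => //= /(_ i); rewrite sim_refl. Qed.

Lemma rep_eq i j : sim i j -> rep i = rep j.
Proof.
move=> ij; rewrite /rep (@eq_pick _ (sim i) (sim j)) => [|k].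
  by case: pickP => //= /(_ j); rewrite sim_refl.
apply/idP/idP; last exact: sim_trans.
by apply: sim_trans; rewrite sim_sym.
Qed.

Lemma repK i : rep (rep i) = rep i.
Proof. by apply/esym/rep_eq/sim_rep. Qed.

Definition flip i := al i != al (rep i).

Lemma al_rep i : al i = if flip i then - al (rep i) else al (rep i).
Proof.
rewrite /flip; case: ifPn => [/negbTE alN|/negPn/eqP//].
by have := sim_rep i; rewrite /sim alN => /eqP.
Qed.

Context {T : Type} (F : set_system T) {FF : Filter F}.
Variables (c0 : T -> R) (c : 'I_h -> T -> R) (alpha : 'I_h -> T -> 'rV[R]_n.+1).
Hypothesis alpha_cvg : forall i, alpha i @ F --> al i.

(* [relu (- z) = relu z - z] lets all neurons of a class share the limit [al (rep i)], at the
   expense of an affine function that is collected in [Bcoef]. *)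
Definition ahat i k := if flip i then - alpha i k else alpha i k.

Lemma ahat_cvg i : ahat i @ F --> al (rep i).
Proof.
have := alpha_cvg (i := i); rewrite al_rep /ahat; case: (flip i) => // ca.
by rewrite -[X in _ --> X]opprK; exact: cvgN.
Qed.

(** The affine function by which the network changes across the hyperplane of class j. It can stay
    bounded while the single outer weights blow up. *)
Definition Acoef j k := \sum_(i | rep i == j) c i k *: ahat i k.

Definition cst1 : 'rV[R]_n.+1 := delta_mx ord0 ord0.

Lemma aff_cst1 x : aff cst1 x = 1.
Proof.
by rewrite affE big1 => [|j _]; rewrite !mxE ?eqxx/= ?addr0// mul0r.
Qed.

(** The part without a break inside [Q]: the corrections for reflected neurons, and the classes
    whose hyperplane misses [Q]. The latter have a constant sign on [Q], read off at [xc]. *)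
Definition Bcoef k := c0 k *: cst1 - \sum_(i | flip i) c i k *: ahat i k
  + \sum_(j | (rep j == j) && ~~ meets j) ind (aff (al j) xc) *: Acoef j k.

Definition act j := (rep j == j) && meets j.

Definition cell x k := Bcoef k + \sum_(j | act j) ind (aff (al j) x) *: Acoef j k.

(** Off the limiting hyperplanes every neuron has a settled sign, near [x0] and for all k in one set
    of the filter; so the network is one affine function there. That [V] does not depend on k is
    essential for the bounds below. *)
Lemma local_formula x0 : Q x0 -> (forall j, rep j = j -> aff (al j) x0 != 0) ->
  exists V W, [/\ nbhs x0 V, F W & forall x k, V x -> W k ->
    netf (c0 k) (c ^~ k) (alpha ^~ k) x = aff (cell x0 k) x].
Proof.
move=> Qx0 ax0.
have near_sign i : filter_prod (nbhs x0) F [set q |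
    ind (aff (ahat i q.2) q.1) = ind (aff (al (rep i)) x0)].
  have ca : (fun q : 'rV[R]_n * T => aff (ahat i q.2) q.1) @ (filter_prod (nbhs x0) F)
      --> aff (al (rep i)) x0.
    apply: cvg_aff; last exact: cvg_fst.
    by apply: cvg_comp (ahat_cvg (i := i)); exact: cvg_snd.
  have a0 : aff (al (rep i)) x0 != 0 by apply: ax0; exact: repK.
  rewrite /ind; have [ap|an|/eqP] := ltgtP 0 (aff (al (rep i)) x0); last first.
  - by rewrite eq_sym (negbTE a0).
  - by move/cvgr_lt : ca => /(_ _ an); apply: filterS => q /= qlt; rewrite ltNge ltW.
  - by move/cvgr_gt : ca => /(_ _ ap); apply: filterS => q /= ->.
have [[V W] [/= nV FW] VW] := filter_forall _ near_sign.
exists V, W; split => // x k Vx Wk.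
have sgn i : ind (aff (ahat i k) x) = ind (aff (al (rep i)) x0) by exact: (VW (x, k)).
have reluI z : relu z = ind z * z.
  rewrite /relu /ind; by have [z0|z0] := leP z 0; rewrite ?mul0r ?mul1r.
have termE i : c i k * relu (aff (alpha i k) x) =
    ind (aff (al (rep i)) x0) * aff (c i k *: ahat i k) x -
    (if flip i then aff (c i k *: ahat i k) x else 0).
  rewrite affZ -(sgn i) [ind _ * _]mulrCA -reluI /ahat; case: (flip i); last by rewrite subr0.
  by rewrite affN reluN; ring.
rewrite /netf (eq_bigr _ (fun i _ => termE i)) sumrB -big_mkcond.
rewrite /cell /Bcoef !affD affN affZ aff_cst1 mulr1 !aff_sum.
rewrite (partition_big rep (fun j => rep j == j)) => [|i _]; last by rewrite repK.
have grp j : rep j == j -> \sum_(i | rep i == j) ind (aff (al (rep i)) x0) * aff (c i k *: ahat i k) x =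
    ind (aff (al j) x0) * aff (Acoef j k) x.
  by move=> _; rewrite /Acoef aff_sum mulr_sumr; apply: eq_bigr => i /eqP ->.
rewrite (eq_bigr _ grp) (bigID meets)/=.
under [X in _ = _ + X]eq_bigr do rewrite affZ.
under [X in _ = _ + X + _]eq_bigr do rewrite affZ.
have -> : \sum_(i | (rep i == i) && ~~ meets i) ind (aff (al i) x0) * aff (Acoef i k) x =
  \sum_(i | (rep i == i) && ~~ meets i) ind (aff (al i) xc) * aff (Acoef i k) x.
  apply: eq_bigr => i /andP[_ nm]; rewrite (aff_sign _ Qx0)// => y Qy.
  by apply: contraNneq nm => ay; apply/asboolP; exists y.
rewrite /act; ring.
Qed.

End local_formula.

(** * Bounded loss bounds the coefficients of the affine pieces *)

Section compactness.
Variables (R : realType) (n h : nat).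
Local Notation lam := (@lebesgue_rV R n).
Variables (Q : set 'rV[R]_n) (p : 'rV[R]_n -> R) (xc : 'rV[R]_n).
Hypothesis oQ : open Q.
Hypothesis bQ : exists B, forall x, Q x -> forall i, `|x ord0 i| <= B.
Hypothesis Qconv : forall x y t, Q x -> Q y -> 0 <= t <= 1 -> Q (x + t *: (y - x)).
Hypothesis Qxc : Q xc.
Hypothesis cp : continuous p.
Hypothesis p0 : forall x, 0 <= p x.
Hypothesis pQ : forall x, 0 < p x <-> Q x.
Variable f : 'rV[R]_n -> R.
Hypothesis bf : bm Q f.

Lemma aff_neq0_point (b : 'rV[R]_n.+1) : b != 0 -> exists y, aff b y != 0.
Proof.
move=> b0; apply: contrapT => nb.
have bz y : aff b y = 0 by apply: contrapT => /eqP bby; apply: nb; exists y.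
move/eqP : b0; apply; apply: aff_eq0.
  apply/rowP => j; have := bz (0 + delta_mx ord0 j).
  rewrite affDx bz add0r (bigD1 j)//= big1 => [|i ij].
    by rewrite addr0 [X in _ * X]mxE !eqxx mulr1 => ->; rewrite mxE.
  by rewrite [X in _ * X]mxE (negbTE ij) mulr0.
by have := bz 0; rewrite affE big1 ?addr0// => j _; rewrite [X in _ * X]mxE mulr0.
Qed.

Lemma bm_netf c0 (c : 'I_h -> R) a : bm Q (netf c0 c a).
Proof.
apply: bmD; first exact: bm_cst.
apply: bm_sum => i _; apply: bmM; first exact: bm_cst.
apply: bm_continuous => // x.
exact: (cvg_relu (nbhs_filter x) (@continuous_aff R n (a i) x)).
Qed.

Context (U : set_system nat) {UU : UltraFilter U}.
Variables (c0 : nat -> R) (c : 'I_h -> nat -> R) (alpha : 'I_h -> nat -> 'rV[R]_n.+1).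
Variable M : R.
Local Notation N k := (netf (c0 k) (c ^~ k) (alpha ^~ k)).
Hypothesis loss_le : forall k, wint p (fun x => (N k x - f x) ^+ 2) <= M.

(** If the coefficients were unbounded, their normalised limit would be a nonzero affine function,
    hence bounded away from 0 on some open subset of [V]; there the networks, and so their losses,
    would become arbitrarily large. *)
Lemma local_affine_bounded x0 V (b : nat -> 'rV[R]_n.+1) : Q x0 -> nbhs x0 V ->
  (\forall k \near U, forall x, V x -> N k x = aff (b k) x) ->
  exists M', \forall k \near U, `|b k| <= M'.
Proof.
move=> Qx0 nV NV.
have [//|big] := ultra_boundedP (U := U) (fun k => `|b k|); exfalso.
pose d k := `|b k|^-1 *: b k.
have d1 k : `|d k| <= 1.
  rewrite normrZ normfV normr_id; have [->|b0] := eqVneq `|b k| 0; first by rewrite mulr0.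
  by rewrite mulVf.
have [|dl cd] := ultra_bounded_cvg (U := U) (u := d) (M := 1); first exact: nearW.
have dl1 : `|dl| = 1.
  have c1 : `|d k| @[k --> U] --> (1 : R).
    apply: cvg_near_cst; apply: filterS (big 0) => k bk.
    by rewrite normrZ normfV normr_id mulVf// gt_eqF.
  exact: (cvg_unique _ (cvg_norm cd) c1).
have dl0 : dl != 0 by rewrite -normr_eq0 dl1 oner_eq0.
have [G [oG Ox0] OV] : exists2 G, open_nbhs x0 G & G `<=` V `&` Q.
  have := @filterI _ _ (nbhs_filter x0) _ _ nV (open_nbhs_nbhs (conj oQ Qx0)).
  by rewrite nbhsE => -[G ? ?]; exists G.
have [|||y [Oy _ dy]] := @generic_point _ _ G setT [:: dl] oG => //.
- by exists x0.
- by move=> b' /[!inE] /eqP ->; have [y] := aff_neq0_point dl0; exists y.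
have dly : aff dl y != 0 by apply: dy; rewrite inE.
pose delta := `|aff dl y| / 2.
have delta0 : 0 < delta by rewrite divr_gt0// normr_gt0.
have [[V1 W1] [/= nV1 UW1] VW1] : filter_prod (nbhs y) U [set q | delta < `|aff (d q.2) q.1|].
  have ca : (fun q : 'rV[R]_n * nat => `|aff (d q.2) q.1|) @ (filter_prod (nbhs y) U)
      --> `|aff dl y|.
    apply: cvg_norm; apply: cvg_aff; last exact: cvg_fst.
    by apply: cvg_comp cd; exact: cvg_snd.
  by move/cvgr_gt : ca; apply; rewrite /delta ltr_pdivrMr// ltr_pMr ?ltr1n// normr_gt0.
have [G' [oG' G'y] G'V] : exists2 G', open_nbhs y G' & G' `<=` V1 `&` G.
  have := @filterI _ _ (nbhs_filter y) _ _ nV1 (open_nbhs_nbhs (conj oG Oy)).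
  by rewrite nbhsE => -[G' ? ?]; exists G'.
have bI : bm Q (\1_G').
  split; first by apply: measurable_indic; exact: measurable_rV_open.
  by exists 1 => x _; rewrite indicE; case: (_ \in _); rewrite ?normr1 ?normr0.
have m0 : 0 < wint p (\1_G').
  apply: (wint_gt0_open oQ bQ cp p0 pQ bI _ oG').
  - by move=> x _; rewrite indicE.
  - by exists y.
  - by move=> x /G'V[_ /OV[]].
  - by exists 1 => // x G'x; rewrite indicE mem_set.
set m := wint p _ in m0.
have [_ [Mf hf]] := bf.
(* As K >= 1, K^2 m >= K m > M. So it suffices to get |N k - f| >= K on [G'], which follows once |b
   k| exceeds (K + Mf) / delta. *)
pose K := `|M| / m + 1.
have K1 : 1 <= K by rewrite lerDr divr_ge0// ltW.
have [k [W1k [Nk bk]]] := @filter_ex _ U _ _ (filterI UW1 (filterI NV (big ((K + Mf) / delta)))).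
have := loss_le k; apply/negP; rewrite -ltNge.
apply: (@lt_le_trans _ _ (wint p (fun x => K ^+ 2 * \1_G' x))).
  rewrite (wintZ oQ bQ cp p0 pQ)// -/m.
  apply: (@lt_le_trans _ _ (K * m)).
    rewrite /K mulrDl divfK ?gt_eqF// mul1r (le_lt_trans (ler_norm M))//.
    by rewrite ltrDl.
  by rewrite ler_pM2r// expr2 ler_peMl// (le_trans ler01).
apply: (wint_le oQ bQ cp p0 pQ); first exact: bmZ.
  by apply: bmX; apply: bmB => //; exact: bm_netf.
move=> x Qx; rewrite indicE; have [xG'|xG'] := boolP (x \in G'); last first.
  by rewrite mulr0 sqr_ge0.
rewrite inE in xG'; rewrite mulr1 -[leRHS]real_normK ?num_real//.
have [V1x Ox] := G'V _ xG'; have [Vx _] := OV _ Ox.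
rewrite lerXn2r ?nnegrE ?normr_ge0//; first by rewrite (le_trans ler01).
have bk0 : 0 < `|b k|.
  have Mf0 : 0 <= Mf by exact: le_trans (normr_ge0 _) (hf _ Qx).
  have K0 : 0 <= K by exact: le_trans ler01 K1.
  by apply: le_lt_trans bk; apply: divr_ge0; [exact: addr_ge0|exact: ltW].
have NE : `|N k x| = `|b k| * `|aff (d k) x|.
  by rewrite Nk// /d affZ [in RHS]normrM normfV normr_id mulrA mulfV ?mul1r// gt_eqF.
have : K + Mf <= `|N k x|.
  rewrite NE; move: bk; rewrite ltr_pdivrMr// => /ltW/le_trans; apply.
  by rewrite ler_pM2l// ltW//; exact: (VW1 (x, k)).
have := hf _ Qx; have := ler_distD (f x) (N k x) 0; rewrite !subr0 => h1 h2 h3.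
lra.
Qed.

Variable al : 'I_h -> 'rV[R]_n.+1.
Hypothesis alpha_cvg : forall i, alpha i @ U --> al i.
Hypothesis al1 : forall i, `|al i| = 1.

Let al0 i : al i != 0. Proof. by rewrite -normr_eq0 al1 oner_eq0. Qed.

Definition generic x := Q x /\ forall j, rep al j = j -> aff (al j) x != 0.

Lemma cell_bounded x : generic x ->
  exists M', \forall k \near U, `|cell Q xc al c0 c alpha x k| <= M'.
Proof.
move=> [Qx gx]; have [V [W [nV UW VW]]] := local_formula Qconv Qxc c0 c alpha_cvg Qx gx.
apply: (local_affine_bounded Qx nV); apply: filterS UW => k Wk y Vy; exact: VW.
Qed.

Lemma meets_lin j : meets Q al j -> lin (al j) != 0.
Proof.
move=> /asboolP[x [_ ax]]; apply: contra_neq (al0 j) => l0.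
by apply: aff_eq0 => //; rewrite -(aff_lin0 x l0).
Qed.

Lemma rep_hyperplane_neq j l : meets Q al j -> rep al j = j -> rep al l = l -> l != j ->
  exists2 y, aff (al j) y = 0 & aff (al l) y != 0.
Proof.
move=> mj rj rl lj; apply: contrapT => nex.
have [|mu lE] := @vanish_proportional _ _ (al j) (al l) (meets_lin mj).
  by move=> x ax; apply: contrapT => /eqP alx; apply: nex; exists x.
have : `|mu| = 1 by rewrite -[LHS]mulr1 -(al1 j) -normrZ -lE al1.
move=> /eqP; rewrite eqr_norml ler01 andbT => /orP[]/eqP muE.
  by move: lj; rewrite -rl -rj (@rep_eq _ _ _ _ l j) ?eqxx// /sim lE muE scale1r eqxx.
by move: lj; rewrite -rl -rj (@rep_eq _ _ _ _ l j) ?eqxx// /sim lE muE scaleN1r eqxx orbT.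
Qed.

Lemma exists_generic : exists x, generic x.
Proof.
have [|||x [Qx _ ax]] := @generic_point _ _ Q setT [seq al j | j <- enum 'I_h] oQ => //.
- by exists xc.
- by move=> b /mapP[j _ ->]; have [y] := aff_neq0_point (al0 j); exists y.
by exists x; split => // j _; apply: ax; apply: map_f; rewrite mem_enum.
Qed.

(** [Acoef] of class j is the difference of the affine pieces on the two sides of its hyperplane.
    Both are bounded by [cell_bounded], at two generic points on either side of a point of this
    hyperplane that lies on no other, so that no other indicator changes. *)
Lemma Acoef_bounded j : act Q al j ->
  exists M', \forall k \near U, `|Acoef al c alpha j k| <= M'.
Proof.
move=> /andP[/eqP rj mj].
have [xj [Qxj axj]] := asboolP _ mj.
have [|||x [Qx ax alx]] := @generic_point _ _ Q [set y | aff (al j) y = 0]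
    [seq al l | l <- [seq l <- enum 'I_h | (rep al l == l) && (l != j)]] oQ.
- by move=> x y t /= ax ay; rewrite aff_conv ax ay !mulr0 addr0.
- by exists xj.
- move=> b /mapP[l]; rewrite mem_filter => /andP[/andP[/eqP rl lj] _] ->.
  exact: rep_hyperplane_neq.
have [i ai] := rV_neq0P (meets_lin mj).
pose z : 'rV[R]_n := (lin (al j) ord0 i)^-1 *: delta_mx ord0 i.
have zE l : z ord0 l = (lin (al j) ord0 i)^-1 * (l == i)%:R.
  by rewrite /z [LHS]mxE [X in _ * X]mxE eqxx.
have az y t : aff (al j) (y + t *: z) = aff (al j) y + t.
  rewrite affDx (bigD1 i)//= big1 => [|l li].
    by rewrite addr0 [X in _ * X]mxE zE eqxx mulr1 mulrCA mulfV ?mulr1.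
  by rewrite [X in _ * X]mxE zE (negbTE li) !mulr0.
have ct : (fun t : R => x + t *: z) @ (0 : R) --> x.
  have cs : (fun t : R => x + t *: (x + z - x)) @ (0 : R) --> x + (0 : R) *: (x + z - x).
    exact: continuous_segment.
  by rewrite scale0r addr0 [x + z]addrC addrK in cs.
have near_t : \forall t \near (0 : R), Q (x + t *: z) /\
    forall l, rep al l = l -> l != j -> ind (aff (al l) (x + t *: z)) = ind (aff (al l) x) /\
      aff (al l) (x + t *: z) != 0.
  apply: filterI; first exact: ct _ (open_nbhs_nbhs (conj oQ Qx)).
  apply: (@filter_forall _ _ _ (nbhs (0 : R))) => l.
  have [rl|nrl] := eqVneq (rep al l) l; last by apply: nearW => t rl; rewrite rl eqxx in nrl.
  have [lj|lj] := eqVneq l j; first by apply: nearW.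
  have al_x : aff (al l) x != 0.
    by apply: alx; apply: map_f; rewrite mem_filter rl eqxx lj mem_enum.
  have cl : aff (al l) (x + t *: z) @[t --> (0 : R)] --> aff (al l) x.
    exact: (cvg_comp _ _ ct (@continuous_aff R n (al l) x)).
  have cne : \forall t \near (0 : R), aff (al l) (x + t *: z) != 0.
    by move/cvgr_neq0 : (cl); apply.
  have [ap|an|/eqP] := ltgtP 0 (aff (al l) x); last by rewrite eq_sym (negbTE al_x).
    move/cvgr_gt : cl => /(_ _ ap) cgt; apply: filterS2 cgt cne => t tp t0 _ _; split => //.
    by rewrite /ind tp ap.
  move/cvgr_lt : cl => /(_ _ an) clt; apply: filterS2 clt cne => t tn t0 _ _; split => //.
  by rewrite /ind !ltNge !ltW.
move: near_t => /nbhs_ballP[e /= e0 he].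
have e2 : 0 < e / 2 by rewrite divr_gt0.
have [|Qp sp] := he (e / 2).
  by rewrite /ball/= sub0r normrN gtr0_norm// ltr_pdivrMr// ltr_pMr// ltr1n.
have [|Qm sm] := he (- (e / 2)).
  by rewrite /ball/= sub0r opprK gtr0_norm// ltr_pdivrMr// ltr_pMr// ltr1n.
have gp : generic (x + (e / 2) *: z).
  split => // l rl; have [->|lj] := eqVneq l j; last by have [] := sp l rl lj.
  by rewrite az ax add0r gt_eqF.
have gm : generic (x + - (e / 2) *: z).
  split => // l rl; have [->|lj] := eqVneq l j; last by have [] := sm l rl lj.
  by rewrite az ax add0r lt_eqF// oppr_lt0.
have [Mp hp] := cell_bounded gp; have [Mm hm] := cell_bounded gm.
exists (Mp + Mm); apply: filterS2 hp hm => k hp hm.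
suff -> : Acoef al c alpha j k = cell Q xc al c0 c alpha (x + (e / 2) *: z) k -
    cell Q xc al c0 c alpha (x + - (e / 2) *: z) k.
  by rewrite (le_trans (ler_normB _ _))// lerD.
have actj : act Q al j by rewrite /act rj eqxx.
rewrite /cell opprD addrACA subrr add0r (bigD1 j)//= [X in _ - X](bigD1 j)//=.
have i1 : ind (e / 2) = 1 by rewrite /ind e2.
have i2 : ind (- (e / 2)) = 0 by rewrite /ind oppr_gt0 ltNge (ltW e2).
rewrite !az ax !add0r i1 i2 scale1r scale0r add0r.
rewrite -addrA -[LHS]addr0; congr (_ + _); apply/esym/eqP; rewrite subr_eq0; apply/eqP.
apply: eq_bigr => l /andP[/andP[/eqP rl _] lj].
by have [-> _] := sp l rl lj; have [-> _] := sm l rl lj.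
Qed.

Lemma Bcoef_bounded : exists M', \forall k \near U, `|Bcoef Q xc al c0 c alpha k| <= M'.
Proof.
have [x gx] := exists_generic; have [Mx hx] := cell_bounded gx.
have /choice[MA hA] : forall j, exists M', act Q al j -> \forall k \near U, `|Acoef al c alpha j k| <= M'.
  move=> j; have [aj|_] := boolP (act Q al j); last by exists 0.
  by have [M' hM'] := Acoef_bounded aj; exists M'.
exists (Mx + \sum_(j | act Q al j) MA j).
have : \forall k \near U, forall j, act Q al j -> `|Acoef al c alpha j k| <= MA j.
  apply: filter_forall => j; have [aj|_] := boolP (act Q al j); last by apply: nearW.
  by apply: filterS (hA j aj) => k.
apply: filterS2 hx => k hx hk.
have -> : Bcoef Q xc al c0 c alpha k = cell Q xc al c0 c alpha x k -
   \sum_(j | act Q al j) ind (aff (al j) x) *: Acoef al c alpha j k.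
  by rewrite /cell addrK.
rewrite (le_trans (ler_normB _ _))// lerD// (le_trans (ler_norm_sum _ _ _))//.
apply: ler_sum => j aj; rewrite normrZ (le_trans _ (hk j aj))// ler_piMl//.
exact: ind_norm.
Qed.

End compactness.

(** * Functions realised on [Q] by at most h neurons *)

Section networks.
Variables (R : realType) (n : nat) (Q : set 'rV[R]_n).
Hypothesis bQ : exists B, forall x, Q x -> forall i, `|x ord0 i| <= B.
Implicit Types (phi psi : 'rV[R]_n -> R).

(** Lists of neurons make sums of networks concatenations, and the inequality makes widening free.
    Only the values on [Q] matter for the loss. *)
Definition netQ h phi := exists c0 (s : seq (R * 'rV[R]_n.+1)), (size s <= h)%N /\
  forall x, Q x -> phi x = c0 + \sum_(q <- s) q.1 * relu (aff q.2 x).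

Lemma netQ_eq h phi psi : (forall x, Q x -> phi x = psi x) -> netQ h phi -> netQ h psi.
Proof. by move=> e [c0 [s [sh sE]]]; exists c0, s; split => // x Qx; rewrite -e// sE. Qed.

Lemma netQ_weaken h h' phi : (h <= h')%N -> netQ h phi -> netQ h' phi.
Proof. by move=> hh' [c0 [s [sh sE]]]; exists c0, s; split => //; exact: leq_trans hh'. Qed.

Lemma netQ_cst c : netQ 0 (fun=> c).
Proof. by exists c, [::]; split => // x _; rewrite big_nil addr0. Qed.

Lemma netQD h h' phi psi : netQ h phi -> netQ h' psi ->
  netQ (h + h') (fun x => phi x + psi x).
Proof.
move=> [c [s [sh sE]]] [c' [s' [sh' sE']]]; exists (c + c'), (s ++ s'); split.
  by rewrite size_cat leq_add.
by move=> x Qx; rewrite sE// sE'// big_cat /= addrACA.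
Qed.

Lemma netQ_sum (I : Type) (r : seq I) (P : pred I) (m : I -> nat) (phi : I -> 'rV[R]_n -> R) :
  (forall i, P i -> netQ (m i) (phi i)) ->
  netQ (\sum_(i <- r | P i) m i) (fun x => \sum_(i <- r | P i) phi i x).
Proof.
move=> hphi; elim: r => [|i r ih].
  by rewrite big_nil; apply: netQ_eq (netQ_cst 0) => x _; rewrite big_nil.
rewrite big_cons; have [Pi|Pi] := boolP (P i); last first.
  by apply: netQ_eq ih => x _; rewrite big_cons (negbTE Pi).
by apply: netQ_eq (netQD (hphi i Pi) ih) => x _; rewrite big_cons Pi.
Qed.

Lemma netQ_neuron c a : netQ 1 (fun x => c * relu (aff a x)).
Proof. by exists 0, [:: (c, a)]; split => // x _; rewrite big_seq1 add0r. Qed.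

(* An affine function is a single neuron that is active on all of [Q]. *)
Lemma netQ_aff b : netQ 1 (aff b).
Proof.
have [K hK] := continuous_bounded_on_bounded bQ (@continuous_aff R n b).
have := netQD (netQ_cst (- K)) (netQ_neuron 1 (b + K *: cst1 R n)).
apply: netQ_eq => x Qx; rewrite affD affZ aff_cst1 mulr1 mul1r relu_gt0; first by ring.
by have := hK x Qx; rewrite ler_norml => /andP[]; lra.
Qed.

Lemma netQ_neuron2 c a c' a' : netQ 2 (fun x => c * relu (aff a x) + c' * relu (aff a' x)).
Proof. exact: (netQD (netQ_neuron c a) (netQ_neuron c' a')). Qed.

Lemma netQ_ramp (l m : 'rV[R]_n.+1) : netQ 2 (fun x => ramp (aff l x) (aff m x)).
Proof.
apply: netQ_eq (netQ_neuron2 1 (l + 2^-1 *: m) (-1) (l - 2^-1 *: m)) => x _.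
by rewrite /ramp affB affD affZ [2^-1 * _]mulrC mul1r mulN1r.
Qed.

(* Replacing one of the two neurons of a ramp by its reflection [relu (- z) = relu z - z]
   changes the ramp by an affine function whose slope has either sign. *)
Lemma netQ_ramp_flip (l m : 'rV[R]_n.+1) (t : R) : t = 1 \/ t = -1 ->
  netQ 2 (fun x => ramp (aff l x) (aff m x) - (t * aff l x + aff m x / 2)).
Proof.
move=> [->|->].
  apply: netQ_eq (netQ_neuron2 1 (- (l + 2^-1 *: m)) (-1) (l - 2^-1 *: m)) => x _.
  by rewrite /ramp affN affB affD affZ [2^-1 * _]mulrC reluN; field.
apply: netQ_eq (netQ_neuron2 1 (l + 2^-1 *: m) (-1) (- (l - 2^-1 *: m))) => x _.
by rewrite /ramp affN affB affD affZ [2^-1 * _]mulrC reluN; field.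
Qed.

Lemma netQ_netf h c0 (c : 'I_h -> R) a : netQ h (netf c0 c a).
Proof.
exists c0, [seq (c i, a i) | i <- enum 'I_h]; split.
  by rewrite size_map size_enum_ord.
by move=> x _; rewrite /netf big_map big_enum.
Qed.

Lemma netfP h phi : netQ h phi -> exists c0 (c : 'I_h -> R) a,
  forall x, Q x -> phi x = netf c0 c a x.
Proof.
move=> [c0 [s [sh sE]]]; exists c0, (fun i => (nth (0, 0) s i).1), (fun i => (nth (0, 0) s i).2).
move=> x Qx; rewrite sE// /netf; congr (_ + _).
rewrite (big_nth (0, 0)) big_mkord (big_ord_widen _ (fun i => (nth (0, 0) s i).1 * relu (aff (nth (0, 0) s i).2 x)) sh).
rewrite big_mkcond; apply: eq_bigr => i _; case: ltnP => // si.
by rewrite nth_default//= mul0r.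
Qed.

Lemma relu_homo (t z : R) : 0 <= t -> relu (t * z) = t * relu z.
Proof. by move=> t0; rewrite !reluE normrM ger0_norm//; ring. Qed.

(** Positive homogeneity of [relu] moves the norm into the outer weight; a neuron with zero inner
    parameters becomes [cst1] with outer weight 0. *)
Lemma netf_normalized h phi : netQ h phi -> exists c0 (c : 'I_h -> R) a,
  (forall i, `|a i| = 1) /\ forall x, Q x -> phi x = netf c0 c a x.
Proof.
move=> /netfP[c0 [c [a aE]]].
have cst1_neq0 : cst1 R n != 0 :> 'rV[R]_n.+1.
  by apply/eqP => /rowP/(_ ord0)/eqP; rewrite !mxE eqxx oner_eq0.
pose b i := if a i == 0 then cst1 R n else a i.
have b0 i : `|b i| != 0 by rewrite normr_eq0 /b; case: ifPn.
exists c0, (fun i => if a i == 0 then 0 else c i * `|b i|), (fun i => `|b i|^-1 *: b i); split.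
  by move=> i; rewrite normrZ normfV normr_id mulVf.
move=> x Qx; rewrite aE// /netf; congr (_ + _); apply: eq_bigr => i _.
rewrite affZ relu_homo ?invr_ge0// /b; have := b0 i; rewrite /b.
have [->|_] := eqVneq (a i) 0 => bi; first by rewrite aff0 relu_le0// mulr0 mul0r.
by rewrite -mulrA mulVKf.
Qed.

End networks.

(** * Existence of minimizers *)

Section existence.
Variables (R : realType) (d' : nat).
Local Notation n := d'.+1.
Local Notation lam := (@lebesgue_rV R n).
Variables (Q : set 'rV[R]_n) (p : 'rV[R]_n -> R) (xc : 'rV[R]_n).
Hypothesis oQ : open Q.
Hypothesis bQ : exists B, forall x, Q x -> forall i, `|x ord0 i| <= B.
Hypothesis Qconv : forall x y t, Q x -> Q y -> 0 <= t <= 1 -> Q (x + t *: (y - x)).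
Hypothesis Qxc : Q xc.
Hypothesis cp : continuous p.
Hypothesis p0 : forall x, 0 <= p x.
Hypothesis pQ : forall x, 0 < p x <-> Q x.
Variable f : 'rV[R]_n -> R.
Hypothesis bf : bm Q f.
Hypothesis cf : forall x, Q x -> {for x, continuous f}.

Definition loss phi := wint p (fun x => (phi x - f x) ^+ 2).

Lemma loss_ge0 phi : 0 <= loss phi.
Proof. by apply: (wint_ge0 p0 pQ) => x _; exact: sqr_ge0. Qed.

Lemma eq_loss phi psi : (forall x, Q x -> phi x = psi x) -> loss phi = loss psi.
Proof. by move=> e; apply: (eq_wint p0 pQ) => x Qx; rewrite e. Qed.

(** * The limit of a minimizing sequence and its neuron count *)

Section limit.
Variable h : nat.
Context (U : set_system nat) {UU : UltraFilter U}.
Variables (c0 : nat -> R) (c : 'I_h -> nat -> R) (alpha : 'I_h -> nat -> 'rV[R]_n.+1).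
Local Notation N k := (netf (c0 k) (c ^~ k) (alpha ^~ k)).
Variable m : R.
Hypothesis U_loss : forall e, 0 < e -> \forall k \near U, loss (N k) <= m + e.
Variable al : 'I_h -> 'rV[R]_n.+1.
Hypothesis alpha_cvg : forall i, alpha i @ U --> al i.
Hypothesis al1 : forall i, `|al i| = 1.
Local Notation actQ := (act Q al).
Local Notation A := (Acoef al c alpha).
Local Notation B := (Bcoef Q xc al c0 c alpha).
Local Notation rp := (rep al).
Local Notation flp := (flip al).
Variables (Al : 'I_h -> 'rV[R]_n.+1) (Bl : 'rV[R]_n.+1).
Hypothesis A_cvg : forall j, actQ j -> A j @ U --> Al j.
Hypothesis B_cvg : B @ U --> Bl.

Definition limit_fun x := aff Bl x + \sum_(j | actQ j) ind (aff (al j) x) * aff (Al j) x.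

Let al0 i : al i != 0. Proof. by rewrite -normr_eq0 al1 oner_eq0. Qed.

Lemma bm_limit_fun : bm Q limit_fun.
Proof.
apply: bmD; first by apply: bm_continuous => //; exact: continuous_aff.
by apply: bm_sum => j _; exact: (@bm_step _ d' _ bQ _ al Al j).
Qed.

Lemma near_dist {S : normedModType R} (u : nat -> S) l (k : nat) : u @ U --> l ->
  U [set q | `|l - u q| < k.+1%:R^-1].
Proof. by move/cvgrPdist_lt => /(_ k.+1%:R^-1); apply; rewrite invr_gt0. Qed.

Lemma cvg_of_dist {S : normedModType R} (u : nat -> S) l :
  (forall k, `|l - u k| < k.+1%:R^-1) -> u @ \oo --> l.
Proof.
move=> ul; apply/cvgrPdist_lt => e e0.
have : \forall k \near \oo, (k.+1%:R^-1 : R) < e.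
  have := @cvg_harmonic R; move/cvgr_lt => /(_ e e0); exact.
by apply: filterS => k; exact: lt_trans (ul k).
Qed.

Lemma limit_loss : loss limit_fun <= m.
Proof.
(* Fatou needs a sequence: the finitely many conditions hold on sets of [U], so one index meets them
   all with error 1 / (k + 1). *)
have sel k : exists q, [/\ forall i, `|al i - alpha i q| < k.+1%:R^-1,
    forall j, actQ j -> `|Al j - A j q| < k.+1%:R^-1,
    `|Bl - B q| < k.+1%:R^-1 & loss (N q) <= m + k.+1%:R^-1].
  have h1 : \forall q \near U, forall i, `|al i - alpha i q| < k.+1%:R^-1.
    by apply: filter_forall => i; exact: near_dist.
  have h2 : \forall q \near U, forall j, actQ j -> `|Al j - A j q| < k.+1%:R^-1.
    apply: filter_forall => j; have [aj|_] := boolP (actQ j); last exact: nearW.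
    by apply: filterS (near_dist k (A_cvg aj)) => q.
  have h3 := near_dist k B_cvg.
  have h4 : \forall q \near U, loss (N q) <= m + k.+1%:R^-1.
    by apply: U_loss; rewrite invr_gt0.
  have [q [[q1 q2] [q3 q4]]] := @filter_ex _ U _ _ (filterI (filterI h1 h2) (filterI h3 h4)).
  by exists q.
have [kap hkap] := choice sel.
have ca i : (alpha i \o kap) @ \oo --> al i.
  by apply: cvg_of_dist => k; have [] := hkap k.
have cA j : actQ j -> (A j \o kap) @ \oo --> Al j.
  by move=> aj; apply: cvg_of_dist => k; have [_ + _ _] := hkap k; exact.
have cB : (B \o kap) @ \oo --> Bl.
  by apply: cvg_of_dist => k; have [] := hkap k.
pose Z := \bigcup_(j in [set j | actQ j]) [set x : 'rV[R]_n | aff (al j) x = 0].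
have mH b : measurable [set x : 'rV[R]_n | aff b x = 0].
  rewrite -[X in measurable X]/(aff b @^-1` [set 0]).
  exact: measurable_preimage (measurable_aff b) (measurable_set1 _).
have mZ : measurable Z.
  by apply: fin_bigcup_measurable; [exact: finite_finset|].
have Z0 : lam Z = 0%E.
  apply: measure_negligible => //; apply: negligible_fin_bigcup => j _.
  by apply/negligibleP => //; exact: lebesgue_rV_hyperplane.
apply: (wint_fatou (phi_ := fun k x => (N (kap k) x - f x) ^+ 2) oQ bQ cp p0 pQ _ _ _ _ mZ Z0).
- by move=> k; apply: bmX; apply: bmB => //; exact: bm_netf.
- by apply: bmX; apply: bmB => //; exact: bm_limit_fun.
- by move=> *; exact: sqr_ge0.
- by move=> *; exact: sqr_ge0.
- move=> x Qx nZ.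
  have gx j : rp j = j -> aff (al j) x != 0.
    move=> rj; apply/eqP => ax; apply: nZ; exists j => //=.
    by rewrite /act rj eqxx; apply/asboolP; exists x.
  have [V [W [nV W_oo VW]]] := local_formula Qconv Qxc (c0 \o kap) (fun i => c i \o kap) ca Qx gx.
  have Vx : V x by exact: nbhs_singleton.
  suff cN : N (kap k) x @[k --> \oo] --> limit_fun x.
    have cd : N (kap k) x - f x @[k --> \oo] --> limit_fun x - f x.
      by apply: cvgB => //; exact: cvg_cst.
    rewrite expr2; under eq_fun do rewrite expr2; exact: cvgM.
  have cc : aff (cell Q xc al (c0 \o kap) (fun i => c i \o kap) (fun i => alpha i \o kap) x k) x
     @[k --> \oo] --> limit_fun x.
    under eq_fun do rewrite /cell affD aff_sum.
    apply: cvgD; first by apply: cvg_aff; [exact: cB|exact: cvg_cst].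
    apply: cvg_big => [|j aj]; first by move=> q; exact: add_continuous.
    under eq_fun do rewrite affZ.
    by apply: cvgMl_tmp; apply: cvg_aff; [exact: cA|exact: cvg_cst].
  apply: cvg_trans cc; apply: near_eq_cvg; apply: filterS W_oo => k Wk.
  by rewrite -VW.
- move=> e e0.
  have : \forall k \near \oo, (k.+1%:R^-1 : R) < e.
    have := @cvg_harmonic R; move/cvgr_lt => /(_ e e0); exact.
  apply: filterS => k ke; have [_ _ _ /le_trans] := hkap k; apply.
  by rewrite lerD2l ltW.
Qed.


Hypothesis alpha1 : forall i k, `|alpha i k| = 1.

(** If [Al j] vanishes on the hyperplane of [al j], it is a multiple of [al j] and the class tends
    to a single [relu] neuron; otherwise the limit is discontinuous there. *)
Definition jump j := actQ j && `[< exists2 y, aff (al j) y = 0 & aff (Al j) y != 0 >].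

Lemma jump_act j : jump j -> actQ j. Proof. by case/andP. Qed.

Let meets_lin_al j : actQ j -> lin (al j) != 0.
Proof. by case/andP => _; exact: (@meets_lin _ _ _ _ al al1 j). Qed.

Lemma nojump_proportional j : actQ j -> ~~ jump j -> exists mu, Al j = mu *: al j.
Proof.
move=> aj nj; apply: vanish_proportional; first exact: meets_lin_al.
move=> x ax; apply: contrapT => /eqP Ax; move/negP : nj; apply; apply/andP; split => //.
by apply/asboolP; exists x.
Qed.

(** If all weights of the class except the representative's are bounded, then so is the latter, as
    [A j] converges. The weights then have limits and [Al j] is a multiple of [al j]. So a jump
    needs a second neuron. *)
Lemma bounded_nojump j : actQ j ->
  (forall i, rp i = j -> i != j -> exists M, \forall k \near U, `|c i k| <= M) -> ~~ jump j.
Proof.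
move=> aj cb; have [/eqP rj _] := andP aj.
have cb' : forall i, exists M, rp i == j -> i != j -> \forall k \near U, `|c i k| <= M.
  move=> i; have [rij|_] := eqVneq (rp i) j; last by exists 0.
  have [ij|ij] := eqVneq i j; first by exists 0.
  by have [M hM] := cb i rij ij; exists M.
have [M hM] := choice cb'.
have ahat1 i k : `|ahat al alpha i k| = 1 by rewrite /ahat; case: ifP; rewrite ?normrN.
have hb : \forall k \near U, forall i, rp i == j -> i != j -> `|c i k| <= M i.
  apply: filter_forall => i; have [rij|_] := boolP (rp i == j); last exact: nearW.
  have [ij|ij] := boolP (i != j); last exact: nearW.
  by apply: filterS (hM i rij ij) => k.
pose S := \sum_(i | (rp i == j) && (i != j)) M i.
have hA : \forall k \near U, `|A j k| <= `|Al j| + 1.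
  have /cvgrPdist_lt/(_ 1 ltr01) := A_cvg aj; apply: filterS => k.
  rewrite distrC => h1; rewrite -(subrK (Al j) (A j k)) addrC.
  by rewrite (le_trans (ler_normD _ _))// lerD2l ltW.
have hcj : \forall k \near U, `|c j k| <= `|Al j| + 1 + S.
  apply: filterS2 hA hb => k hA hb.
  have -> : `|c j k| = `|c j k *: ahat al alpha j k| by rewrite normrZ ahat1 mulr1.
  have -> : c j k *: ahat al alpha j k = A j k -
      \sum_(i | (rp i == j) && (i != j)) c i k *: ahat al alpha i k.
    by rewrite /Acoef (bigD1 j)/= ?rj// addrK.
  rewrite (le_trans (ler_normB _ _))// lerD// (le_trans (ler_norm_sum _ _ _))//.
  by apply: ler_sum => i /andP[rij ij]; rewrite normrZ ahat1 mulr1 hb.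
have /choice[gam hgam] : forall i, exists g : R, rp i == j -> c i @ U --> g.
  move=> i; have [rij|_] := boolP (rp i == j); last by exists 0.
  have [ij|ij] := eqVneq i j.
    by have [g cg] := ultra_boundedR_cvg hcj; exists g; rewrite ij.
  have [g cg] := ultra_boundedR_cvg (hM i rij ij); by exists g.
have cA : A j @ U --> (\sum_(i | rp i == j) gam i) *: al j.
  rewrite scaler_suml; apply: cvg_big => [|i rij]; first by move=> q; exact: add_continuous.
  apply: cvgZ; first exact: hgam.
  by rewrite -(eqP rij); exact: ahat_cvg.
have AlE := cvg_unique (@norm_hausdorff _ _) (A_cvg aj) cA.
apply/negP => /andP[_ /asboolP[y ay]].
by rewrite AlE affZ ay mulr0 eqxx.
Qed.

(* A jump costs two neurons, any other active class one. *)
Definition cost := (\sum_(j | actQ j) (jump j).+1)%N.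

Let gs j := #|[pred i | rp i == j]|.

Let gs_sum : (\sum_(j | rp j == j) gs j)%N = h.
Proof.
transitivity (\sum_(i < h) 1)%N; last by rewrite sum1_card card_ord.
rewrite [RHS](partition_big rp (fun j => rp j == j)) => [|i _]; last by rewrite repK.
by apply: eq_bigr => j _; rewrite /gs -sum1_card.
Qed.

Let F j : nat := if actQ j then (jump j).+1 else 0%N.

Let FE : (\sum_(j | rp j == j) F j)%N = cost.
Proof.
rewrite /cost [in LHS](bigID actQ)/= [X in (_ + X)%N]big1 ?addn0 => [|j /andP[_ /negbTE aj]].
  apply: eq_big => [j|j /andP[_ aj]]; last by rewrite /F aj.
  by rewrite /act andbA andbb.
by rewrite /F aj.
Qed.

Let F_le j : rp j == j -> (F j <= gs j)%N.
Proof.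
move=> rj; rewrite /F; case: ifPn => // aj.
have gj : (0 < gs j)%N by apply/card_gt0P; exists j.
have [jj|] := boolP (jump j); last by rewrite /= => _.
rewrite /= ltn_neqAle gj andbT; apply/negP => /eqP g1.
have := @bounded_nojump j aj; rewrite jj => /(_ _)/negP; apply => // i rij ij.
move/esym/eqP : g1 => /card1P[i0 hi0].
have ji0 : j = i0 by have := hi0 j; rewrite !inE rj => /esym/eqP.
have ii0 : i = i0 by have := hi0 i; rewrite !inE rij eqxx => /esym/eqP.
by rewrite ii0 -ji0 eqxx in ij.
Qed.

Lemma cost_le : (cost <= h)%N.
Proof.
rewrite -FE; apply: (@leq_trans (\sum_(j | rp j == j) gs j)%N); last by rewrite gs_sum.
by apply: leq_sum => j; exact: F_le.
Qed.

(** Equality of the sums of [F] and [gs] forces equality in every class: none is inactive, and none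
    has more neurons than it costs. *)
Lemma tight_groups : (h <= cost)%N -> forall j, rp j == j -> actQ j /\ gs j = (jump j).+1.
Proof.
move=> hc j rj.
have FG : F j = gs j.
  apply/eqP; rewrite eqn_leq F_le//= leqNgt; apply/negP => Fg.
  have : (\sum_(j | rp j == j) gs j <= \sum_(j | rp j == j) F j)%N by rewrite gs_sum FE.
  rewrite (bigD1 j)//= [X in (_ <= X)%N](bigD1 j)//= leqNgt => /negP; apply.
  by rewrite -addSn leq_add// leq_sum// => i /andP[ri _]; exact: F_le.
have gj : (0 < gs j)%N by apply/card_gt0P; exists j.
by move: FG gj; rewrite /F; case: ifP => // _ <-.
Qed.

Variable mu : 'I_h -> R.
Hypothesis muE : forall j, actQ j -> ~~ jump j -> Al j = mu j *: al j.

Definition ubase x := aff Bl x + \sum_(j | actQ j && ~~ jump j) mu j * relu (aff (al j) x).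

Lemma limit_funE x : limit_fun x = jumpy jump al Al ubase x.
Proof.
rewrite /limit_fun /jumpy /ubase -addrA; congr (_ + _).
rewrite (bigID jump)/= addrC; congr (_ + _).
  apply: eq_bigr => j /andP[aj nj]; rewrite muE// affZ mulrCA; congr (_ * _).
  by rewrite /relu /ind; have [z0|z0] := leP (aff (al j) x) 0; rewrite ?mul0r ?mul1r.
by apply: eq_bigl => j; rewrite andb_idl//; exact: jump_act.
Qed.

Lemma continuous_ubase : continuous ubase.
Proof.
have cr j : continuous (fun x => mu j * relu (aff (al j) x)).
  move=> x; have FF := nbhs_filter x.
  exact: (@cvgMl_tmp _ _ _ FF _ _ _ (cvg_relu FF (@continuous_aff R n (al j) x))).
move=> x; apply: (@continuousD _ _ _ (aff Bl)); first exact: continuous_aff.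
have cb := @cvg_big R 'I_h +%R 0 (fun j => actQ j && ~~ jump j) (fun q => add_continuous q)
  _ (nbhs x) (index_enum 'I_h) (fun j x => mu j * relu (aff (al j) x)) _ (nbhs_filter x).
by apply: cb => j _; exact: cr.
Qed.

Lemma bm_ubase : bm Q ubase.
Proof. by apply: bm_continuous => //; exact: continuous_ubase. Qed.

Definition slope e s (v : 'I_h -> 'rV[R]_n.+1) (eta : 'I_h -> R) j := (eta j / e) *: al j + s *: v j.

Lemma rmpE e s v eta j x : rmp al Al v eta e s j x = ramp (aff (slope e s v eta j) x) (aff (Al j) x).
Proof. by rewrite /rmp /slope affD !affZ. Qed.

(** [K] selects the ramps in which a neuron is reflected and [t] the sign of the resulting slope.
    All affine corrections join [Bl] in one affine function, which has to fit into the spare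
    neurons. *)
Lemma ramped_netQ (K : pred 'I_h) (t : 'I_h -> R) e s v eta (spare : nat) :
  (forall j, K j -> t j = 1 \/ t j = -1) -> (spare + cost <= h)%N ->
  netQ Q spare (aff (Bl + \sum_(j | jump j && K j) (t j *: slope e s v eta j + 2^-1 *: Al j))) ->
  netQ Q h (ramped jump al Al v eta ubase e s).
Proof.
move=> Kt sc nD.
pose phi j x := if jump j then
    rmp al Al v eta e s j x -
      (if K j then t j * aff (slope e s v eta j) x + aff (Al j) x / 2 else 0)
  else mu j * relu (aff (al j) x).
have nphi : netQ Q cost (fun x => \sum_(j | actQ j) phi j x).
  apply: netQ_sum => j aj; rewrite /phi; case: (jump j); last exact: netQ_neuron.
  have [Kj|_] := boolP (K j).
    by apply: netQ_eq (netQ_ramp_flip Q (slope e s v eta j) (Al j) (Kt j Kj)) => x _; rewrite rmpE.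
  by apply: netQ_eq (netQ_ramp Q (slope e s v eta j) (Al j)) => x _; rewrite subr0 rmpE.
apply: netQ_weaken sc _; apply: netQ_eq (netQD nD nphi) => x _.
rewrite /ramped /ubase affD aff_sum [\sum_(j | actQ j) phi j x](bigID jump)/= -!addrA; congr (_ + _).
have -> : \sum_(j | actQ j && jump j) phi j x = \sum_(j | jump j) rmp al Al v eta e s j x -
   \sum_(j | jump j && K j) (t j * aff (slope e s v eta j) x + aff (Al j) x / 2).
  rewrite [X in _ - X]big_mkcondr -sumrB; apply: eq_big => [j|j /andP[_ jj]]; last by rewrite /phi jj.
  by rewrite andb_idl//; exact: jump_act.
have -> : \sum_(j | actQ j && ~~ jump j) phi j x = \sum_(j | actQ j && ~~ jump j) mu j * relu (aff (al j) x).
  by apply: eq_bigr => j /andP[_ /negbTE jj]; rewrite /phi jj.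
have -> : \sum_(j | jump j && K j) aff (t j *: slope e s v eta j + 2^-1 *: Al j) x =
   \sum_(j | jump j && K j) (t j * aff (slope e s v eta j) x + aff (Al j) x / 2).
  by apply: eq_bigr => j _; rewrite affD !affZ [2^-1 * _]mulrC.
ring.
Qed.

Lemma netQ_const_aff D : lin D = 0 -> netQ Q 0 (aff D).
Proof. by move=> lD; apply: netQ_eq (netQ_cst Q (D ord0 ord0)) => x _; rewrite aff_lin0. Qed.


Section tight.
Hypothesis tight : (h <= cost)%N.

Let all_act j : rp j == j -> actQ j. Proof. by move=> rj; have [] := tight_groups tight rj. Qed.

Let rp_rp i : rp (rp i) == rp i. Proof. by rewrite repK. Qed.

Let flip_rp i : flp (rp i) = false.
Proof. by rewrite /flip repK eqxx. Qed.

Let flip_neq i : flp i -> i != rp i.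
Proof. by move=> fi; apply/eqP => ii; move: fi; rewrite ii flip_rp. Qed.

Let group_small i (s : seq 'I_h) : uniq s -> (forall k, k \in s -> rp k = rp i) ->
  (size s <= (jump (rp i)).+1)%N.
Proof.
move=> us sg; have [_ <-] := tight_groups tight (rp_rp i).
rewrite /gs cardE; apply: uniq_leq_size => // k ks.
by rewrite mem_enum inE sg.
Qed.

(** A flipped neuron and its representative are two members of one class; when tight, only jumps
    have two. *)
Let flip_jump i : flp i -> jump (rp i).
Proof.
move=> fi; have := @group_small i [:: i; rp i].
rewrite /= inE flip_neq//= => /(_ isT); case: (jump (rp i)) => //; apply.
by move=> k; rewrite !inE => /orP[]/eqP->//; rewrite repK.
Qed.

(** Two flipped neurons and their representative would be three members, more than a jump costs. *)
Let flip_inj i i' : flp i -> flp i' -> rp i = rp i' -> i = i'.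
Proof.
move=> fi fi' ii'; apply/eqP; apply: contraT => ni.
have := @group_small i [:: i; i'; rp i]; rewrite /= !inE negb_or ni flip_neq//= ii' flip_neq//=.
move=> /(_ isT) H; suff : (2 < (jump (rp i')).+1)%N by case: (jump _).
apply: H => k; rewrite !inE => /or3P[]/eqP->//; by rewrite ?ii' ?repK.
Qed.

Let BE k : B k = c0 k *: cst1 R n - \sum_(i | flp i) c i k *: ahat al alpha i k.
Proof.
rewrite /Bcoef [X in _ + X]big_pred0 ?addr0// => j.
apply/negbTE; rewrite negb_and negbK; have [rj|//] := boolP (rp j == j).
by have /andP[_ ->] := all_act rj; rewrite orbT.
Qed.

Let lin_coord (b : 'rV[R]_n.+1) l : lin b ord0 l = b ord0 (lift ord0 l).
Proof. by rewrite mxE. Qed.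

Let lin_cst1 : lin (cst1 R n) = 0.
Proof. by apply/rowP => l; rewrite !mxE andbF. Qed.

(** Without flips, and with every class meeting [Q], [B] is a constant function for each k, and so
    is its limit. *)
Lemma noflip_lin : (forall i, ~~ flp i) -> lin Bl = 0.
Proof.
move=> nf; apply/rowP => l; rewrite lin_coord [RHS]mxE.
have cB : B k ord0 (lift ord0 l) @[k --> U] --> Bl ord0 (lift ord0 l).
  exact: (cvg_comp _ _ B_cvg (@coord_continuous R 1 n.+1 ord0 (lift ord0 l) Bl)).
have c0l : B k ord0 (lift ord0 l) @[k --> U] --> (0 : R).
  rewrite (_ : (fun k => _) = fun=> 0); first exact: cvg_cst.
  apply/funext => k; rewrite -lin_coord BE big_pred0 => [|i]; last exact/negbTE.
  by rewrite subr0 linZ lin_cst1 scaler0 mxE.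
exact: (cvg_unique (@norm_hausdorff _ _) cB c0l).
Qed.

(* Flipped neurons belong to jumps, so their outer weights blow up; as [B] stays bounded,
   their normalised limit is a linear relation between the normals of the jumps. *)
Lemma flip_relation i0 : flp i0 -> exists kap : 'I_h -> R,
  (exists2 j, jump j & kap j != 0) /\ \sum_(j | jump j) kap j *: lin (al j) = 0.
Proof.
move=> f0; pose S k := \sum_(i | flp i) `|c i k|.
have cS i k : flp i -> `|c i k| <= S k.
  by move=> fi; rewrite /S (bigD1 i)//= lerDl sumr_ge0.
(* If the flipped weights stayed bounded, [bounded_nojump] would apply to the class of [i0]: its
   only member besides the representative is flipped. *)
have Sbig : forall M, \forall k \near U, M < S k.
  have [[M hM]|//] := ultra_boundedP (U := U) S; exfalso.
  have := @bounded_nojump _ (jump_act (flip_jump f0)).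
  rewrite flip_jump// => /(_ _)/negP; apply => // i rij ij.
  exists M; apply: filterS hM => k; apply: le_trans; apply: cS.
  apply: contraT => nfi; have := @group_small i0 [:: i; i0; rp i0].
  have ii0 : i != i0 by apply: contraNneq nfi => ->.
  rewrite /= !inE negb_or ii0 ij flip_neq//= => /(_ isT) H.
  suff : (2 < (jump (rp i0)).+1)%N by case: (jump _).
  by apply: H => k'; rewrite !inE => /or3P[]/eqP->//; rewrite repK.
have S0 := Sbig 0.
have /choice[kp hkp] : forall i, exists g : R, flp i -> c i k / S k @[k --> U] --> g.
  move=> i; have [fi|_] := boolP (flp i); last by exists 0.
  have [|g cg] := @ultra_boundedR_cvg _ U _ R (fun k => c i k / S k) 1; last by exists g.
  apply: filterS S0 => k Sk; rewrite normrM normfV (gtr0_norm Sk).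
  by rewrite ler_pdivrMr// mul1r cS.
have kp1 : \sum_(i | flp i) `|kp i| = 1.
  have c1 : \sum_(i | flp i) `|c i k / S k| @[k --> U] --> \sum_(i | flp i) `|kp i|.
    apply: cvg_big => [|i fi]; first by move=> q; exact: add_continuous.
    by apply: cvg_norm; exact: hkp.
  have c2 : \sum_(i | flp i) `|c i k / S k| @[k --> U] --> (1 : R).
    apply: cvg_near_cst; apply: filterS S0 => k Sk.
    rewrite (eq_bigr (fun i => `|c i k| / S k)) => [|i _].
      by rewrite -mulr_suml mulfV// gt_eqF.
    by rewrite normrM normfV (gtr0_norm Sk).
  exact: (cvg_unique (@norm_hausdorff _ _) c1 c2).
have Sinv : (S k)^-1 @[k --> U] --> (0 : R).
  apply/cvgrPdist_lt => e e0; apply: filterS2 S0 (Sbig e^-1) => k Sk ek.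
  by rewrite sub0r normrN normfV (gtr0_norm Sk) invf_plt ?posrE.
(* Only slopes are compared, so the possibly unbounded [c0] drops out of B / S. *)
have rel : \sum_(i | flp i) kp i *: lin (al (rp i)) = 0.
  apply/rowP => l; rewrite [RHS]mxE summxE.
  have cB : B k ord0 (lift ord0 l) @[k --> U] --> Bl ord0 (lift ord0 l).
    exact: (cvg_comp _ _ B_cvg (@coord_continuous R 1 n.+1 ord0 (lift ord0 l) Bl)).
  have c1 : - ((S k)^-1 * B k ord0 (lift ord0 l)) @[k --> U] --> - (0 * Bl ord0 (lift ord0 l)).
    by apply: cvgN; exact: cvgM.
  rewrite mul0r oppr0 in c1.
  have c2 : \sum_(i | flp i) (c i k / S k) * lin (ahat al alpha i k) ord0 l @[k --> U] -->
      \sum_(i | flp i) kp i * lin (al (rp i)) ord0 l.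
    apply: cvg_big => [|i fi]; first by move=> q; exact: add_continuous.
    apply: cvgM; first exact: hkp.
    have ca : ahat al alpha i @ U --> al (rp i) by exact: ahat_cvg.
    rewrite lin_coord (_ : (fun k => _) = (fun k => ahat al alpha i k ord0 (lift ord0 l))); last first.
      by apply/funext => k; rewrite lin_coord.
    exact: (cvg_comp _ _ ca (@coord_continuous R 1 n.+1 ord0 (lift ord0 l) (al (rp i)))).
  have E k : - ((S k)^-1 * B k ord0 (lift ord0 l)) =
      \sum_(i | flp i) (c i k / S k) * lin (ahat al alpha i k) ord0 l.
    rewrite -lin_coord BE linD linN linZ lin_cst1 scaler0 add0r lin_sum.
    rewrite [X in _ * X]mxE mulrN opprK summxE mulr_sumr; apply: eq_bigr => i _.
    by rewrite linZ [X in _ * X]mxE; ring.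
  under eq_bigr do rewrite mxE.
  rewrite (_ : (fun k => - _) = (fun k => \sum_(i | flp i) (c i k / S k) * lin (ahat al alpha i k) ord0 l)) in c1; last exact/funext.
  exact: (cvg_unique (@norm_hausdorff _ _) c2 c1).
(* By [flip_inj] the sum has at most one term: it reindexes [kp] from flipped neurons to classes. *)
pose kap j := \sum_(i | flp i && (rp i == j)) kp i.
have kapE i : flp i -> kap (rp i) = kp i.
  move=> fi; rewrite /kap (bigD1 i) ?fi ?eqxx//= big1 ?addr0// => i' /andP[/andP[fi' /eqP ri'] ii'].
  by rewrite (flip_inj fi' fi ri') eqxx in ii'.
exists kap; split.
  have [i fi kpi] : exists2 i, flp i & kp i != 0.
    apply: contrapT => nex; have := kp1; rewrite big1 => [/eqP|i fi].
      by rewrite eq_sym oner_eq0.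
    by apply/eqP; rewrite normr_eq0; apply: contraT => kpi; exfalso; apply: nex; exists i.
  by exists (rp i); [exact: flip_jump|rewrite kapE].
rewrite -[RHS]rel [RHS](partition_big rp jump) => [|i fi]; last exact: flip_jump.
apply: eq_bigr => j jj; rewrite /kap scaler_suml.
by apply: eq_bigr => i /andP[_ /eqP ->].
Qed.

End tight.

(* A spare neuron absorbs the affine part; without spare neurons, it is made constant by
   reflecting neurons along [flip_relation], or is constant because nothing is flipped. *)
Lemma exists_ramps : exists v eta, (forall j, 0 < eta j) /\
  forall e s, 0 < e -> s = 1 \/ s = -1 -> netQ Q h (ramped jump al Al v eta ubase e s).
Proof.
have [loose|tight] := ltnP cost h.
  exists (fun=> 0), (fun=> 1); split => // e s e0 _.
  apply: (@ramped_netQ pred0 (fun=> 1) _ _ _ _ 1) => //.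
  by rewrite big_pred0 ?addr0; [exact: netQ_aff|move=> j; rewrite andbF].
have [[i0 f0]|nf] := pselect (exists i, flp i); last first.
  exists (fun=> 0), (fun=> 1); split => // e s e0 _.
  apply: (@ramped_netQ pred0 (fun=> 1) _ _ _ _ 0) => //; first by rewrite add0n cost_le.
  rewrite big_pred0 ?addr0; last by move=> j; rewrite andbF.
  apply: netQ_const_aff; apply: noflip_lin => // i; apply/negP => fi; apply: nf; by exists i.
have [kap [[j1 jj1 kj1] rel]] := flip_relation tight f0.
pose K j := kap j != 0.
(* Reflecting with sign s sg(kap j) and taking eta j = |kap j| turns the steep parts into (s / e)
   times the sum of kap j *: al j, whose slope is 0 by [rel]. The remaining affine part is cancelled
   by loading [V] on the single ramp [j1]; since s s = 1, this works for both signs of s. *)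
pose V := - (Bl + \sum_(j | jump j && K j) 2^-1 *: Al j).
pose v j := if j == j1 then Num.sg (kap j1) *: V else 0.
pose eta j := if K j then `|kap j| else 1.
exists v, eta; split => [j|e s e0 s1].
  by rewrite /eta /K; case: ifPn => // kj; rewrite normr_gt0.
have sg1 (t : R) : t != 0 -> Num.sg t = 1 \/ Num.sg t = -1.
  move=> t0; have [tn|tp|/eqP] := ltgtP t 0; last by rewrite (negbTE t0).
    by right; exact: ltr0_sg.
  by left; exact: gtr0_sg.
have ss : s * s = 1 by case: s1 => ->; rewrite ?mulrNN mulr1.
have sgsg (t : R) : t != 0 -> Num.sg t * Num.sg t = 1.
  by move=> /sg1[] ->; rewrite ?mulrNN mulr1.
apply: (@ramped_netQ K (fun j => s * Num.sg (kap j)) _ _ _ _ 0).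
- by move=> j Kj; case: s1 => ->; case: (sg1 _ Kj) => ->; rewrite ?mulrNN ?mulr1 ?mul1r; [left|right|right|left].
- by rewrite add0n cost_le.
apply: netQ_const_aff.
have -> : Bl + \sum_(j | jump j && K j) ((s * Num.sg (kap j)) *: slope e s v eta j + 2^-1 *: Al j) =
   (s / e) *: \sum_(j | jump j) kap j *: al j.
  rewrite big_split/=.
  have -> : \sum_(j | jump j && K j) (s * Num.sg (kap j)) *: slope e s v eta j =
      \sum_(j | jump j && K j) (s / e) *: (kap j *: al j) + \sum_(j | jump j && K j) Num.sg (kap j) *: v j.
    rewrite -big_split/=; apply: eq_bigr => j /andP[_ Kj].
    rewrite /slope scalerDr !scalerA; congr (_ *: _ + _ *: _).
      by rewrite /eta Kj [in RHS](numEsg (kap j)); ring.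
    by rewrite mulrAC ss mul1r.
  have -> : \sum_(j | jump j && K j) Num.sg (kap j) *: v j = V.
    rewrite (bigD1 j1)/= ?jj1 ?kj1// big1 ?addr0 => [|j /andP[_ jn]].
      by rewrite /v eqxx scalerA sgsg// scale1r.
    by rewrite /v (negbTE jn) scaler0.
  have -> : \sum_(j | jump j) kap j *: al j = \sum_(j | jump j && K j) kap j *: al j.
    rewrite (bigID K)/= [X in _ + X]big1 ?addr0// => j /andP[_]; rewrite negbK => /eqP ->.
    by rewrite scale0r.
  rewrite scaler_sumr /V; set X := \sum_(j | _) _ *: (_ *: _); set Y := \sum_(j | _) 2^-1 *: _.
  by rewrite opprD !addrA subrK addrAC subrr add0r.
rewrite linZ lin_sum (eq_bigr (fun j => kap j *: lin (al j))) ?rel ?scaler0// => j _.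
by rewrite linZ.
Qed.

Lemma limit_attained : (forall phi, netQ Q h phi -> m <= loss phi) ->
  exists2 phi, netQ Q h phi & loss phi <= m.
Proof.
move=> mlb; have [v [eta [eta0 hv]]] := exists_ramps.
have lE : loss limit_fun = loss (jumpy jump al Al ubase).
  by apply: eq_loss => x _; exact: limit_funE.
have [/existsP[j0 jj0]|nj] := boolP [exists j, jump j].
  exfalso.
  have [||||||||e e0 imp] := @ramp_improvement _ _ _ _ oQ bQ cp p0 pQ _ bf cf _ jump al Al v eta ubase.
  - exact: bm_ubase.
  - by move=> x _; exact: continuous_ubase.
  - by move=> *; exact: eta0.
  - by move=> j /jump_act/andP[_ /asboolP[x [Qx ax]]]; exists x.
  - by move=> j /jump_act; exact: meets_lin_al.
  - move=> i j /jump_act/andP[/eqP ri mi] /jump_act/andP[/eqP rj _] ij.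
    by apply: (rep_hyperplane_neq al1 mi ri rj); rewrite eq_sym.
  - by move=> j /andP[_ /asboolP].
  - by exists j0.
  have h1 := mlb _ (hv e 1 e0 (or_introl erefl)).
  have h2 := mlb _ (hv e (-1) e0 (or_intror erefl)).
  have := limit_loss; rewrite lE; move: imp h1 h2; rewrite /loss => imp h1 h2 h3.
  lra.
exists limit_fun; last exact: limit_loss.
(* Without jumps the ramped function is the limit itself, so [hv] already bounds its width. *)
apply: netQ_eq (hv 1 1 ltr01 (or_introl erefl)) => x _.
rewrite limit_funE /ramped /jumpy; congr (_ + _).
by rewrite !big_pred0// => j; apply/negbTE; move: nj; rewrite negb_exists => /forallP.
Qed.

End limit.

Theorem exists_minimizer h : exists2 phi, netQ Q h phi &
  forall psi, netQ Q h psi -> loss phi <= loss psi.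
Proof.
pose S := [set loss psi | psi in netQ Q h].
have S0 : has_inf S.
  split; last by exists 0 => _ [psi _ <-]; exact: loss_ge0.
  by exists (loss (fun=> 0)); exists (fun=> 0) => //; apply: netQ_weaken (netQ_cst Q 0).
pose m := inf S.
have mlb phi : netQ Q h phi -> m <= loss phi.
  by move=> nphi; apply: ge_inf; [exact: S0.2|exists phi].
have sel (k : nat) : exists q : R * ('I_h -> R) * ('I_h -> 'rV[R]_n.+1),
    (forall i, `|q.2 i| = 1) /\ loss (netf q.1.1 q.1.2 q.2) <= m + k.+1%:R^-1.
  have k0 : 0 < k.+1%:R^-1 :> R by rewrite invr_gt0.
  have [_ [phi nphi <-] hphi] := inf_adherent k0 S0.
  have [c0 [c [a [a1 aE]]]] := netf_normalized nphi.
  by exists (c0, c, a); split => //=; rewrite -(eq_loss aE) ltW.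
have [q hq] := choice sel.
have [U [UU sU]] := ultraFilterLemma (@eventually_filter).
have /choice[al hal] : forall i, exists l : 'rV[R]_n.+1, (fun k => (q k).2 i) @ U --> l.
  move=> i; apply: (ultra_bounded_cvg (M := 1)); apply: nearW => k.
  by have [-> _] := hq k.
have al1 i : `|al i| = 1.
  have c1 : `|(q k).2 i| @[k --> U] --> (1 : R).
    by apply: cvg_near_cst; apply: nearW => k; have [-> _] := hq k.
  exact: (cvg_unique (@norm_hausdorff _ _) (cvg_norm (hal i)) c1).
pose c0 k := (q k).1.1; pose c i k := (q k).1.2 i; pose alpha i k := (q k).2 i.
have loss_le k : wint p (fun x => (netf (c0 k) (c ^~ k) (alpha ^~ k) x - f x) ^+ 2) <= m + 1.
  have [_ /le_trans] := hq k; apply; rewrite lerD2l invf_le1// ler1n//.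
have /choice[Al hAl] : forall j, exists l : 'rV[R]_n.+1, act Q al j -> Acoef al c alpha j @ U --> l.
  move=> j; have [aj|_] := boolP (act Q al j); last by exists 0.
  have [M' hM'] := Acoef_bounded oQ bQ Qconv Qxc cp p0 pQ bf loss_le hal al1 aj.
  by have [l hl] := ultra_bounded_cvg hM'; exists l.
have [M' hM'] := Bcoef_bounded oQ bQ Qconv Qxc cp p0 pQ bf loss_le hal al1.
have [Bl hBl] := ultra_bounded_cvg hM'.
have /choice[mu hmu] : forall j, exists mu, act Q al j -> ~~ jump al Al j -> Al j = mu *: al j.
  move=> j; have [aj|_] := boolP (act Q al j); last by exists 0.
  have [jj|nj] := boolP (jump al Al j); first by exists 0.
  by have [mu hmu] := nojump_proportional al1 aj nj; exists mu.
have U_loss e : 0 < e -> \forall k \near U, loss (netf (c0 k) (c ^~ k) (alpha ^~ k)) <= m + e.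
  move=> e0; apply: sU.
  have : \forall k \near \oo, (k.+1%:R^-1 : R) < e.
    have := @cvg_harmonic R; move/cvgr_lt => /(_ e e0); exact.
  apply: filterS => k ke; have [_ /le_trans] := hq k; apply.
  by rewrite lerD2l ltW.
have a1 i k : `|alpha i k| = 1 by have [->] := hq k.
have [phi nphi hphi] := limit_attained U_loss hal al1 hAl hBl a1 hmu mlb.
by exists phi => // psi /mlb; exact: le_trans.
Qed.

End existence.

(** * Strict descent *)

Section strict_descent.
Variables (R : realType) (d' : nat).
Local Notation n := d'.+1.
Variables (Q : set 'rV[R]_n) (p : 'rV[R]_n -> R).
Hypothesis oQ : open Q.
Hypothesis bQ : exists B, forall x, Q x -> forall i, `|x ord0 i| <= B.
Hypothesis cp : continuous p.
Hypothesis p0 : forall x, 0 <= p x.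
Hypothesis pQ : forall x, 0 < p x <-> Q x.

(** * Functions orthogonal to every neuron *)

Section orthogonality.
Variable r : 'rV[R]_n -> R.
Hypothesis br : bm Q r.
Hypothesis cr : forall x, Q x -> {for x, continuous r}.
Hypothesis r_orth : forall a, wint p (fun x => r x * relu (aff a x)) = 0.

Let Lam phi := wint p (fun x => r x * phi x).

Let LamD phi psi : bm Q phi -> bm Q psi -> Lam (fun x => phi x + psi x) = Lam phi + Lam psi.
Proof.
move=> h1 h2; rewrite /Lam -(wintD oQ bQ cp p0 pQ); try exact: bmM.
by congr wint; apply/funext => x; rewrite mulrDr.
Qed.

Let LamZ c phi : bm Q phi -> Lam (fun x => c * phi x) = c * Lam phi.
Proof.
move=> h1; rewrite /Lam -(wintZ oQ bQ cp p0 pQ); last exact: bmM.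
by congr wint; apply/funext => x; rewrite mulrCA.
Qed.

Let Lam_sum (I : Type) (s : seq I) (phi : I -> 'rV[R]_n -> R) : (forall i, bm Q (phi i)) ->
  Lam (fun x => \sum_(i <- s) phi i x) = \sum_(i <- s) Lam (phi i).
Proof.
move=> h; rewrite /Lam -(wint_sum oQ bQ cp p0 pQ) => [|i _]; last exact: bmM.
by congr wint; apply/funext => x; rewrite mulr_sumr.
Qed.

Let bm_relu a : bm Q (fun x => relu (aff a x)).
Proof.
apply: bm_continuous => // x.
exact: (cvg_relu (nbhs_filter x) (@continuous_aff R n a x)).
Qed.

Let bm_exp a : bm Q (fun x => expR (aff a x)).
Proof.
apply: bm_continuous => // x.
exact: (cvg_comp _ _ (@continuous_aff R n a x) (@continuous_expR R (aff a x))).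
Qed.

(** The second difference of [relu]: the tent on [-1, 1] with peak 1. *)
Definition hat (u : R) : R := relu (u + 1) - 2 * relu u + relu (u - 1).

Lemma hat_ge0 u : 0 <= hat u.
Proof.
rewrite /hat /relu; have [h1|h1] := leP (u + 1) 0; have [h2|h2] := leP u 0;
by have [h3|h3] := leP (u - 1) 0; lra.
Qed.

Lemma hat_eq0 u : 1 <= `|u| -> hat u = 0.
Proof.
rewrite /hat /relu ler_normr => /orP[] hu; have [h1|h1] := leP (u + 1) 0;
have [h2|h2] := leP u 0; by have [h3|h3] := leP (u - 1) 0; lra.
Qed.

(** Integer translates of the tent form a partition of unity; with first differences [D] of [relu]
    the sum telescopes. *)
Lemma hat_sum u m : 0 <= u -> u <= m%:R -> \sum_(k < m.+1) hat (u - k%:R) = 1.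
Proof.
move=> u0 um; pose D (k : nat) : R := relu (u - k%:R + 1) - relu (u - k%:R).
have -> : \sum_(k < m.+1) hat (u - k%:R) = - \sum_(0 <= k < m.+1) (D k.+1 - D k).
  rewrite big_mkord -sumrN; apply: eq_bigr => k _; rewrite /D /hat.
  have -> : u - k.+1%:R + 1 = u - k%:R by rewrite -natr1; ring.
  have -> : u - k.+1%:R = u - k%:R - 1 by rewrite -natr1; ring.
  ring.
have Dm : D m.+1 = 0.
  by rewrite /D !relu_le0 ?subrr// -natr1; lra.
have D0 : D 0 = 1 by rewrite /D mulr0n subr0 !relu_gt0 //; lra.
by rewrite telescope_sumr// Dm D0 sub0r opprK.
Qed.

Let Lam_hat b : Lam (fun x => hat (aff b x)) = 0.
Proof.
have b1 s : (fun x => relu (aff b x + s)) = (fun x => relu (aff (b + s *: cst1 R n) x)).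
  by apply/funext => x; rewrite affD affZ aff_cst1 mulr1.
have bms s : bm Q (fun x => relu (aff b x + s)) by rewrite b1.
have L0 s : Lam (fun x => relu (aff b x + s)) = 0 by rewrite b1; exact: r_orth.
have L0' : Lam (fun x => relu (aff b x)) = 0 by exact: r_orth.
rewrite (_ : (fun x => _) = (fun x => (relu (aff b x + 1) + (- 2) * relu (aff b x)) + relu (aff b x + -1))).
  by rewrite LamD ?LamD ?LamZ ?L0 ?L0' ?mulr0 ?addr0//; [exact: bmZ|apply: bmD => //; exact: bmZ].
by apply/funext => x; rewrite /hat mulNr.
Qed.

Let Lam_bound phi e : bm Q phi -> (forall x, Q x -> `|phi x| <= e) ->
  `|Lam phi| <= e * wint p (fun x => `|r x|).
Proof.
move=> hphi phie.
have bnr : bm Q (fun x => `|r x|).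
  have [m1 [M hM]] := br; split; first exact: measurableT_comp.
  by exists M => x Qx; rewrite normr_id hM.
rewrite -(wintZ oQ bQ cp p0 pQ)// ler_norml; apply/andP; split.
  rewrite -mulN1r -(wintZ oQ bQ cp p0 pQ); last exact: bmZ.
  apply: (wint_le oQ bQ cp p0 pQ); [by do 2 apply: bmZ|exact: bmM|].
  move=> x Qx; rewrite mulN1r lerNl; apply: le_trans (ler_norm _) _.
  by rewrite normrN normrM mulrC ler_wpM2r// phie.
apply: (wint_le oQ bQ cp p0 pQ); [exact: bmM|exact: bmZ|].
move=> x Qx; apply: le_trans (ler_norm _) _.
by rewrite normrM mulrC ler_wpM2r// phie.
Qed.

(** The exponential is approximated uniformly on [Q] by the combination of tents with its values at
    equidistant nodes; each tent is orthogonal to [r]. *)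
Lemma orth_exp a : wint p (fun x => r x * expR (aff a x)) = 0.
Proof.
have [K hK] := continuous_bounded_on_bounded bQ (@continuous_aff R n a).
pose W := wint p (fun x => `|r x|).
have W0 : 0 <= W by apply: (wint_ge0 p0 pQ).
apply/eqP; rewrite -normr_le0; apply/ler_addgt0Pr => e e0; rewrite add0r.
(* The error on [Q] will be at most expR K * e1, contributing expR K * e1 * W <= e; the + 1 covers W
   = 0. *)
pose e1 := e / (expR K * (W + 1)).
have e10 : 0 < e1 by rewrite divr_gt0// mulr_gt0 ?expR_gt0// ltr_pwDr.
have [del /= del0 hdel] : exists2 del : R, 0 < del & forall y, `|y| < del -> `|expR y - 1| < e1.
  have /cvgrPdist_lt/(_ e1 e10)/nbhs_ballP[del /= del0 hdel] := @continuous_expR R 0.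
  exists del => // y yd; have := hdel y; rewrite /ball/= sub0r normrN expR0 distrC; exact.
pose N := (Num.truncn del^-1).+1.
have N0 : 0 < N%:R :> R by rewrite ltr0n.
have Nd : N%:R^-1 < del.
  by rewrite invf_plt ?posrE//; exact: truncnS_gt.
(* Shifts the range [-K, K] of the affine form to start at 0 and stretches it, so that the nodes
   [s k], at distance 1 / N < del, become the integers 0, ..., m. *)
pose b : 'rV[R]_n.+1 := N%:R *: (a + K *: cst1 R n).
have bE x : aff b x = N%:R * (aff a x + K) by rewrite affZ affD affZ aff_cst1 mulr1.
pose m := (Num.truncn (N%:R * (K + K))).+1.
pose s (k : nat) : R := k%:R / N%:R - K.
pose g x := \sum_(k < m.+1) expR (s k) * hat (aff b x - k%:R).
have hatE (k : 'I_m.+1) x : hat (aff b x - k%:R) = hat (aff (b - k%:R *: cst1 R n) x).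
  by rewrite affB affZ aff_cst1 mulr1.
have bm_hat b' : bm Q (fun x => hat (aff b' x)).
  apply: bmD; first apply: bmB => //; first by
    rewrite (_ : (fun x => _) = (fun x => relu (aff (b' + cst1 R n) x))) //; apply/funext => x; rewrite affD aff_cst1.
    exact: bmZ.
  by rewrite (_ : (fun x => _) = (fun x => relu (aff (b' - cst1 R n) x))) //; apply/funext => x; rewrite affB aff_cst1.
have gE : g = (fun x => \sum_(k < m.+1) expR (s k) * hat (aff (b - k%:R *: cst1 R n) x)).
  by apply/funext => x; apply: eq_bigr => k _; rewrite hatE.
have bg : bm Q g by rewrite gE; apply: bm_sum => k _; exact: bmZ.
have Lg : Lam g = 0.
  rewrite gE Lam_sum => [|k]; last exact: bmZ.
  by rewrite big1// => k _; rewrite LamZ// Lam_hat mulr0.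
have -> : wint p (fun x => r x * expR (aff a x)) = Lam (fun x => expR (aff a x) + -1 * g x).
  by rewrite LamD ?LamZ ?Lg ?mulr0 ?addr0//; exact: bmZ.
have err x : Q x -> `|expR (aff a x) + -1 * g x| <= expR K * e1.
  move=> Qx; have := hK x Qx; rewrite ler_norml => /andP[h1 h2].
  have bx0 : 0 <= aff b x by rewrite bE; apply: mulr_ge0; [exact: ltW|lra].
  have bxm : aff b x <= m%:R.
    rewrite (@le_trans _ _ (N%:R * (K + K)))//; last exact/ltW/truncnS_gt.
    by rewrite bE ler_pM2l// lerD2r.
  have hs := hat_sum bx0 bxm.
  rewrite (_ : _ + _ = \sum_(k < m.+1) (expR (aff a x) - expR (s k)) * hat (aff b x - k%:R)); last first.
    by rewrite (eq_bigr _ (fun k _ => mulrBl _ _ _)) sumrB -mulr_sumr hs mulr1 mulN1r.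
  apply: le_trans (ler_norm_sum _ _ _) _.
  have -> : expR K * e1 = \sum_(k < m.+1) expR K * e1 * hat (aff b x - k%:R).
    by rewrite -mulr_sumr hs mulr1.
  apply: ler_sum => k _; rewrite normrM (ger0_norm (hat_ge0 _)).
  have [k1|k1] := leP 1 `|aff b x - k%:R|; first by rewrite hat_eq0// !mulr0.
  apply: ler_wpM2r; first exact: hat_ge0.
  have -> : expR (s k) = expR (aff a x) * expR (s k - aff a x) by rewrite -expRD addrC subrK.
  rewrite -{1}[expR (aff a x)]mulr1 -mulrBr normrM (gtr0_norm (expR_gt0 _)).
  apply: ler_pM => //; rewrite ?expR_ge0// ?ler_expR//.
  rewrite distrC ltW//; apply: hdel; apply: le_lt_trans Nd.
  have -> : s k - aff a x = - ((aff b x - k%:R) / N%:R).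
    by rewrite bE /s; field; rewrite gt_eqF.
  by rewrite normrN normrM normfV (gtr0_norm N0) ler_pdivrMr// mulVf ?gt_eqF// ltW.
have := @Lam_bound (fun x => expR (aff a x) + -1 * g x) (expR K * e1) (bmD (bm_exp a) (bmZ (-1) bg)) err.
move=> /le_trans; apply; rewrite -/W /e1.
have eK := expR_gt0 K.
have -> : expR K * (e / (expR K * (W + 1))) * W = e * (W / (W + 1)).
  by field; rewrite !gt_eqF//= ltr_pwDr.
apply: ler_piMr; first exact: ltW.
by rewrite ler_pdivrMr ?ltr_pwDr// mul1r lerDl.
Qed.

(** Since exponentials of affine forms multiply to such exponentials, this span is an algebra;
    orthogonality thus extends to powers of its members. *)
Let expspan (phi : 'rV[R]_n -> R) := exists s : seq (R * 'rV[R]_n.+1),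
  forall x, phi x = \sum_(q <- s) q.1 * expR (aff q.2 x).

Let expspan_orth phi : expspan phi -> wint p (fun x => r x * phi x) = 0.
Proof.
move=> [s sE]; have -> : phi = (fun x => \sum_(q <- s) q.1 * expR (aff q.2 x)) by exact/funext.
rewrite [LHS](@Lam_sum _ s (fun q x => q.1 * expR (aff q.2 x))) => [|q]; last exact: bmZ.
by rewrite big1// => q _; rewrite LamZ// [X in _ * X]orth_exp mulr0.
Qed.

Let expspan_exp c a : expspan (fun x => c * expR (aff a x)).
Proof. by exists [:: (c, a)] => x; rewrite big_seq1. Qed.

Let expspan_cst c : expspan (fun=> c).
Proof. by exists [:: (c, 0)] => x; rewrite big_seq1/= aff0 expR0 mulr1. Qed.

Let expspanD phi psi : expspan phi -> expspan psi -> expspan (fun x => phi x + psi x).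
Proof. by move=> [s sE] [t tE]; exists (s ++ t) => x; rewrite big_cat/= sE tE. Qed.

Let expspan_sum (I : Type) (s : seq I) (phi : I -> 'rV[R]_n -> R) :
  (forall i, expspan (phi i)) -> expspan (fun x => \sum_(i <- s) phi i x).
Proof.
move=> h; elim: s => [|i s ih].
  by have [t tE] := expspan_cst 0; exists t => x; rewrite big_nil -tE.
by have [t tE] := expspanD (h i) ih; exists t => x; rewrite big_cons -tE.
Qed.

Let expspanM phi psi : expspan phi -> expspan psi -> expspan (fun x => phi x * psi x).
Proof.
move=> [s sE] [t tE].
have [u uE] := @expspan_sum _ s (fun q x => \sum_(q' <- t) q.1 * q'.1 * expR (aff (q.2 + q'.2) x))
  (fun q => expspan_sum t (fun q' => expspan_exp (q.1 * q'.1) (q.2 + q'.2))).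
exists u => x; rewrite -uE sE tE mulr_suml; apply: eq_bigr => q _.
by rewrite mulr_sumr; apply: eq_bigr => q' _; rewrite affD expRD; ring.
Qed.

Let expspanX phi k : expspan phi -> expspan (fun x => phi x ^+ k).
Proof.
move=> h; elim: k => [|k ih]; first exact: expspan_cst.
by have [t tE] := expspanM h ih; exists t => x; rewrite exprS -tE.
Qed.

Let cosh2 (u : R) := expR u + expR (- u).

(** With s t = 1, s^2 + t^2 = 2 + (s - t)^2, and |s - t| >= |u / 2| by the tangent of the
    exponential at 0. *)
Let cosh2_ge u : 2 + (u / 2) ^+ 2 <= cosh2 u.
Proof.
pose s := expR (u / 2); pose t := expR (- (u / 2)).
have st : s * t = 1 by rewrite /s /t -expRD subrr expR0.
have -> : cosh2 u = s ^+ 2 + t ^+ 2.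
  by rewrite /cosh2 !expr2 /s /t -!expRD; congr (expR _ + expR _); field.
have s1 : 1 + u / 2 <= s by exact: expR_ge1Dx.
have t1 : 1 - u / 2 <= t by exact: expR_ge1Dx.
have s0 : 0 < s by exact: expR_gt0.
have t0 : 0 < t by exact: expR_gt0.
have [u0|u0] := leP 0 (u / 2).
  have t_le1 : t <= 1 by nra.
  nra.
have s_le1 : s <= 1 by nra.
nra.
Qed.

(** [pk] has its strict maximum at [y]. High powers of [C + pk] concentrate near [y], where [r] is
    positive, so their integral against [r] could not vanish. *)
Lemma orth_not_gt0 y : Q y -> ~ 0 < r y.
Proof.
move=> Qy ry.
have : \forall x \near y, r y / 2 < r x.
  by move/cvgr_gt : (cr Qy) => /(_ (r y / 2)); apply; lra.
move=> /(filterI (open_nbhs_nbhs (conj oQ Qy)))/nbhs_ballP[del /= del0 hdel].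
pose pk (x : 'rV[R]_n) := - \sum_i cosh2 (x ord0 i - y ord0 i).
have /choice[b bE] := @aff_coord R n.
have pkE : pk = fun x => - 1 * \sum_(i < n) (1 * expR (aff (b i - y ord0 i *: cst1 R n) x) +
    1 * expR (aff (- (b i - y ord0 i *: cst1 R n)) x)).
  apply/funext => x; rewrite /pk mulN1r; congr (- _); apply: eq_bigr => i _.
  by rewrite !mul1r affN affB affZ aff_cst1 mulr1 -bE.
have span_pk : expspan pk.
  rewrite pkE; apply: expspanM; first exact: expspan_cst.
  by apply: expspan_sum => i; apply: expspanD; exact: expspan_exp.
have cpk : continuous pk.
  rewrite pkE => x; have FF := nbhs_filter x.
  have ce a : expR (aff a x') @[x' --> x] --> expR (aff a x).
    exact: (cvg_comp _ _ (@continuous_aff R n a x) (@continuous_expR R (aff a x))).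
  have cs := @cvg_big R 'I_n +%R 0 xpredT (fun q => add_continuous q) _ (nbhs x) (index_enum 'I_n)
    (fun i x => 1 * expR (aff (b i - y ord0 i *: cst1 R n) x) +
    1 * expR (aff (- (b i - y ord0 i *: cst1 R n)) x)) _ FF.
  apply: (@cvgMl_tmp _ _ _ FF); apply: cs => i _.
  exact: (@cvgD _ _ _ _ FF _ _ _ _ (@cvgMl_tmp _ _ _ FF _ _ _ (ce _)) (@cvgMl_tmp _ _ _ FF _ _ _ (ce _))).
have [B hB] := continuous_bounded_on_bounded bQ cpk.
have pky : pk y = - (2 * n%:R).
  rewrite /pk (eq_bigr (fun=> 2)) => [|i _].
    by rewrite sumr_const card_ord mulr_natr.
  by rewrite subrr /cosh2 oppr0 expR0.
pose g := (del / 2) ^+ 2.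
have g0 : 0 < g by rewrite /g exprn_gt0// divr_gt0.
have pk_out x : ~ ball y del x -> pk x <= - (2 * n%:R) - g.
  move=> nb; have [i xi] : exists i, del <= `|x ord0 i - y ord0 i|.
    apply: contrapT => nex; apply: nb; split => // i j; rewrite ord1 /ball/= distrC ltNge.
    by apply/negP => xj; apply: nex; exists j.
  rewrite /pk -opprD lerN2 (bigD1 i)//=.
  have h1 : 2 + g <= cosh2 (x ord0 i - y ord0 i).
    apply: le_trans (cosh2_ge _); rewrite lerD2l /g -[leRHS]real_normK ?num_real//.
    rewrite normrM [`|2^-1|]gtr0_norm// lerXn2r ?nnegrE ?divr_ge0 ?(ltW del0)//.
    by rewrite ler_pM2r.
  have h2 : 2 * n%:R - 2 <= \sum_(j | j != i) cosh2 (x ord0 j - y ord0 j).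
    have -> : 2 * n%:R - 2 = \sum_(j < n | j != i) (2 : R).
      rewrite sumr_const cardC1 card_ord /= -[RHS]mulr_natr.
      by have -> : n%:R = d'%:R + 1 :> R; [rewrite natr1|ring].
    apply: ler_sum => j _; apply: le_trans (cosh2_ge _); by rewrite lerDl sqr_ge0.
  lra.
(* Large enough that [C + pk] is nonnegative on [Q] and [k1] = B + 1 is positive. Outside the ball
   [C + pk] is at most [k1], on [W'] it exceeds [k2] > [k1]. *)
pose C := B + 2 * n%:R + g + 1.
have B0 : 2 * n%:R <= B by have := hB _ Qy; rewrite pky normrN ler_norml => /andP[].
pose k1 := C - 2 * n%:R - g; pose k2 := C - 2 * n%:R - g / 2.
have n0 : 0 <= n%:R :> R by [].
have k10 : 0 < k1 by rewrite /k1 /C; lra.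
have k12 : k1 < k2 by rewrite /k1 /k2; lra.
have [Mr hMr] := br.2.
pose G := ball y del `&` [set x | - (2 * n%:R) - g / 2 < pk x].
have /nbhs_ballP[e2 /= e20 he2] : \forall x \near y, - (2 * n%:R) - g / 2 < pk x.
  by move/cvgr_gt : (cpk y) => /(_ (- (2 * n%:R) - g / 2)); apply; rewrite pky; lra.
pose e3 := Num.min del e2.
have e30 : 0 < e3 by rewrite lt_min del0.
have [W' [oW' W'y] W'b] : exists2 W', open_nbhs y W' & W' `<=` ball y e3.
  by have := nbhsx_ballx y e3 e30; rewrite nbhsE => -[W' ? ?]; exists W'.
have W'del x : W' x -> ball y del x /\ - (2 * n%:R) - g / 2 < pk x.
  move=> /W'b bx; split; first by apply: le_ball bx; rewrite ge_min lexx.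
  by apply: he2; apply: le_ball bx; rewrite ge_min lexx orbT.
have bI : bm Q (\1_W').
  split; first by apply: measurable_indic; exact: measurable_rV_open.
  by exists 1 => x _; rewrite indicE; case: (_ \in _); rewrite ?normr1 ?normr0.
have m10 : 0 < wint p (\1_W').
  apply: (wint_gt0_open oQ bQ cp p0 pQ bI _ oW').
  - by move=> x _; rewrite indicE.
  - by exists y.
  - by move=> x /W'del[/hdel[]].
  - by exists 1 => // x W'x; rewrite indicE mem_set.
have bpk : bm Q pk by exact: bm_continuous.
pose eta := r y / 2.
have eta0 : 0 < eta by rewrite divr_gt0.
have Mr0 : 0 <= Mr by exact: le_trans (hMr _ Qy).
(* On [Q], r (C + pk)^k is at least eta k2^k on [W'], nonnegative on the ball and at least - Mr k1^k
   outside it. Since k1 < k2, this inequality fails for large k. *)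
have key k : eta * k2 ^+ k * wint p (\1_W') <= Mr * k1 ^+ k * wint p (fun=> 1).
  have : wint p (fun x => r x * (C + pk x) ^+ k) = 0.
    by apply: expspan_orth; apply: expspanX; apply: expspanD => //; exact: expspan_cst.
  have : wint p (fun x => eta * k2 ^+ k * \1_W' x - Mr * k1 ^+ k * 1) <= wint p (fun x => r x * (C + pk x) ^+ k).
    apply: (wint_le oQ bQ cp p0 pQ).
    - by apply: bmB; apply: bmZ => //; exact: bm_cst.
    - by apply: bmM => //; apply: bmX; apply: bmD => //; exact: bm_cst.
    move=> x Qx; rewrite mulr1.
    have Ck : 0 <= C + pk x.
      by have := hB _ Qx; rewrite ler_norml => /andP[? _]; rewrite /C; lra.
    have k1k : 0 <= Mr * k1 ^+ k by rewrite mulr_ge0// exprn_ge0// ltW.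
    rewrite indicE; have [xW|xW] := boolP (x \in W').
      rewrite inE in xW; have [bx pkx] := W'del _ xW; have [_ rx] := hdel _ bx.
      rewrite mulr1; apply: (@le_trans _ _ (eta * k2 ^+ k)); first by rewrite lerBlDr lerDl.
      apply: ler_pM; [exact: ltW| |exact: ltW|].
        by rewrite exprn_ge0// ltW// (lt_trans k10).
      rewrite lerXn2r ?nnegrE//; first by rewrite ltW// (lt_trans k10).
      by rewrite /k2; lra.
    rewrite mulr0 sub0r; have [bx|nbx] := pselect (ball y del x).
      have [_ rx] := hdel _ bx.
      apply: (@le_trans _ _ 0); first by rewrite oppr_le0.
      by rewrite mulr_ge0 ?exprn_ge0// ltW// (lt_trans eta0).
    rewrite -subr_ge0 opprK.
    have h1 : (C + pk x) ^+ k <= k1 ^+ k.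
      rewrite lerXn2r ?nnegrE//; first exact: ltW.
      by have := pk_out _ nbx; rewrite /k1; lra.
    have := hMr _ Qx; rewrite ler_norml => /andP[h2 h3].
    have h4 : 0 <= (C + pk x) ^+ k by rewrite exprn_ge0.
    move: h1 h4; move: (_ ^+ k) (k1 ^+ k) => s t st s0; nra.
  rewrite (wintB oQ bQ cp p0 pQ); try by apply: bmZ => //; exact: bm_cst.
  rewrite !(wintZ oQ bQ cp p0 pQ)//; last exact: bm_cst.
  lra.
have k20 : 0 < k2 by exact: lt_trans k12.
pose q := k1 / k2.
have q1 : `|q| < 1 by rewrite ger0_norm ?divr_ge0 ?ltW// ltr_pdivrMr// mul1r.
have cq : Mr * wint p (fun=> 1) * q ^+ k @[k --> \oo] --> (0 : R).
  by rewrite -(mulr0 (Mr * wint p (fun=> 1))); apply: cvgMl_tmp; exact: cvg_expr.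
have /(cvgr_lt _ cq)[k _ /(_ k (leqnn k))] : 0 < eta * wint p (\1_W') by rewrite mulr_gt0.
apply/negP; rewrite -leNgt /q expr_div_n.
have k2k : 0 < k2 ^+ k by rewrite exprn_gt0.
rewrite mulrA ler_pdivlMr//; have := key k; set X := k2 ^+ k; set Y := k1 ^+ k; lra.
Qed.

End orthogonality.

Lemma orth_eq0 r : bm Q r -> (forall x, Q x -> {for x, continuous r}) ->
  (forall a, wint p (fun x => r x * relu (aff a x)) = 0) -> forall x, Q x -> r x = 0.
Proof.
move=> br cr rO x Qx; apply/eqP; rewrite eq_le; apply/andP; split.
  by rewrite leNgt; apply/negP; exact: (orth_not_gt0 br cr rO Qx).
rewrite -oppr_le0 leNgt; apply/negP.
apply: (@orth_not_gt0 (fun x => - r x) _ _ _ x Qx); first exact: bmN.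
  by move=> y Qy; apply: continuousN; exact: cr.
move=> a; have ba : bm Q (fun x => r x * relu (aff a x)).
  apply: bmM => //; apply: bm_continuous => // z.
  exact: (cvg_relu (nbhs_filter z) (@continuous_aff R n a z)).
rewrite -[RHS](mulr0 (-1)) -(rO a) -(wintZ oQ bQ cp p0 pQ)//.
by congr wint; apply/funext => z; rewrite mulN1r mulNr.
Qed.

(** If the residual is not orthogonal to some neuron, then the loss along that neuron is a quadratic
    in its weight with nonzero derivative at 0. *)
Theorem wider_net_improves (f : 'rV[R]_n -> R) h phi : bm Q f ->
  (forall x, Q x -> {for x, continuous f}) -> netQ Q h phi -> 0 < loss p f phi ->
  exists2 psi, netQ Q h.+1 psi & loss p f psi < loss p f phi.
Proof.
move=> bf cf /netfP[c0 [c [a aE]]]; rewrite (eq_loss p0 pQ f aE).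
set N := netf c0 c a => lpos.
have crelu (b : 'rV[R]_n.+1) : continuous (fun x => relu (aff b x)).
  by move=> z; exact: (cvg_relu (nbhs_filter z) (@continuous_aff R n b z)).
have cN : continuous N.
  move=> x; have FF := nbhs_filter x.
  have cs := @cvg_big R 'I_h +%R 0 xpredT (fun q => add_continuous q) _ (nbhs x) (index_enum 'I_h)
    (fun i x => c i * relu (aff (a i) x)) _ FF.
  apply: (@cvgD _ _ _ _ FF); first exact: (@cvg_cst _ _ _ _ FF).
  by apply: cs => i _; exact: (@cvgMl_tmp _ _ _ FF _ _ _ (crelu (a i) x)).
have bN : bm Q N by exact: bm_continuous.
pose r x := N x - f x.
have br : bm Q r by exact: bmB.
have cr x : Q x -> {for x, continuous r}.
  by move=> Qx; apply: continuousB; [exact: cN|exact: cf].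
have [rO|] := pselect (forall b, wint p (fun x => r x * relu (aff b x)) = 0).
  exfalso; move: lpos; rewrite /loss (eq_wint p0 pQ (psi := fun=> 0)) ?(wint0 oQ bQ cp p0 pQ) ?ltxx//.
  by move=> x Qx; rewrite -/(r x) (orth_eq0 br cr rO Qx) expr0n.
move=> /existsNP[b /eqP Lb]; set L := wint p _ in Lb.
have bb : bm Q (fun x => relu (aff b x)) by exact: bm_continuous.
pose W := wint p (fun x => relu (aff b x) ^+ 2).
have W0 : 0 <= W by apply: (wint_ge0 p0 pQ) => x _; exact: sqr_ge0.
(* Near the minimizer - L / W of 2 t L + t^2 W; the + 1 covers W = 0, and the value is still
   negative. *)
pose t := - L / (W + 1).
exists (fun x => N x + t * relu (aff b x)).
  apply: (netQ_weaken (h := (h + 1)%N)); first by rewrite addn1.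
  by apply: netQD; [exact: netQ_netf|exact: netQ_neuron].
have -> : loss p f (fun x => N x + t * relu (aff b x)) = loss p f N + (2 * t * L + t ^+ 2 * W).
  have brb : bm Q (fun x => 2 * t * (r x * relu (aff b x))) by apply: bmZ; exact: bmM.
  have bW : bm Q (fun x => t ^+ 2 * relu (aff b x) ^+ 2) by apply: bmZ; exact: bmX.
  have e1 : 2 * t * L = wint p (fun x => 2 * t * (r x * relu (aff b x))).
    by rewrite (wintZ oQ bQ cp p0 pQ)//; exact: bmM.
  have e2 : t ^+ 2 * W = wint p (fun x => t ^+ 2 * relu (aff b x) ^+ 2).
    by rewrite (wintZ oQ bQ cp p0 pQ)//; exact: bmX.
  rewrite e1 e2 -(wintD oQ bQ cp p0 pQ)// /loss -(wintD oQ bQ cp p0 pQ)//.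
  - by congr wint; apply/funext => x; rewrite -/(r x) /r; ring.
  - exact: bmX.
  - exact: bmD.
rewrite gtrDl.
have W1 : 0 < W + 1 by lra.
have -> : 2 * t * L + t ^+ 2 * W = - (L ^+ 2 * (W + 2)) / (W + 1) ^+ 2.
  by rewrite /t; field; rewrite gt_eqF.
rewrite mulNr oppr_lt0 divr_gt0 ?exprn_gt0// mulr_gt0//; last by lra.
by rewrite exprn_even_gt0.
Qed.

End strict_descent.

(** * Transfer to the parametrised network *)

(** The change of variables is available for the Radon-Nikodym derivative, which agrees almost
    everywhere with the given density. *)
Lemma ge0_integral_density (R : realType) d (T : measurableType d)
    (nu : {finite_measure set T -> \bar R}) (lam : {sigma_finite_measure set T -> \bar R})
    (g : T -> R) (E : set T) (F : T -> \bar R) :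
  (forall x, 0 <= g x) -> measurable_fun setT g ->
  (forall B, measurable B -> nu B = \int[lam]_(x in B) (g x)%:E)%E ->
  (forall x, 0 <= F x)%E -> measurable E -> measurable_fun E F ->
  (\int[nu]_(x in E) F x = \int[lam]_(x in E) (F x * (g x)%:E))%E.
Proof.
move=> g0 mg nug F0 mE mF.
have nulam : nu `<< lam.
  apply/null_content_dominatesP => A mA lamA; rewrite nug//.
  by apply: null_set_integral => //; apply/measurable_EFinP/measurable_funTS.
rewrite -(Radon_Nikodym_SigmaFinite.change_of_variables nulam)//.
set r := Radon_Nikodym_SigmaFinite.f _ _.
have mr : measurable_fun setT r := measurable_int _ (Radon_Nikodym_SigmaFinite.f_integrable nulam).
have mgE : measurable_fun setT (fun x => (g x)%:E) by exact/measurable_EFinP.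
have rg : ae_eq lam setT r (fun x => (g x)%:E).
  apply: integral_ae_eq => //; first exact: Radon_Nikodym_SigmaFinite.f_integrable.
  by move=> A _ mA; rewrite -nug// -Radon_Nikodym_SigmaFinite.f_integral.
apply: ae_eq_integral => //.
- by apply: emeasurable_funM => //; exact: measurable_funTS.
- by apply: emeasurable_funM => //; exact: measurable_funTS.
- apply: filterS rg => x rgx Ex /=; by rewrite rgx.
Qed.

Lemma within_continuous_measurable_rV (R : realType) n (D : set 'rV[R]_n) (f : 'rV[R]_n -> R) :
  measurable D -> {within D, continuous f} -> measurable_fun D f.
Proof.
move=> mD /continuousP cf; apply: (measurability _ (RGenOpens.measurableE R)).
move=> _ [_ [a [b ->]] <-].
have /cf/open_subspaceP[U oU UD] : open `]a, b[%classic by exact: interval_open.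
rewrite setIC -UD; apply: measurableI => //; exact: measurable_rV_open.
Qed.

(** * Networks as parameter vectors with dead neurons *)

Section parameters.
Variables (R : realType) (d : nat) (Q : set 'rV[R]_d).
Hypothesis bQ : exists B, forall x, Q x -> forall i, `|x ord0 i| <= B.
Implicit Types (phi psi : 'rV[R]_d -> R).

Definition param h (th : 'rV[R]_(nn_dim d h)) k : R := th ord0 (inord k).

Definition preact h (th : 'rV[R]_(nn_dim d h)) i (x : 'rV[R]_d) :=
  param th (d * h + i)%N + \sum_(j < d) param th (i * d + j)%N * x ord0 j.

Lemma nnE h (th : 'rV[R]_(nn_dim d h)) x :
  nn (@relu R) th x = param th (d * h + 2 * h)%N +
    \sum_(i < h) param th (d * h + h + i)%N * relu (preact th i x).
Proof. by []. Qed.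

Lemma nn_netQ h H (th : 'rV[R]_(nn_dim d H)) : (h <= H)%N ->
  (forall i x, (h <= i < H)%N -> Q x -> preact th i x <= 0) -> netQ Q h (nn (@relu R) th).
Proof.
move=> hH dead.
pose c i := param th (d * H + H + i)%N.
pose a i : 'rV[R]_d.+1 :=
  \row_k oapp (fun j : 'I_d => param th (i * d + j)%N) (param th (d * H + i)%N) (unlift ord0 k).
have aE i x : aff (a i) x = preact th i x.
  rewrite affE /preact mxE unlift_none; congr (_ + _).
  by apply: eq_bigr => j _; rewrite mxE liftK.
apply: netQ_eq (netQ_netf Q (param th (d * H + 2 * H)%N) (fun i : 'I_h => c i) (fun i : 'I_h => a i)).
move=> x Qx; rewrite nnE /netf; congr (_ + _).
rewrite (big_ord_widen _ (fun i => c i * relu (aff (a i) x)) hH) big_mkcond.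
apply: eq_bigr => i _; rewrite aE; case: ltnP => // hi.
by rewrite [in RHS]relu_le0 ?mulr0// dead// hi ltn_ord.
Qed.

Lemma netQ_nn h H phi : (h <= H)%N -> netQ Q h phi -> exists th : 'rV[R]_(nn_dim d H),
  (forall x, Q x -> nn (@relu R) th x = phi x) /\
  forall i x, (h <= i < H)%N -> preact th i x = -1.
Proof.
move=> hH [c0 [s [sh sE]]].
(* Padding neurons have outer weight 0 and constant preactivation -1, hence are dead with a
   margin. *)
pose q i := nth (0, - cst1 R d) s i.
(* Decodes the parameter layout; inner weight i * d + j is recovered by division. The sum has one
   term and serves to turn the remainder into an index of type ['I_d]. *)
pose par (k : nat) := if (k < d * H)%N then \sum_(j < d | (j == k %% d :> nat)%N) (q (k %/ d)%N).2 ord0 (lift ord0 j)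
  else if (k < d * H + H)%N then (q (k - d * H)%N).2 ord0 ord0
  else if (k < d * H + 2 * H)%N then (q (k - (d * H + H))%N).1 else c0.
pose th : 'rV[R]_(nn_dim d H) := \row_i par i.
have thE k : (k <= d * H + 2 * H)%N -> param th k = par k.
  by move=> kH; rewrite /param mxE inordK.
have aE i x : (i < H)%N -> preact th i x = aff (q i).2 x.
  move=> iH; rewrite affE /preact; congr (_ + _).
    rewrite thE /par; last by lia.
    by rewrite ltnNge leq_addr/= ltn_add2l iH addKn.
  apply: eq_bigr => j _; congr (_ * _).
  have jd := ltn_ord j.
  have ijH : (i * d + j < d * H)%N.
    apply: (@leq_trans (i.+1 * d)); first by rewrite mulSn addnC ltn_add2r.
    by rewrite mulnC leq_mul2l iH orbT.
  rewrite thE /par ?ijH; last by rewrite ltnW// (leq_trans ijH)// leq_addr.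
  rewrite modnMDl modn_small// divnMDl; last exact: leq_ltn_trans jd.
  rewrite divn_small// addn0 (big_pred1 j)// => k; exact/eqP/eqP/val_inj.
exists th; split.
  move=> x Qx; rewrite sE// nnE; congr (_ + _).
    by rewrite thE// /par ltnNge leq_addr/= ltn_add2l ltnNge leq_pmull//= ltnn.
  rewrite (big_nth (0, - cst1 R d)) big_mkord.
  rewrite (big_ord_widen _ (fun i => (q i).1 * relu (aff (q i).2 x)) (leq_trans sh hH)).
  rewrite [RHS]big_mkcond; apply: eq_bigr => i _; have iH := ltn_ord i.
  rewrite aE// thE /par; last by lia.
  rewrite ifF; last by lia.
  rewrite ifF; last by lia.
  rewrite ifT; last by lia.
  rewrite addKn; case: ltnP => // si.
  by rewrite /q nth_default//= mul0r.
move=> i x /andP[hi iH]; rewrite aE// /q nth_default; last exact: leq_trans hi.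
by rewrite affN aff_cst1.
Qed.

Lemma near_preact_dead H (th : 'rV[R]_(nn_dim d H)) (h : nat) :
  (forall i x, (h <= i < H)%N -> preact th i x = -1) ->
  \forall y \near th, forall i x, (h <= i < H)%N -> Q x -> preact y i x <= 0.
Proof.
move=> dead; have [B QB] := bQ.
pose B' := Num.max B 0.
have B'0 : 0 <= B' by rewrite le_max lexx orbT.
(* With each parameter off by at most this radius, a preactivation on [Q] moves by at most radius *
   (1 + d B') = 1, and so stays nonpositive. *)
have e0 : 0 < (1 + d%:R * B')^-1 by rewrite invr_gt0 ltr_wpDr// mulr_ge0.
have := nbhsx_ballx th _ e0; apply: filterS => y thy i x hi Qx.
have par_close k : `|param y k - param th k| <= (1 + d%:R * B')^-1.
  by have := thy.2 ord0 (inord k); rewrite /ball/= distrC => /ltW.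
suff : preact y i x - preact th i x <= 1 by rewrite dead//; lra.
rewrite /preact opprD addrACA -sumrB.
apply: (@le_trans _ _ ((1 + d%:R * B')^-1 + \sum_(j < d) (1 + d%:R * B')^-1 * B')).
  apply: lerD; first exact: le_trans (ler_norm _) _.
  apply: ler_sum => j _; rewrite -mulrBl; apply: le_trans (ler_norm _) _.
  by rewrite normrM ler_pM// le_max QB.
rewrite sumr_const card_ord -[X in _ + X <= _]mulr_natl mulrCA -[X in X + _ <= _]mulr1 -mulrDr mulVf//.
by rewrite gt_eqF// -invr_gt0.
Qed.

End parameters.

Section cubes.
Variables (R : realType) (d : nat) (a b : R).
Local Notation Q := (@open_cube R d a b).

Lemma open_open_cube : open Q.
Proof.
rewrite openE => x Qx; 
apply: (@filter_forall _ _ (fun i => [set y : 'rV[R]_d | y ord0 i \in `]a, b[]) _ (nbhs_filter x)) => i.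
have oab : open `]a, b[%classic by exact: interval_open.
exact: (@coord_continuous R 1 d ord0 i x _ (open_nbhs_nbhs (conj oab (Qx i)))).
Qed.

Lemma open_cube_sub : Q `<=` cube d a b.
Proof. by move=> x Qx i; have := Qx i; rewrite !in_itv/= => /andP[/ltW-> /ltW->]. Qed.

Lemma cube_bounded x : cube d a b x -> forall i, `|x ord0 i| <= `|a| + `|b|.
Proof.
move=> Cx i; have := Cx i; rewrite in_itv/= => /andP[ax xb].
have := ler_norm b; have := ler_norm (- a); rewrite normrN ler_norml.
have := normr_ge0 a; have := normr_ge0 b; lra.
Qed.

Lemma open_cube_bounded : exists B, forall x, Q x -> forall i, `|x ord0 i| <= B.
Proof. by exists (`|a| + `|b|) => x /open_cube_sub; exact: cube_bounded. Qed.

Lemma open_cube_convex x y t : Q x -> Q y -> 0 <= t <= 1 -> Q (x + t *: (y - x)).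
Proof.
move=> Qx Qy /andP[t0 t1] i; have := Qx i; have := Qy i; rewrite !in_itv/= !mxE.
move: (x _ _) (y _ _) => u v /andP[av vb] /andP[au ub].
have [->|tn0] := eqVneq t 0; first by rewrite mul0r addr0 au.
have t0' : 0 < t by rewrite lt_def tn0.
by apply/andP; split; nra.
Qed.

Lemma compact_cube : compact (cube d a b).
Proof. by apply: (@rV_compact _ _ (fun=> `[a, b]%classic)) => _; exact: segment_compact. Qed.

Lemma measurable_cube : measurable (cube d a b).
Proof. exact: (@measurable_rV_box R d (fun=> a) (fun=> b)). Qed.

Lemma center_open_cube : a < b -> Q (const_mx ((a + b) / 2)).
Proof. by move=> ab i; rewrite mxE in_itv/=; apply/andP; split; lra. Qed.

End cubes.

(** * From the measure on the cube to the weighted integral *)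

Section density.
Variables (R : realType) (d : nat) (a b : R).
Local Notation Q := (@open_cube R d a b).
Local Notation K := (@cube R d a b).
Variables (mu : {measure set 'rV[R]_d -> \bar R}) (f : 'rV[R]_d -> R) (p : 'rV[R]_d -> R).
Hypothesis cf : {within K, continuous f}.
Hypotheses (cp : continuous p) (p0 : forall x, 0 <= p x) (pQ : forall x, 0 < p x <-> Q x).
Hypothesis hmu : forall B : set 'rV[R]_d, measurable B -> B `<=` K ->
  mu B = (\int[lebesgue_rV d]_(x in B) (p x)%:E)%E.
Local Notation mK := (@measurable_cube R d a b).
Local Notation oQ := (@open_open_cube R d a b).
Local Notation bQ := (@open_cube_bounded R d a b).

(** Continuity of [f] is given only within the cube; the extension by 0 is measurable everywhere and
    continuous at the points of the open cube. *)
Definition on_cube : 'rV[R]_d -> R := f \_ K.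

Lemma on_cubeE x : K x -> on_cube x = f x.
Proof. by move=> Kx; rewrite /on_cube patchE mem_set. Qed.

Lemma on_cube_continuous x : Q x -> {for x, continuous on_cube}.
Proof.
move=> Qx; have : {within K, continuous on_cube}.
  by apply: subspace_eq_continuous cf => y /set_mem Ky; rewrite /from_subspace on_cubeE.
move=> /(continuous_subspaceW (@open_cube_sub R d a b)).
rewrite continuous_open_subspace; last exact: open_open_cube.
by apply; rewrite inE.
Qed.

Lemma bm_on_cube : bm Q on_cube.
Proof.
split.
  apply/(measurable_restrictT f mK); exact: within_continuous_measurable_rV mK cf.
have : bounded_set (f @` K).
  by apply: compact_bounded; apply: continuous_compact; [exact: cf|exact: compact_cube].
move=> [M [_ hM]]; exists (M + 1) => x /open_cube_sub Kx; rewrite on_cubeE//.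
by apply: (hM (M + 1)); [rewrite ltrDl|exists x].
Qed.

Lemma integral_cube_wint (phi : 'rV[R]_d -> R) : bm Q phi ->
  (\int[mu]_(x in K) ((phi x - f x) ^+ 2)%:E)%E =
    (wint p (fun x => (phi x - on_cube x) ^+ 2))%:E.
Proof.
move=> bphi; set F := fun x => _ ^+ 2.
have bF : bm Q F by apply: bmX; apply: bmB => //; exact: bm_on_cube.
have pK x : ~ K x -> p x = 0.
  by move=> nK; apply: (weight_eq0 p0 pQ) => /open_cube_sub.
have mp : measurable_fun setT p := continuous_measurable_rVR cp.
have nuE B : measurable B -> mrestr mu mK B = (\int[lebesgue_rV d]_(x in B) (p x)%:E)%E.
  move=> mB; rewrite /mrestr hmu; [|exact: measurableI mB mK|exact: subIsetr].
  rewrite integral_mkcondr; apply: eq_integral => x _; rewrite patchE.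
  by case: ifPn => //; rewrite notin_setE => /pK->.
have finK B : measurable B -> mrestr mu mK B \is a fin_num.
  move=> mB; rewrite ge0_fin_numE ?measure_ge0// nuE//.
  apply: (@le_lt_trans _ _ (\int[lebesgue_rV d]_x (p x)%:E)%E).
    apply: ge0_subset_integral => //; first exact/measurable_EFinP.
    by move=> x _; rewrite lee_fin.
  have /integrableP[_] := bm_integrable oQ bQ cp p0 pQ (bm_cst Q 1).
  by under eq_integral => x _ do rewrite /= mul1r ger0_norm//.
(* [mu] is prescribed only inside the cube; restricted to it, it is a finite measure with density
   [p]. *)
pose nu : {finite_measure set 'rV[R]_d -> \bar R} :=
  HB.pack (mrestr mu mK) (Measure_isFinite.Build _ _ _ (mrestr mu mK) finK).
transitivity (\int[nu]_(x in K) (F x)%:E)%E.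
  rewrite [RHS](@eq_measure_integral _ _ _ _ mu); last first.
    by move=> A mA AK; rewrite /nu/= /mrestr setIidl.
  by apply: eq_integral => x /set_mem Kx; rewrite /F on_cubeE.
have mF : measurable_fun setT (EFin \o F) by apply/measurable_EFinP; exact: bF.1.
rewrite (ge0_integral_density (nu := nu) (lam := lebesgue_rV d) p0 mp)//=.
- rewrite /wint /Rintegral fineK; last first.
    exact/integrable_fin_num/(bm_integrable oQ bQ cp p0 pQ bF).
  rewrite [LHS]integral_mkcond; apply: eq_integral => x _; rewrite patchE.
  by case: ifPn => //; rewrite notin_setE => /pK->; rewrite mulr0.
- by move=> x; rewrite lee_fin sqr_ge0.
- exact: mK.
- exact: measurable_funTS.
Qed.

End density.

Lemma inf_range_eq0 (R : realType) (T : Type) (L : T -> R) t :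
  (forall s, 0 <= L s) -> L t = 0 -> inf (range L) = 0.
Proof.
move=> L0 Lt; apply/eqP; rewrite eq_le; apply/andP; split.
  by rewrite -Lt; apply: ge_inf; [exists 0 => _ [s _ <-]|exists t].
by apply: lb_le_inf; [exists (L t), t|move=> _ [s _ <-]].
Qed.

Theorem corollary3p17 (R : realType) (d : nat) (hd : (0 < d)%N)
    (a b : R) (hab : a <= b)
    (mu : {measure set 'rV[R]_d -> \bar R})
    (f : 'rV[R]_d -> R) (hf : {within cube d a b, continuous f})
    (sigma : R -> R) (hsigma : forall x, sigma x = Num.max x 0)
    (L : forall h : nat, 'rV[R]_(nn_dim d h) -> R)
    (hL : forall (h : nat) (th : 'rV[R]_(nn_dim d h)),
      (L h th)%:E =
      (\int[mu]_(x in cube d a b) ((nn sigma th x - f x) ^+ 2)%:E)%E)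
    (p : 'rV[R]_d -> R) (hp_ge0 : forall x, 0 <= p x) (hp : continuous p)
    (hp_pos : p @^-1` [set y | 0 < y] = open_cube d a b)
    (hmu : forall B : set 'rV[R]_d, measurable B -> B `<=` cube d a b ->
      mu B = (\int[lebesgue_rV d]_(x in B) (p x)%:E)%E)
    (H n : nat)
    (hn : n%:R%:E = Order.min (H%:R%:E) (least_width L)) :
  exists v : nat -> 'rV[R]_(nn_dim d H),
    (forall h : nat, (h <= n)%N -> local_minimum (L H) (v h)) /\
    ((L H (v 0%N))%:E <=
      ereal_inf [set (\int[mu]_(x in cube d a b) (`|f x - xi| ^+ 2)%:E)%E
                | xi in [set: R]])%E /\
    (forall h : nat, (h < n)%N -> L H (v h.+1) < L H (v h)).
Proof.
case: d hd mu f hf L hL p hp_ge0 hp hp_pos hmu hn => // d _ mu f cf L hL p p0 cp pos hmu hn.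
have {hsigma} hsigma : sigma = @relu R by apply/funext => x; rewrite hsigma.
rewrite {sigma}hsigma in hL.
have pQ x : 0 < p x <-> open_cube d.+1 a b x by rewrite -pos.
pose oQ := @open_open_cube R d.+1 a b; pose bQ := @open_cube_bounded R d.+1 a b.
pose f' := on_cube a b f.
have bf : bm (open_cube d.+1 a b) f' by exact: bm_on_cube.
have cf' x : open_cube d.+1 a b x -> {for x, continuous f'} by exact: on_cube_continuous.
have LE h th : L h th = loss p f' (nn (@relu R) th).
  apply: EFin_inj; rewrite hL (integral_cube_wint cf cp p0 pQ hmu)//.
  have /netfP[c0 [c [al alE]]] : netQ setT h (nn (@relu R) th).
    by apply: nn_netQ => // i x /andP[hi]; rewrite ltnNge hi.
  have -> : nn (@relu R) th = netf c0 c al by apply/funext => x; exact: alE.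
  exact: bm_netf.
have L0 h th : 0 <= L h th by rewrite LE; exact: (loss_ge0 p0 pQ).
have cst_integral xi : (\int[mu]_(x in cube d.+1 a b) (`|f x - xi| ^+ 2)%:E)%E =
    (loss p f' (fun=> xi))%:E.
  rewrite /loss -(integral_cube_wint cf cp p0 pQ hmu)//; last exact: bm_cst.
  by apply: eq_integral => x _; rewrite real_normK ?num_real// -sqrrN opprB.
have hnH : (n <= H)%N.
  by rewrite -(ler_nat R) -lee_fin hn ge_min lexx.
have hnw : (n%:R%:E <= least_width L)%E by rewrite hn ge_min lexx orbT.
have width_le h th : L h th = 0 -> (n <= h)%N.
  move=> Lh; rewrite -(ler_nat R) -lee_fin; apply: le_trans hnw _.
  by apply: ereal_inf_lbound; left; exists h => //=; exact: inf_range_eq0 Lh.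
(* In the degenerate case the open cube is empty, so every loss is 0 and n = 0. *)
have [ab|ab] := ltP a b; last first.
  have L00 h th : L h th = 0.
    rewrite LE /loss (eq_wint p0 pQ (psi := fun=> 0)) ?(wint0 oQ bQ cp p0 pQ)// => x /(_ ord0).
    by rewrite in_itv/= => /andP[/lt_trans h1 /h1]; rewrite ltNge ab.
  have n0 : n = 0%N by apply/eqP; rewrite -leqn0; exact: width_le (L00 0%N 0).
  exists (fun=> 0); split; [|split].
  - by move=> h _; apply: (@filterE _ _ (nbhs_filter (0 : 'rV[R]_(nn_dim d.+1 H)))) => y; rewrite !L00.
  - apply: le_ereal_inf_tmp => _ [xi _ <-]; rewrite L00; apply: integral_ge0 => x _.
    by rewrite lee_fin sqr_ge0.
  - by move=> h; rewrite n0.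
have /choice[phi phiP] : forall h, exists phi : 'rV[R]_d.+1 -> R,
    netQ (open_cube d.+1 a b) h phi /\
    forall psi, netQ (open_cube d.+1 a b) h psi -> loss p f' phi <= loss p f' psi.
  move=> h; have [phi] := exists_minimizer oQ bQ (@open_cube_convex R d.+1 a b)
    (center_open_cube ab) cp p0 pQ bf cf' h.
  by exists phi.
have /choice[v vP] : forall h, exists v : 'rV[R]_(nn_dim d.+1 H), (h <= H)%N ->
    (forall x, open_cube d.+1 a b x -> nn (@relu R) v x = phi h x) /\
    forall i x, (h <= i < H)%N -> preact v i x = -1.
  move=> h; have [hH|hH] := leqP h H; last by exists 0.
  by have [th ?] := netQ_nn hH (phiP h).1; exists th.
have LvE h : (h <= H)%N -> L H (v h) = loss p f' (phi h).
  by move=> hH; rewrite LE; apply: (eq_loss p0 pQ) => x Qx; exact: (vP h hH).1.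
exists v; split; [|split].
- move=> h hn'; have hH := leq_trans hn' hnH.
  (* Near [v h] the neurons from h on remain dead on the open cube, so nearby networks have width h
     there and cannot beat [phi h]. *)
  have := near_preact_dead bQ (vP h hH).2; apply: filterS => y ydead.
  rewrite LvE// LE; apply: (phiP h).2; exact: nn_netQ.
- apply: le_ereal_inf_tmp => _ [xi _ <-]; rewrite cst_integral lee_fin LvE//.
  apply: (phiP 0%N).2; exact: netQ_cst.
- move=> h hn'; have hH := leq_trans hn' hnH; rewrite !LvE//; last exact: ltnW.
  have [th [thE _]] := netQ_nn (leqnn h) (phiP h).1.
  have pos_loss : 0 < loss p f' (phi h).
    rewrite lt_def (loss_ge0 p0 pQ) andbT; apply/eqP => l0.
    (* A vanishing loss at width h would give n <= h; here h < n. *)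
    have /width_le : L h th = 0.
      by rewrite LE -l0; exact: (eq_loss p0 pQ).
    by rewrite leqNgt hn'.
  have [psi npsi] := wider_net_improves oQ bQ cp p0 pQ bf cf' (phiP h).1 pos_loss.
  by apply: le_lt_trans; exact: (phiP h.+1).2.
Qed.
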